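(* Let $T\ge 1$ be an integer and $\delta\in(0,1)$. Let $f:\mathbb{R}^d\to\mathbb{R}$ be $(L_0,L_1)$-smooth and convex with a minimizer $x^*$ (so $f(x^* )=f^*$), and suppose that Assumptions 1, 2 and 3 hold (with constants $A,B,C>0$). Put $\overline{\Delta}_1=f(x_1)-f^*$ and $$\overline{\Delta}_a=\frac85\overline{\Delta}_1+\frac85\log\frac T\delta+\frac85+\frac{303L_0}{1120L_1^2},\qquad \mathcal{M}_a=\frac{L_0}{8L_1}+\frac94\sqrt{L_0\overline{\Delta}_a+L_1^2\overline{\Delta}_a^2},$$ $$P_a=\sqrt{A\overline{\Delta}_a+4B(L_0\overline{\Delta}_a+L_1^2\overline{\Delta}_a^2)+C},\qquad \mathcal{H}=\log\left(1+\frac{2T\left(A\overline{\Delta}_a+4(B+1)(L_0\overline{\Delta}_a+L_1^2\overline{\Delta}_a^2)+C\right)}{G_0^2}\right).$$ Let $\{\overline{x}_t\}_{t\in[T]}$ be generated by AdaGrad-Norm or by RSAG with the adaptive step size $\eta_t=\eta/\left(G_0^2+\sum_{k=1}^t\|g_k\|^2\right)^{1/2}$, where $$G_0>0,\qquad 0<\eta\le\min\left\{\frac{1}{2\sqrt{(L_0+L_1\mathcal{M}_a)\mathcal{H}}},\frac{1}{8P_a\mathcal{H}},\frac{1}{3P_a},\frac{1}{8L_1}\right\}.$$ Define $$A_{T,\delta}=16\log\left(\frac{60\log_2(4T)\log(6T)}{\delta}\right),\quad B_{T,\delta}=16\log^2\left(\frac{60\log_2(4T)\log(6T)}{\delta}\right),\quad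 \mathcal{W}_a=\frac{\eta\sqrt{A\overline{\Delta}_a+C}}{G_0}+\eta\sqrt B,$$ $$R_a=2\eta^2\log\left(1+\frac{TP_a^2}{2G_0^2}\right)+\frac{7\eta^2}{G_0^2}P_a^2\log\frac T\delta,$$ $$D_a^2=2\|x_1-x^*\|^2+4R_a+10\eta^2\mathcal{H}+\frac{\eta^2}{2}+32\left(A_{T,\delta}R_a+\mathcal{W}_a^2B_{T,\delta}\right)+\frac{8}{\eta^2}R_a^2,\quad D_a>0.$$ Then, with probability at least $1-4\delta$, $$\begin{aligned}f\left(\frac1T\sum_{t=1}^T\overline{x}_t\right)-f^*\le{}&\left(12\left(A+4B(L_0+L_1^2\overline{\Delta}_a)\right)\left(D_a+\frac1{8L_1}\right)^2\log\frac1\delta+\frac{2G_0\|x_1-x^*\|^2}{\eta}\right)\frac1T\\&+\left(4\left(2\eta+\frac{D_a^2}{\eta}+\eta\mathcal{H}\right)^2\left(A+4(B+1)(L_0+L_1^2\overline{\Delta}_a)\right)+4\eta\mathcal{H}G_0\right)\frac1T\\&+\frac{7\left(D_a+\frac1{8L_1}\right)\sqrt{C\log\frac1\delta}+4\left(2\eta+\frac{D_a^2}{\eta}+\eta\mathcal{H}\right)\sqrt{2C}}{\sqrt T}.\end{aligned}$$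
   Context: Notation: $\|\cdot\|$ is the Euclidean norm on $\mathbb{R}^d$, $[T]=\{1,\dots,T\}$, $\log$ is the natural logarithm. The objective is $f(x)=\mathbb{E}_{z\sim\mathcal D}[f_z(x;z)]$, differentiable, with stochastic gradient oracle $\nabla f_z(x;z)$; $z_1,\dots,z_T$ are independent samples from $\mathcal D$. $(L_0,L_1)$-smoothness ($L_0,L_1>0$): $\|\nabla f(x)-\nabla f(y)\|\le (L_0+L_1\|\nabla f(x)\|)\|x-y\|$ for all $x,y\in\mathbb{R}^d$ with $\|x-y\|\le 1/L_1$. Assumption 1: $f^*:=\inf_{x}f(x)>-\infty$. Assumption 2: $\mathbb{E}_z[\nabla f_z(x;z)]=\nabla f(x)$ for all $x$. Assumption 3: for constants $A,B,C>0$, for all $x$, almost surely $\|\nabla f_z(x;z)-\nabla f(x)\|^2\le A(f(x)-f^* )+B\|\nabla f(x)\|^2+C$. Generic AGD template: given (deterministic) $\tilde x_1=x_1\in\mathbb{R}^d$, $\alpha_t\in(0,1]$ and step sizes $\theta_t,\gamma_t$, for $t=1,\dots,T$: $\overline{x}_t=\alpha_tx_t+(1-\alpha_t)\tilde x_t$; $g_t=\nabla f_z(\overline{x}_t;z_t)$; $x_{t+1}=x_t-\theta_tg_t$; $\tilde x_{t+1}=\overline{x}_t-\gamma_tg_t$. RSAG with adaptive step size: $\theta_t=\eta_t$, $\alpha_t=\frac{2}{t+1}$, $\gamma_t=(1+\alpha_t)\theta_t$. AdaGrad-Norm: $\gamma_t=\theta_t=\eta_t$ (so $\overline{x}_t=x_t$).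 Here $\eta_t=\eta/(G_0^2+\sum_{k=1}^t\|g_k\|^2)^{1/2}$ with constants $\eta,G_0>0$. *)

(* Defs.v *)
From mathcomp Require Export all_boot all_order all_algebra finmap.
From mathcomp Require Export all_classical all_reals all_analysis.

Set Implicit Arguments.
Unset Strict Implicit.
Unset Printing Implicit Defensive.

Export Order.TTheory GRing.Theory Num.Theory.
Export numFieldNormedType.Exports.

Open Scope classical_set_scope.
Open Scope ring_scope.

(* The library norm `|x| on 'rV[R]_d is the sup norm, hence this definition. *)
Definition enorm (R : realType) (d : nat) (x : 'rV[R]_d) : R :=
  Num.sqrt (\sum_(i < d) x 0 i ^+ 2).

Definition grad (R : realType) (d : nat) (f : 'rV[R]_d -> R) (x : 'rV[R]_d) :
    'rV[R]_d :=
  \row_(i < d) 'D_(delta_mx 0 i) f x.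

Definition borelRV (R : realType) (d : nat) :=
  g_sigma_algebraType (@open 'rV[R]_d).

Definition L0L1_smooth (R : realType) (d : nat) (L0 L1 : R)
    (f : 'rV[R]_d -> R) : Prop :=
  (forall x, differentiable f x) /\
  (forall x y, enorm (x - y) <= L1^-1 ->
    enorm (grad f x - grad f y) <= (L0 + L1 * enorm (grad f x)) * enorm (x - y)).

(* The oracle G is a measurable version of the gradient in x of fz(x; z): at
   every point x they agree for D-almost every z. *)
Definition gradient_oracle (R : realType) (d : nat) (dZ : measure_display)
    (Z : measurableType dZ) (D : probability Z R)
    (fz : 'rV[R]_d -> Z -> R) (G : 'rV[R]_d -> Z -> 'rV[R]_d) : Prop :=
  measurable_fun [set: borelRV R d * Z]
    (fun p => G p.1 p.2 : borelRV R d) /\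
  (forall x, {ae D, forall z,
    differentiable (fz ^~ z) x /\ G x z = grad (fz ^~ z) x}).

Definition iid_samples (R : realType) (dO dZ : measure_display)
    (Omega : measurableType dO) (Z : measurableType dZ)
    (P : probability Omega R) (D : probability Z R) (T : nat)
    (z : nat -> {RV P >-> Z}) : Prop :=
  (forall t (S : set Z), (1 <= t <= T)%N -> measurable S ->
    distribution P (z t) S = D S) /\
  (forall (J : {fset nat}) (S : nat -> set Z),
    (forall t, t \in J -> (1 <= t <= T)%N) ->
    (forall t, measurable (S t)) ->
    P (\bigcap_(t in [set` J]) z t @^-1` S t) =
    (\prod_(t <- J) P (z t @^-1` S t))%E).

Definition agd (R : realType) (d : nat) (Omega Z : Type)
    (G : 'rV[R]_d -> Z -> 'rV[R]_d) (z : nat -> Omega -> Z) (T : nat)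
    (x1 : 'rV[R]_d) (alpha : nat -> R) (theta gamma : nat -> Omega -> R)
    (x xtilde xbar g : nat -> Omega -> 'rV[R]_d) : Prop :=
  [/\ forall t, (1 <= t <= T)%N -> 0 < alpha t <= 1,
      forall w, x 1%N w = x1 /\ xtilde 1%N w = x1
    & forall t w, (1 <= t <= T)%N ->
      [/\ xbar t w = alpha t *: x t w + (1 - alpha t) *: xtilde t w,
          g t w = G (xbar t w) (z t w),
          x t.+1 w = x t w - theta t w *: g t w
        & xtilde t.+1 w = xbar t w - gamma t w *: g t w]].

Definition adaptive_step (R : realType) (d : nat) (Omega : Type) (eta G0 : R)
    (g : nat -> Omega -> 'rV[R]_d) (t : nat) (w : Omega) : R :=
  eta / Num.sqrt (G0 ^+ 2 + \sum_(1 <= k < t.+1) enorm (g k w) ^+ 2).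

Definition rsag (R : realType) (d : nat) (Omega Z : Type)
    (G : 'rV[R]_d -> Z -> 'rV[R]_d) (z : nat -> Omega -> Z) (T : nat)
    (x1 : 'rV[R]_d) (eta G0 : R)
    (x xtilde xbar g : nat -> Omega -> 'rV[R]_d) : Prop :=
  let alpha := fun t => 2 / t.+1%:R in
  let theta := adaptive_step eta G0 g in
  agd G z T x1 alpha theta (fun t w => (1 + alpha t) * theta t w)
    x xtilde xbar g.

(* As gamma = theta, xbar t = x t whatever the weights alpha are. *)
Definition adagrad_norm (R : realType) (d : nat) (Omega Z : Type)
    (G : 'rV[R]_d -> Z -> 'rV[R]_d) (z : nat -> Omega -> Z) (T : nat)
    (x1 : 'rV[R]_d) (eta G0 : R)
    (x xtilde xbar g : nat -> Omega -> 'rV[R]_d) : Prop :=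
  exists alpha : nat -> R,
    agd G z T x1 alpha (adaptive_step eta G0 g) (adaptive_step eta G0 g)
      x xtilde xbar g.

(* Main.v *)
(* Both algorithms are normalized gradient iterations x_{t+1} = x_t - eta_t g_t
   whose query points xbar_t stay within eta of x_t, the squared deviations
   being summed up by those of the steps.  Four events, each failing with
   probability at most delta by Ville's inequality for an exponential
   supermartingale (the noise xi_t is conditionally centered and bounded by
   sigma(xbar_t)), then yield a deterministic argument.
   1. Testing xi_t against grad f(xbar_t), weighted by a predictable proxy of
      eta_t, turns the descent lemma into an induction showing that
      f(xbar_t) - f^* never exceeds \overline\Delta_a; there the gradients are
      bounded and f is effectively smooth.
   2. Testing against grad f(xbar_t) alone shows that the accumulated |g_t|^2
      dominates the accumulated |xi_t|^2 up to a logarithm, so that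
      sum eta_{t-1}^2 |xi_t|^2 <= R_a.
   3. Testing against xbar_t - x^*, weighted by eta_{t-1}, bounds |x_t - x^*| by
      D_a by induction; a self-normalized exponent brings in the budget R_a.
   4. Testing against xbar_t - x^* controls the noise in the regret, which is
      summed by parts with the nondecreasing weights 1 / eta_t; convexity passes
      to the average. *)
From HB Require Import structures.
Require Import Defs.
From mathcomp Require Import ring lra zify measurable_realfun.
Set Implicit Arguments.
Unset Strict Implicit.
Unset Printing Implicit Defensive.

(** * Euclidean geometry and smooth functions *)

(** The step [eta_t] depends on the current sample, so a noise sum weighted by it is not a
    martingale. In stages 1 and 3 it is replaced by a weight known before the sample is drawn; the
    mismatch is of second order in stage 1 and telescopes in stage 3. A second obstacle is circular:
    the noise is bounded by [Pa] only while the values stay below the level that stage 1 has to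
    establish. The exponents are therefore compensated by [noise_bound] at the actual query point,
    which makes them supermartingale increments without any assumption on the path. The constant
    [Pa] replaces it only pathwise, where the values involved are already controlled. In the same
    way the self-normalized exponent is truncated, and the truncation is shown to be inactive inside
    the distance induction. All four events have level [l = ln (1 / delta)]. The claim has content
    only for [delta < 1 / 4], and there [1 <= l], which lets [l] absorb numerical constants; the
    larger logarithms of the statement enter by monotonicity. *)

Definition dot (R : realType) (d : nat) (u v : 'rV[R]_d) : R :=
  \sum_(i < d) u 0 i * v 0 i.

Section euclid.
Variables (R : realType) (d : nat).
Implicit Types (u v w : 'rV[R]_d) (a : R).

Lemma dotC u v : dot u v = dot v u.
Proof. by apply: eq_bigr => i _; rewrite mulrC. Qed.

Lemma dotDl u v w : dot (u + v) w = dot u w + dot v w.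
Proof. by rewrite -big_split; apply: eq_bigr => i _; rewrite mxE mulrDl. Qed.

Lemma dotZl a u v : dot (a *: u) v = a * dot u v.
Proof. by rewrite mulr_sumr; apply: eq_bigr => i _; rewrite mxE mulrA. Qed.

Lemma dotNl u v : dot (- u) v = - dot u v.
Proof. by rewrite -scaleN1r dotZl mulN1r. Qed.

Lemma dotDr u v w : dot u (v + w) = dot u v + dot u w.
Proof. by rewrite dotC dotDl !(dotC u). Qed.

Lemma dotZr a u v : dot u (a *: v) = a * dot u v.
Proof. by rewrite dotC dotZl dotC. Qed.

Lemma dotNr u v : dot u (- v) = - dot u v.
Proof. by rewrite dotC dotNl dotC. Qed.

Definition dotE := (dotDl, dotDr, dotNl, dotNr, dotZl, dotZr).

Lemma dotvv_ge0 u : 0 <= dot u u.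
Proof. by apply: sumr_ge0 => i _; rewrite -expr2 sqr_ge0. Qed.

Lemma enorm_ge0 u : 0 <= enorm u.
Proof. exact: sqrtr_ge0. Qed.

Lemma sqr_enorm u : enorm u ^+ 2 = dot u u.
Proof.
rewrite sqr_sqrtr; last by apply: sumr_ge0 => i _; rewrite sqr_ge0.
by apply: eq_bigr => i _; rewrite expr2.
Qed.

Lemma enormZ a u : enorm (a *: u) = `|a| * enorm u.
Proof.
apply/eqP; rewrite -(@eqrXn2 _ 2)// ?mulr_ge0 ?enorm_ge0//.
by rewrite exprMn !sqr_enorm !dotE mulrA real_normK ?num_real// expr2.
Qed.

Lemma enormN u : enorm (- u) = enorm u.
Proof. by rewrite -scaleN1r enormZ normrN1 mul1r. Qed.

Lemma enorm0 : enorm (0 : 'rV[R]_d) = 0.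
Proof. by rewrite -(scale0r 0) enormZ normr0 mul0r. Qed.

Lemma cauchy_schwarz u v : dot u v <= enorm u * enorm v.
Proof.
have u0 := enorm_ge0 u; have v0 := enorm_ge0 v.
have [uv0|uv0] := eqVneq (enorm u * enorm v) 0.
  (* If one norm vanishes, one of these nonnegative polynomials in [a] is affine with slope
     [- 2 * dot u v]; the values of [a] chosen below would make it equal to -1. *)
  have H a : 0 <= dot u u - 2 * a * dot u v + a ^+ 2 * dot v v.
    by have := dotvv_ge0 (u - a *: v); rewrite !dotE (dotC v u); lra.
  have H' a : 0 <= dot v v - 2 * a * dot u v + a ^+ 2 * dot u u.
    by have := dotvv_ge0 (v - a *: u); rewrite !dotE (dotC v u); lra.
  rewrite uv0 leNgt; apply/negP => p0.
  move: uv0 => /eqP; rewrite mulf_eq0 => /orP[]/eqP e0.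
    have := H' ((dot v v + 1) / (2 * dot u v)); rewrite -(sqr_enorm u) e0.
    have -> : 2 * ((dot v v + 1) / (2 * dot u v)) * dot u v = dot v v + 1.
      by field; rewrite gt_eqF.
    by rewrite expr0n/=; lra.
  have := H ((dot u u + 1) / (2 * dot u v)); rewrite -(sqr_enorm v) e0.
  have -> : 2 * ((dot u u + 1) / (2 * dot u v)) * dot u v = dot u u + 1.
    by field; rewrite gt_eqF.
  by rewrite expr0n/=; lra.
have p0 : 0 < enorm u * enorm v by rewrite lt_def uv0 mulr_ge0.
have := dotvv_ge0 (enorm v *: u - enorm u *: v).
rewrite !dotE (dotC v u) -!sqr_enorm => H.
have : 0 <= (enorm u * enorm v) * (enorm u * enorm v - dot u v) by nra.
by rewrite pmulr_rge0// subr_ge0.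
Qed.

Lemma dot_ge u v : - (enorm u * enorm v) <= dot u v.
Proof. by have := cauchy_schwarz (- u) v; rewrite dotNl enormN; lra. Qed.

Lemma normr_dot u v : `|dot u v| <= enorm u * enorm v.
Proof. by rewrite ler_norml dot_ge cauchy_schwarz. Qed.

Lemma enormD u v : enorm (u + v) <= enorm u + enorm v.
Proof.
rewrite -(@ler_pXn2r _ 2)// ?nnegrE ?addr_ge0 ?enorm_ge0//.
rewrite sqr_enorm !dotE (dotC v u) -!sqr_enorm.
by have := cauchy_schwarz u v; lra.
Qed.

Lemma enormB u v : enorm (u - v) = enorm (v - u).
Proof. by rewrite -opprB enormN. Qed.

Lemma sqr_enormD_le u v : enorm (u + v) ^+ 2 <= 2 * enorm u ^+ 2 + 2 * enorm v ^+ 2.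
Proof.
have := dotvv_ge0 (u - v).
by rewrite !sqr_enorm !dotE (dotC v u); lra.
Qed.

Lemma sqr_enormB u v :
  enorm (u - v) ^+ 2 = enorm u ^+ 2 - 2 * dot u v + enorm v ^+ 2.
Proof. by rewrite !sqr_enorm !dotE (dotC v u); ring. Qed.


End euclid.

(** * Tangent bounds for smooth and for convex functions *)

Section calculus.
Variables (R : realType) (d : nat).
Implicit Types (f : 'rV[R]_d -> R) (u v x y : 'rV[R]_d).

Lemma derive_dot_grad f x v : differentiable f x -> 'D_v f x = dot (grad f x) v.
Proof.
move=> df; rewrite deriveE// {1}[v]row_sum_delta linear_sum.
apply: eq_bigr => i _; rewrite linearZ /= mxE deriveE//.
by rewrite [RHS]mulrC.
Qed.

Lemma is_derive_line f x v (s : R) : (forall y, differentiable f y) ->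
  is_derive s 1 (fun r : R => f (x + r *: v)) (dot (grad f (x + s *: v)) v).
Proof.
move=> df.
pose l := fun r : R^o => x + r *: v.
have dl : is_diff (s : R^o) l (fun r : R^o => r *: v).
  apply: is_diff_eq.
  by apply/funext => r /=; rewrite add0r.
have dfl : differentiable (f \o l) (s : R^o).
  by apply: differentiable_comp => //; exact: df.
have dle : 'd l (s : R^o) = (fun r : R^o => r *: v) :> (R^o -> 'rV[R]_d).
  exact: diff_val.
split; first by apply/derivable1_diffP.
rewrite -derive1E derive1E' // diff_comp //=.
by rewrite dle scale1r -deriveE // derive_dot_grad.
Qed.

(** A monotonicity argument stands in for the integral of the gradient along the segment: [f] minus
    the quadratic in [s] with the claimed slope has a nonpositive derivative. *)
Lemma quadratic_upper_bound f x v (K : R) : (forall y, differentiable f y) ->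
  (forall s, 0 < s < 1 -> dot (grad f (x + s *: v) - grad f x) v <= K * s) ->
  f (x + v) <= f x + dot (grad f x) v + K / 2.
Proof.
move=> df H.
pose h := fun s : R => f (x + s *: v) - (s * dot (grad f x) v + K / 2 * s ^+ 2).
have dh (s : R) : is_derive s 1 h (dot (grad f (x + s *: v)) v
    - (dot (grad f x) v + K * s)).
  rewrite /h; apply: is_deriveB; first exact: is_derive_line.
  apply: is_derive_eq; rewrite /GRing.scale /=; lra.
have : h 1 <= h 0.
  apply: (@ler0_derive1_nincr _ h 0 1) => //.
  - move=> s; rewrite in_itv/= => s01; rewrite derive1E derive_val.
    by have := H s s01; rewrite !dotE; lra.
  - by apply: derivable_within_continuous => s _.
by rewrite /h !scale0r !scale1r addr0 expr0n /= expr1n; lra.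
Qed.

Lemma coord_le_enorm u i : `|u 0 i| <= enorm u.
Proof.
rewrite -(@ler_pXn2r _ 2)// ?nnegrE ?enorm_ge0// sqr_enorm real_normK ?num_real//.
rewrite /dot (bigD1 i)//= expr2 lerDl sumr_ge0// => j _.
by rewrite -expr2 sqr_ge0.
Qed.

Lemma continuous_enormB x : continuous (fun y => enorm (x - y)).
Proof.
move=> y; rewrite /enorm; apply: continuous_comp; last exact: sqrt_continuous.
move: y; apply: continuous_big => [|i _ y]; first exact: add_continuous.
under eq_fun do rewrite !mxE expr2.
have c : {for y, continuous (fun y : 'rV[R]_d => x 0 i - y 0 i)}.
  apply: (@continuousB _ _ _ (cst (x 0 i)) (fun y => y 0 i)).
    exact: cst_continuous.
  exact: coord_continuous.
exact: (continuousM c c).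
Qed.

(** If the tangent inequality failed, the derivative at 0 along the segment would exceed
    [f y - f x]; so would a difference quotient at some small positive [h], against convexity. *)
Lemma convex_grad_le f x y : (forall y, differentiable f y) ->
  convex_function [set: 'rV[R]_d] f ->
  f x + dot (grad f x) (y - x) <= f y.
Proof.
move=> df cf; rewrite leNgt; apply/negP => lt.
pose phi := fun r : R => f (x + r *: (y - x)).
have dphi := @is_derive_line f x (y - x) 0 df.
have : f y - f x < 'D_1 phi 0.
  by rewrite (@derive_val _ _ _ _ _ _ _ dphi) scale0r addr0; lra.
have dv : derivable phi 0 1 by case: dphi.
move: (dv) => /cvgr_gt /[apply].
rewrite /dnbhs => /nbhs_ballP[e /= e0 H].
pose h := Num.min (e / 2) (1 / 2).
have h0 : 0 < h by rewrite lt_min !divr_gt0.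
have h1 : h <= 1 / 2 by rewrite ge_min lexx orbT.
have he : h <= e / 2 by rewrite ge_min lexx.
have : ball 0 e h by rewrite /ball /= sub0r normrN gtr0_norm//; lra.
move=> /H /(_ (lt0r_neq0 h0)).
rewrite /phi addr0 scale0r addr0 /GRing.scale /= mulr1 mulrC ltr_pdivlMr//.
have h1' : h <= 1 by lra.
have := cf (@Itv01 R h (ltW h0) h1') y x.
rewrite !inE => /(_ Logic.I Logic.I) c0.
have {c0} : f (h *: y + (1 - h) *: x) <= h * f y + (1 - h) * f x := c0.
have -> : h *: y + (1 - h) *: x = x + h *: (y - x).
  by rewrite scalerBl scale1r scalerBr addrC -addrA [- _ + _]addrC.
rewrite /GRing.scale /=; lra.
Qed.

Variables (f : 'rV[R]_d -> R) (L0 L1 : R).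
Hypotheses (L00 : 0 < L0) (L10 : 0 < L1) (sf : L0L1_smooth L0 L1 f).

Lemma descent x y : enorm (y - x) <= L1^-1 ->
  f y <= f x + dot (grad f x) (y - x)
    + (L0 + L1 * enorm (grad f x)) / 2 * enorm (y - x) ^+ 2.
Proof.
move=> xy; have [df sm] := sf.
have G0 := enorm_ge0 (grad f x); have v0 := enorm_ge0 (y - x).
have := @quadratic_upper_bound f x (y - x)
  ((L0 + L1 * enorm (grad f x)) * enorm (y - x) ^+ 2) df.
rewrite subrKC mulrAC; apply => s /andP[s0 s1].
apply: le_trans (cauchy_schwarz _ _) _; rewrite enormB.
have e : enorm (x - (x + s *: (y - x))) = s * enorm (y - x).
  by rewrite opprD addNKr enormN enormZ ger0_norm// ltW.
have := sm x (x + s *: (y - x)); rewrite e => /(_ _).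
have : s * enorm (y - x) <= L1^-1 by nra.
move=> h /(_ h) h'.
apply: le_trans (ler_wpM2r v0 h') _.
by rewrite le_eqVlt; apply/orP; left; apply/eqP; ring.
Qed.

(** A gradient step of size [(L0 + L1 * n)^-1] has length at most [L1^-1], so the descent inequality
    applies to it and yields a decrease of at least [n ^+ 2 / (2 * (L0 + L1 * n))], which cannot
    exceed [f x - fs]. The term linear in [n] is then absorbed by the square of [n - 2 * L1 * D]. *)
Lemma sqr_grad_le (fs : R) x : (forall y, fs <= f y) ->
  enorm (grad f x) ^+ 2 <= 4 * (L0 * (f x - fs) + L1 ^+ 2 * (f x - fs) ^+ 2).
Proof.
move=> fsP; set D := f x - fs; set n := enorm (grad f x).
have n0 : 0 <= n := enorm_ge0 _.
have D0 : 0 <= D by rewrite subr_ge0.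
have K0 : 0 < L0 + L1 * n by rewrite ltr_wpDr// mulr_ge0// ltW.
have e : enorm (x - (L0 + L1 * n)^-1 *: grad f x - x) = n / (L0 + L1 * n).
  by rewrite addrAC subrr add0r enormN enormZ gtr0_norm ?invr_gt0// mulrC.
have := @descent x (x - (L0 + L1 * n)^-1 *: grad f x).
rewrite e [X in dot _ X]addrAC subrr add0r !dotE -sqr_enorm -/n => /(_ _).
have h1 : n / (L0 + L1 * n) <= L1^-1.
  by rewrite ler_pdivrMr// mulrDr mulKf ?gt_eqF// lerDr mulr_ge0 ?invr_ge0// ltW.
move=> /(_ h1) h2.
have := le_trans (fsP _) h2.
have -> : f x - (L0 + L1 * n)^-1 * n ^+ 2
    + (L0 + L1 * n) / 2 * (n / (L0 + L1 * n)) ^+ 2 = f x - n ^+ 2 / (2 * (L0 + L1 * n)).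
  by field; rewrite gt_eqF.
move=> h3; have : n ^+ 2 / (2 * (L0 + L1 * n)) <= D by rewrite /D; lra.
rewrite ler_pdivrMr ?mulr_gt0// => h4.
have := sqr_ge0 (n - 2 * L1 * D).
nra.
Qed.

(** Around a fixed [x] the smoothness condition is a Lipschitz bound with constant
    [L0 + L1 * enorm (grad f x)]. Continuity is what makes the gradient and [noise_bound] Borel
    measurable. *)
Lemma continuous_grad i : continuous (fun y : 'rV[R]_d => grad f y 0 i).
Proof.
move=> x; apply/(@cvgrPdist_lt R R^o _ (nbhs x)) => e e0.
pose K := L0 + L1 * enorm (grad f x).
have K0 : 0 < K by rewrite ltr_wpDr// mulr_ge0 ?enorm_ge0// ltW.
have m0 : 0 < Num.min (L1^-1) (e / K) by rewrite lt_min invr_gt0 L10 divr_gt0.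
have /cvgr_lt := @continuous_enormB x x.
rewrite subrr enorm0 => /(_ _ m0).
apply: filterS => y; rewrite lt_min => /andP[y1 y2].
have := sf.2 _ _ (ltW y1); rewrite -/K => h.
have := coord_le_enorm (grad f x - grad f y) i; rewrite !mxE => h2.
rewrite (le_lt_trans h2)// (le_lt_trans h)//.
by rewrite mulrC -ltr_pdivlMr.
Qed.

End calculus.

(** * Measurability and the filtration of the samples *)

Section borel_vectors.
Variables (R : realType) (d : nat).

(* Rational boxes form a countable base of the topology. *)
Lemma measurable_rV (dT : measure_display) (T : measurableType dT)
    (h : T -> 'rV[R]_d) :
  (forall i, measurable_fun [set: T] (fun t => h t 0 i)) ->
  measurable_fun [set: T] (h : T -> borelRV R d).
Proof.
move=> mh.
apply: (@measurability _ _ T (borelRV R d) setT h (@open 'rV[R]_d)) => //.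
move=> _ [V oV <-]; rewrite setTI.
pose box (q : 'rV[rat]_d) (n : nat) : set T :=
  \bigcap_(i in [set: 'I_d]) [set t | `|ratr (q 0 i) - h t 0 i| < n.+1%:R^-1].
pose sub (q : 'rV[rat]_d) (n : nat) :=
  forall v : 'rV[R]_d, (forall i, `|ratr (q 0 i) - v 0 i| < n.+1%:R^-1) -> V v.
have mbox q n : measurable (box q n).
  apply: fin_bigcap_measurable => //= i _.
  rewrite -[X in measurable X]setTI.
  have mn : measurable_fun [set: T] (fun t => `|ratr (q 0 i) - h t 0 i|).
    apply: measurableT_comp => //.
    by apply: measurable_funB => //; exact: mh.
  have -> : [set t | `|ratr (q 0 i) - h t 0 i| < n.+1%:R^-1] =
    (fun t => `|ratr (q 0 i) - h t 0 i|) @^-1` `]-oo, (n.+1%:R^-1 : R)[.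
    by apply/seteqP; split => t /=; rewrite in_itv.
  exact: mn.
(* Through [pickle], [F] enumerates the preimages of all rational boxes contained in [V]; the other
   codes give the empty set. *)
pose F (k : nat) : set T :=
  if (choice.unpickle k : option ('rV[rat]_d * nat)%type) is Some qn then
    if `[< sub qn.1 qn.2 >] then box qn.1 qn.2 else set0
  else set0 : set T.
have -> : h @^-1` V = \bigcup_k F k.
  apply/seteqP; split => [t /= Vht|t [k _]]; last first.
    rewrite /F; case: choice.unpickle => // -[q n] /=; case: asboolP => // s b.
    by apply: s => i; apply: b.
  have /nbhs_ballP[e /= e0 He] := open_nbhs_nbhs (conj oV Vht).
  have [n ne] : exists n : nat, n.+1%:R^-1 < e / 2.
    have [n _ /(_ n (leqnn n)) /= Hn] := near_infty_natSinv_lt (PosNum (divr_gt0 e0 (@ltr0Sn _ 1))).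
    by exists n.
  have qi (i : 'I_d) : exists q : rat, `|ratr q - h t 0 i| < (n.+1%:R^-1 : R).
    have n0 : 0 < n.+1%:R^-1 :> R by rewrite invr_gt0.
    have lt : h t 0 i < h t 0 i + n.+1%:R^-1 by rewrite ltrDl.
    have [q] := rat_in_itvoo lt; rewrite in_itv /= => /andP[q1 q2].
    exists q; move: n0 q1 q2 {ne lt}; move: (n.+1%:R^-1 : R) (ratr q : R) => a b a0 b1 b2.
    by rewrite ltr_norml; apply/andP; split; lra.
  have [q Hq] := choice qi.
  exists (choice.pickle (\row_i q i, n)) => //.
  rewrite /F choice.pickleK /=; case: asboolP => [_ i _ /=|[]]; first by rewrite mxE.
  move=> v Hv; apply: He; split => // i j; rewrite (ord1 i).
  have := Hv j; have := Hq j; rewrite mxE /ball /= => h1 h2.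
  have -> : h t 0 j - v 0 j = (ratr (q j) - v 0 j) - (ratr (q j) - h t 0 j) by ring.
  rewrite (le_lt_trans (ler_normB _ _))// (lt_trans (ltrD h2 h1))//.
  by rewrite [ltRHS]splitr ltrD.
apply: bigcup_measurable => k _; rewrite /F; case: choice.unpickle => // -[q n] /=.
by case: asboolP.
Qed.

Lemma continuous_measurable_rV (h : 'rV[R]_d -> R) : continuous h ->
  measurable_fun [set: borelRV R d] h.
Proof.
move=> ch.
apply: (measurability _ (RGenOInfty.measurableE R)) => /= _ [_ [a ->] <-].
rewrite setTI; apply: sub_sigma_algebra.
by apply: open_comp => // ? _; exact: ch.
Qed.

Lemma measurable_coord i : measurable_fun [set: borelRV R d] (fun v => v 0 i).
Proof. by apply: continuous_measurable_rV; exact: coord_continuous. Qed.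

End borel_vectors.

(** * Natural filtration of the samples and integration with the past frozen *)

Section independence.
Variables (R : realType) (dO dZ : measure_display).
Variables (Omega : measurableType dO) (Z : measurableType dZ).
Variables (P : probability Omega R) (D : probability Z R).
Variables (T : nat) (z : nat -> {RV P >-> Z}).
Hypothesis iid : iid_samples D T z.

(** Every index from 1 to [n] carries a constraint, possibly [setT], so that two cylinders intersect
    componentwise: this is a pi-system generating the past. *)
Definition cylinders (n : nat) : set_system Omega :=
  [set A | exists2 S : nat -> set Z, (forall k, measurable (S k)) &
    A = \bigcap_(k in [set k | (1 <= k <= n)%N]) z k @^-1` S k].

(** The filtration is encoded by types with carrier [Omega]: a variable is known after [n] samples
    when it is measurable on [past n]. *)
Definition past (n : nat) := g_sigma_algebraType (cylinders n).

Lemma setI_closed_cylinders n : setI_closed (cylinders n).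
Proof.
move=> _ _ [S mS ->] [S' mS' ->]; exists (fun k => S k `&` S' k).
  by move=> k; exact: measurableI.
by rewrite -bigcapI.
Qed.

Lemma cylinders_measurable n : cylinders n `<=` @measurable _ Omega.
Proof.
move=> _ [S mS ->]; apply: fin_bigcap_measurable.
  apply: (@sub_finite_set _ _ `I_n.+1) => [k /= /andP[_]|]; first by rewrite ltnS.
  exact: finite_II.
by move=> k _; rewrite -[X in measurable X]setTI; exact: measurable_funP.
Qed.

Lemma past_measurable n (A : set Omega) :
  @measurable _ (past n) A -> measurable A.
Proof.
apply: smallest_sub; last exact: cylinders_measurable.
exact: sigma_algebra_measurable.
Qed.

Lemma measurable_past n : @measurable _ (past n) `<=` @measurable _ (past n.+1).
Proof.
apply: smallest_sub; first exact: sigma_algebra_measurable.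
move=> _ [S mS ->]; apply: sub_sigma_algebra.
exists (fun k => if (k <= n)%N then S k else setT).
  by move=> k; case: ifP.
apply/seteqP; split => w /= H k /= /andP[k1 k2].
  by case: ifPn => // kn; apply: H => /=; rewrite k1.
have /= := H k; rewrite k2 k1 leqW// => /(_ isT); exact.
Qed.

Lemma measurable_fun_pastS d' (S : measurableType d') n (W : Omega -> S) :
  measurable_fun [set: past n] W -> measurable_fun [set: past n.+1] W.
Proof. by move=> mW _ B mB; apply: measurable_past; exact: mW. Qed.

Lemma measurable_fun_past d' (S : measurableType d') n (W : Omega -> S) :
  measurable_fun [set: past n] W -> measurable_fun [set: Omega] W.
Proof. by move=> mW _ B mB; apply: past_measurable; exact: mW. Qed.

Lemma measurable_sample_past n : measurable_fun [set: past n.+1] (z n.+1).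
Proof.
move=> _ B mB; rewrite setTI; apply: sub_sigma_algebra.
exists (fun k => if k == n.+1 then B else setT); first by move=> k; case: ifP.
apply/seteqP; split => w /= H.
  by move=> k /= _; case: eqP => // ->.
by have := H n.+1; rewrite /= ltnSn eqxx; exact.
Qed.

(** The constraint on the next sample is one more factor: putting [B] at index [n.+1] turns the
    intersection into a joint event over the indices from 1 to [n.+1], whose probability factors. *)
Lemma cylinders_indep n A B : (n < T)%N -> cylinders n A -> measurable B ->
  P (A `&` z n.+1 @^-1` B) = (P A * P (z n.+1 @^-1` B))%E.
Proof.
move=> nT [S mS ->] mB.
pose S' k := if k == n.+1 then B else S k.
have mS' k : measurable (S' k) by rewrite /S'; case: ifP.
have [_ ind] := iid.
pose J := [fset k in iota 1 n]%fset.
have JP k : (k \in J) = (1 <= k <= n)%N by rewrite inE mem_iota add1n ltnS.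
have := ind (n.+1 |` J)%fset S'.
have nJ : n.+1 \notin J by rewrite JP ltnn andbF.
rewrite big_fsetU1//=.
have -> : \bigcap_(t in [set` (n.+1 |` J)%fset]) z t @^-1` S' t =
   \bigcap_(k in [set k | (1 <= k <= n)%N]) z k @^-1` S k `&` z n.+1 @^-1` B.
  apply/seteqP; split => w /=.
    move=> H; split; last by have := H n.+1; rewrite /S' eqxx; apply; rewrite /= in_fset1U eqxx.
    move=> k /= kn; have := H k; rewrite /S'.
    case: eqP => [ke|_]; first by move: kn; rewrite ke ltnn andbF.
    by apply; rewrite /= in_fset1U JP kn orbT.
  move=> [H1 H2] k /=; rewrite in_fset1U JP /S'.
  by case: eqP => [-> _//|_ /= kn]; exact: H1.
move=> -> //; last by move=> t; rewrite in_fset1U JP => /orP[/eqP ->//|]; lia.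
rewrite muleC {2}/S' eqxx; congr (_ * _)%E.
have := ind J S; have -> : [set` J] = [set k | (1 <= k <= n)%N].
  by apply/seteqP; split => k /=; rewrite JP.
move=> ->//; last by move=> t; rewrite JP; lia.
rewrite !big_seq; apply: eq_bigr => k kJ; rewrite /S'.
by case: eqP => // ke; move: kJ; rewrite ke (negPf nJ).
Qed.

(** The events independent of a fixed event of the next sample are closed under complements and
    disjoint countable unions, so Dynkin's theorem extends independence from the cylinders to the
    sigma-algebra they generate. *)
Lemma past_indep n A B : (n < T)%N -> @measurable _ (past n) A -> measurable B ->
  P (A `&` z n.+1 @^-1` B) = (P A * P (z n.+1 @^-1` B))%E.
Proof.
move=> nT + mB.
have mzB : measurable (z n.+1 @^-1` B).
  by rewrite -[X in measurable X]setTI; exact: measurable_funP.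
pose Q (A : set Omega) := P (A `&` z n.+1 @^-1` B) = (P A * P (z n.+1 @^-1` B))%E.
have QC A' : measurable A' -> Q A' -> Q (~` A').
  move=> mA'; rewrite /Q => QA'.
  rewrite setIC -setDE measureD//; last by rewrite ltey_eq fin_num_measure.
  rewrite (_ : measure_function.Content.sort _ (_ `&` A') =
    P A' * P (z n.+1 @^-1` B))%E; last by rewrite setIC; exact: QA'.
  rewrite probability_setC// muleBl ?fin_num_measure//.
    by rewrite mul1e.
have QU (F : (set Omega)^nat) : (forall k, measurable (F k)) ->
    trivIset [set: nat] F -> (forall k, Q (F k)) -> Q (\bigcup_k F k).
  move=> mF tF QF; rewrite /Q setI_bigcupl.
  rewrite measure_bigcup//=; [|by move=> k _; exact: measurableI|exact: trivIset_setIr].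
  rewrite measure_bigcup//=.
  rewrite -[P (z n.+1 @^-1` B)](fineK (fin_num_measure P _ mzB)) muleC.
  rewrite -nneseriesZl//.
  by apply: eq_eseriesr => k _; rewrite fineK ?fin_num_measure// muleC; exact: QF.
apply: (@dynkin_induction _ (past n) (cylinders n) Q) => //.
- exact: setI_closed_cylinders.
- by rewrite /Q setTI probability_setT mul1e.
- by move=> A' /cylinders_indep; exact.
- by move=> A' /past_measurable mA' QA'; exact: QC.
- by move=> F mF tF QF; apply: QU => // k; exact: past_measurable (mF k).
Qed.

Section freezing.
Local Open Scope ereal_scope.

(** This takes the place of a conditional expectation given the past. By independence the law of the
    pair is the product of the law of [W] and [D], and Tonelli integrates the fresh sample first,
    with [W] frozen. *)
Lemma integral_past_sample n d' (S : measurableType d') (W : Omega -> S)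
    (h : S * Z -> \bar R) : (n < T)%N ->
  measurable_fun [set: past n] W ->
  measurable_fun [set: S * Z] h -> (forall p, 0 <= h p) ->
  \int[P]_w h (W w, z n.+1 w) = \int[P]_w \int[D]_s h (W w, s).
Proof.
move=> nT mW mh h0.
have mW' := measurable_fun_past mW.
pose W' : {RV P >-> S} := HB.pack W (isMeasurableFun.Build _ _ _ _ _ mW').
have mz : measurable_fun [set: Omega] (z n.+1) by exact: measurable_funP.
have mWz : measurable_fun [set: Omega] (fun w => (W w, z n.+1 w)).
  exact: measurable_fun_pair.
pose Wz : {RV P >-> (S * Z)%type} :=
  HB.pack (fun w => (W w, z n.+1 w)) (isMeasurableFun.Build _ _ _ _ _ mWz).
have joint X : measurable X ->
    ((distribution P W') \x D)%E X = distribution P Wz X.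
  apply: product_measure_unique => A' B' mA mB.
  have [dz _] := iid.
  transitivity (P (W @^-1` A' `&` z n.+1 @^-1` B')); first by [].
  rewrite past_indep//; last by rewrite -[X in measurable X]setTI; exact: mW.
  by congr (_ * _); exact: dz.
rewrite -(ge0_integral_distribution Wz)//.
rewrite (eq_measure_integral (distribution P W' \x D)) => [|X mX _]; last exact/esym/joint.
rewrite fubini_tonelli1//.
rewrite (ge0_integral_distribution W')//.
  exact: measurable_fun_fubini_tonelli_F.
by move=> y; exact: integral_ge0.
Qed.

End freezing.

(** * Ville's inequality for exponential supermartingales *)

Section maximal_inequality.
Variables (d' : measure_display) (S : measurableType d').
Variables (W : nat -> Omega -> S) (psi : S * Z -> R) (delta : R).
Hypotheses (delta0 : 0 < delta) (mpsi : measurable_fun [set: S * Z] psi).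
Hypothesis mW : forall n, (n < T)%N -> measurable_fun [set: past n] (W n.+1).
Hypothesis psi1 : forall s, (\int[D]_y (expR (psi (s, y)))%:E <= 1)%E.

(* Freezing the exponential supermartingale when it reaches [delta^-1] lets
   Markov's inequality at time [T] control all times at once. *)
Fixpoint stopped_exp (n : nat) (w : Omega) : R :=
  if n is m.+1 then
    if delta^-1 <= stopped_exp m w then stopped_exp m w
    else stopped_exp m w * expR (psi (W n w, z n w))
  else 1.

Lemma stopped_exp_gt0 n w : 0 < stopped_exp n w.
Proof.
by elim: n => //= n IH; case: ifP => // _; rewrite mulr_gt0 ?expR_gt0.
Qed.

Lemma measurable_stopped_exp n : (n <= T)%N ->
  measurable_fun [set: past n] (stopped_exp n).
Proof.
elim: n => [_|n IH nT]; first exact: measurable_cst.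
have mN := measurable_fun_pastS (IH (ltnW nT)).
have mWn := measurable_fun_pastS (mW nT).
have mz := @measurable_sample_past n.
apply: measurable_fun_ifT => //; first exact: measurable_fun_ler.
apply: measurable_funM => //.
apply: measurableT_comp => //.
apply: (measurableT_comp mpsi).
exact: measurable_fun_pair.
Qed.

(** With the past frozen, the next factor is 1 on the stopped branch and has integral at most 1 on
    the other one, so the expectation does not increase. *)
Lemma integral_stopped_exp_le1 n : (n <= T)%N ->
  (\int[P]_w (stopped_exp n w)%:E <= 1)%E.
Proof.
elim: n => [_|n IH nT] /=.
  by rewrite integral_cst// mul1e; exact: probability_le1.
(* The absolute value makes [h] nonnegative on the whole product, as freezing demands; on the
   positive process it changes nothing. *)
pose h (p : (R * S) * Z) : \bar R :=
  (`|p.1.1| * (if delta^-1 <= p.1.1 then 1 else expR (psi (p.1.2, p.2))))%:E.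
have mN := measurable_stopped_exp (ltnW nT).
have m11 : measurable_fun [set: (R * S) * Z] (fun p => p.1.1).
  exact: (measurableT_comp measurable_fst measurable_fst).
have mh : measurable_fun [set: (R * S) * Z] h.
  apply/measurable_EFinP; apply: measurable_funM.
    exact: measurableT_comp.
  apply: measurable_fun_ifT => //; first exact: measurable_fun_ler.
  apply: measurableT_comp => //.
  apply: (measurableT_comp mpsi).
  apply: measurable_fun_pair; last exact: measurable_snd.
  exact: (measurableT_comp measurable_snd measurable_fst).
have h0 p : (0 <= h p)%E.
  by rewrite lee_fin mulr_ge0//; case: ifP => // _; exact: expR_ge0.
have hN w : (stopped_exp n.+1 w)%:E = h ((stopped_exp n w, W n.+1 w), z n.+1 w).
  rewrite /h /= gtr0_norm ?stopped_exp_gt0//.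
  by case: ifP => // _; rewrite mulr1.
under eq_integral do rewrite hN.
rewrite (integral_past_sample (W := fun w => (stopped_exp n w, W n.+1 w)))//; last first.
  by apply: measurable_fun_pair => //; exact: mW.
apply: le_trans (IH (ltnW nT)).
apply: ge0_le_integral => //.
- by move=> w _; apply: integral_ge0.
- have mF := measurable_fun_fubini_tonelli_F (m2 := D) h mh h0.
  apply: (measurableT_comp mF); apply: measurable_fun_pair.
    exact: measurable_fun_past mN.
  exact: measurable_fun_past (mW nT).
- by apply/measurable_EFinP; exact: measurable_fun_past mN.
move=> w _; rewrite /h /=.
have N0 := stopped_exp_gt0 n w.
rewrite gtr0_norm//.
case: (delta^-1 <= stopped_exp n w).
  rewrite mulr1 integral_cst// -[leRHS]mule1 lee_pmul2l ?lte_fin//.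
  exact: probability_le1.
under eq_integral do rewrite EFinM.
rewrite ge0_integralZl//=; last by rewrite lee_fin ltW.
  by rewrite -[leRHS]mule1 lee_pmul2l// lte_fin.
apply/measurable_EFinP; apply: measurableT_comp => //.
by apply: (measurableT_comp mpsi); apply: measurable_fun_pair.
Qed.

Lemma maximal_inequality : exists Bad : set Omega,
  [/\ measurable Bad, (P Bad <= delta%:E)%E &
    forall w, ~ Bad w -> forall n, (n <= T)%N ->
      \sum_(1 <= t < n.+1) psi (W t w, z t w) <= ln (1 / delta)].
Proof.
have mN := measurable_fun_past (measurable_stopped_exp (leqnn T)).
have mN' := mN.
pose X : {RV P >-> R} :=
  HB.pack (stopped_exp T) (isMeasurableFun.Build _ _ _ _ _ mN).
exists [set w | delta^-1 <= stopped_exp T w]; split.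
- rewrite -[X in measurable X]setTI.
  have -> : [set w | delta^-1 <= stopped_exp T w] = stopped_exp T @^-1` `[delta^-1, +oo[.
    by apply/seteqP; split => w /=; rewrite in_itv /= andbT.
  exact: mN'.
- have := @markov _ _ _ P X id (delta^-1).
  rewrite invr_gt0 => /(_ delta0 (@measurable_id _ _ setT) (fun _ h => h)) .
  move=> /(_ (fun _ _ _ _ h => h)).
  have -> : [set x | (delta^-1%:E <= `|(X x)%:E|)%E] = [set w | delta^-1 <= stopped_exp T w].
    by apply/seteqP; split => w /=; rewrite lee_fin gtr0_norm// stopped_exp_gt0.
  rewrite unlock (eq_integral (fun w => (stopped_exp T w)%:E)) => [|w _]; last first.
    by rewrite /= gtr0_norm ?stopped_exp_gt0.
  move=> /le_trans /(_ (integral_stopped_exp_le1 (leqnn T))).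
  move=> le1; rewrite -(@lee_pmul2l _ (delta^-1)%:E) ?lte_fin ?invr_gt0//.
  by rewrite -EFinM mulVf ?gt_eqF.
move=> w /negP; rewrite -ltNge => NT n nT.
(* A value that reaches the threshold is kept until [T]. Staying below it at [T] therefore means
   never having reached it, by backward induction, and then the stopped process is the plain
   exponential at all times. *)
have H k : (k <= T)%N -> stopped_exp (T - k) w < delta^-1.
  elim: k => [_|k IH kT]; first by rewrite subn0.
  have := IH (ltnW kT).
  have -> : (T - k = (T - k.+1).+1)%N by lia.
  rewrite /=; case: (leP (delta^-1) (stopped_exp (T - k.+1) w)) => // h.
  by rewrite ltNge h.
have H' k : (k <= T)%N -> stopped_exp k w < delta^-1.
  by move=> kT; have := H (T - k)%N (leq_subr _ _); rewrite subKn.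
have E k : (k <= T)%N ->
    stopped_exp k w = expR (\sum_(1 <= t < k.+1) psi (W t w, z t w)).
  elim: k => [_|k IH kT]; first by rewrite big_geq//= expR0.
  have := H' k (ltnW kT); rewrite ltNge => /negPf /= ->.
  by rewrite big_nat_recr//= expRD IH// ltnW.
have := H' n nT; rewrite E// => /ltW h.
by rewrite div1r -ler_expR lnK// posrE invr_gt0.
Qed.

End maximal_inequality.
End independence.

(** * Exponential moments of the noise *)

Section exp_bounds.
Variable R : realType.

(** The claim is [1 <= (1 + x) * expR (x ^+ 2 - x)]. For [0 <= x] the tangent of the exponential
    suffices, since [(1 + x) * (1 - x + x ^+ 2) = 1 + x ^+ 3]. *)
Lemma expR_sub_sqr_le (x : R) : `|x| <= 1 / 4 -> expR (x - x ^+ 2) <= 1 + x.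
Proof.
rewrite ler_norml => /andP[x1 x2].
have e0 := expR_gt0 (x - x ^+ 2).
suff : 1 <= (1 + x) * expR (x ^+ 2 - x).
  have -> : x ^+ 2 - x = - (x - x ^+ 2) by ring.
  by rewrite expRN ler_pdivlMr ?mul1r.
have [x0|x0] := leP 0 x.
  have := expR_ge1Dx (x ^+ 2 - x).
  nra.
(* For negative [x] the tangent only gives [1 + x ^+ 3 < 1]; it is applied to half of the exponent
   and squared, which leaves a positive second order term. *)
have -> : x ^+ 2 - x = (x ^+ 2 - x) / 2 + (x ^+ 2 - x) / 2 by field.
rewrite expRD.
have u0 : 0 <= (x ^+ 2 - x) / 2 by nra.
have := expR_ge1Dx ((x ^+ 2 - x) / 2).
move: u0; set u := (x ^+ 2 - x) / 2; set E := expR u => u0 Eu.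
have EE : (1 + u) ^+ 2 <= E * E by nra.
have : 1 <= (1 + x) * (1 + u) ^+ 2.
  rewrite /u; have -> : (1 + x) * (1 + (x ^+ 2 - x) / 2) ^+ 2 =
    1 + x ^+ 2 * (1 + 3 * x - x ^+ 2 + x ^+ 3) / 4 by field.
  have x21 : x ^+ 2 <= 1 / 16 by nra.
  have x31 : - (1 / 64) <= x ^+ 3.
    have -> : x ^+ 3 = x * x ^+ 2 by ring.
    by have := sqr_ge0 x; nra.
  have : 0 <= x ^+ 2 * (1 + 3 * x - x ^+ 2 + x ^+ 3).
    by rewrite mulr_ge0 ?sqr_ge0//; lra.
  lra.
nra.
Qed.

(** Up to a factor 2 this is [sinh s <= s * cosh s], which gives the sign of the derivative of
    [cosh s * expR (- (s ^+ 2 / 2))] in the next lemma. *)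
Lemma sinh_le_mul_cosh (s : R) : 0 <= s ->
  expR s - expR (- s) <= s * (expR s + expR (- s)).
Proof.
move=> s0.
pose h := fun r : R => r * (expR r + expR (- r)) - (expR r - expR (- r)).
have dh (r : R) : is_derive r 1 h (r * (expR r - expR (- r))).
  rewrite /h; apply: is_derive_eq; rewrite /GRing.scale /=; ring.
have : h 0 <= h s.
  apply: (@ger0_derive1_ndecry _ h 0) => //.
  - move=> r; rewrite in_itv/= andbT => r0; rewrite derive1E derive_val.
    by rewrite mulr_ge0 ?(ltW r0)// subr_ge0 ler_expR; lra.
  - by apply: derivable_within_continuous => r _.
by rewrite /h oppr0; lra.
Qed.

Lemma cosh_le (s : R) : 0 <= s -> (expR s + expR (- s)) / 2 <= expR (s ^+ 2 / 2).
Proof.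
move=> s0.
pose h := fun r : R => - ((expR r + expR (- r)) * expR (- (r ^+ 2 / 2))).
have dh (r : R) : is_derive r 1 h
    ((r * (expR r + expR (- r)) - (expR r - expR (- r))) * expR (- (r ^+ 2 / 2))).
  rewrite /h; apply: is_derive_eq; by rewrite /GRing.scale /=; field.
have : h 0 <= h s.
  apply: (@ger0_derive1_ndecry _ h 0) => //.
  - move=> r; rewrite in_itv/= andbT => r0; rewrite derive1E derive_val.
    rewrite mulr_ge0 ?expR_ge0// subr_ge0.
    exact/sinh_le_mul_cosh/ltW.
  - by apply: derivable_within_continuous => r _.
rewrite /h oppr0 expr0n/= mul0r oppr0 expR0 (expRN (s ^+ 2 / 2)).
have e0 := expR_gt0 (s ^+ 2 / 2).
by rewrite lerN2 ler_pdivrMr//; lra.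
Qed.

(** The pointwise form of Hoeffding's lemma: on [[-s, s]] the exponential lies below its chord,
    whose value at 0 is [cosh s <= expR (s ^+ 2 / 2)]. The slope [k] is the same for all [x], so the
    affine majorant integrates to 1 against a centered variable. *)
Lemma hoeffding_affine (s : R) : 0 <= s ->
  exists k, forall x, `|x| <= s -> expR (x - s ^+ 2 / 2) <= 1 + k * x.
Proof.
rewrite le_eqVlt => /predU1P[<-|s0].
  exists 0 => x; rewrite normr_le0 => /eqP ->.
  by rewrite expr0n/= mul0r subrr expR0 mulr0 addr0.
exists ((expR s - expR (- s)) / (2 * s) * expR (- (s ^+ 2 / 2))) => x.
rewrite ler_norml => /andP[x1 x2].
have t0 : 0 <= (s + x) / (2 * s) by rewrite divr_ge0//; lra.
have t1 : (s + x) / (2 * s) <= 1 by rewrite ler_pdivrMr; lra.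
have c0 := convex_expR (Itv01 t0 t1) s (- s).
have {c0} c1 : expR ((s + x) / (2 * s) * s + (1 - (s + x) / (2 * s)) * - s) <=
  (s + x) / (2 * s) * expR s + (1 - (s + x) / (2 * s)) * expR (- s) := c0.
have e1 : (s + x) / (2 * s) * s + (1 - (s + x) / (2 * s)) * - s = x.
  by field; rewrite gt_eqF.
rewrite e1 in c1.
rewrite expRD.
have c2 := cosh_le (ltW s0).
have e0 := expR_gt0 (s ^+ 2 / 2).
have e2 : expR (s ^+ 2 / 2) * expR (- (s ^+ 2 / 2)) = 1.
  by rewrite -expRD subrr expR0.
have e3 := expR_gt0 (- (s ^+ 2 / 2)).
apply: le_trans (ler_wpM2r (ltW e3) c1) _.
have -> : (s + x) / (2 * s) * expR s + (1 - (s + x) / (2 * s)) * expR (- s) =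
  (expR s + expR (- s)) / 2 + (expR s - expR (- s)) / (2 * s) * x.
  by field; rewrite gt_eqF.
have := ler_wpM2r (ltW e3) c2; rewrite e2; lra.
Qed.

End exp_bounds.

Definition noise_bound (R : realType) (d : nat) (f : 'rV[R]_d -> R) (A B C : R)
    (x : 'rV[R]_d) : R :=
  A * (f x - inf (range f)) + B * enorm (grad f x) ^+ 2 + C.

Section noise.
Variables (R : realType) (d : nat) (dZ : measure_display).
Variables (Z : measurableType dZ) (D : probability Z R).
Variables (fz : 'rV[R]_d -> Z -> R) (G : 'rV[R]_d -> Z -> 'rV[R]_d).
Variables (f : 'rV[R]_d -> R) (A B C : R).
Hypothesis oracle : gradient_oracle D fz G.
Hypothesis unbiased : forall y (i : 'I_d),
  'E_D[(fun s => G y s 0 i)%R]%E = (grad f y 0 i)%:E.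
Hypothesis bounded : forall y, {ae D, forall s,
  enorm (G y s - grad f y) ^+ 2 <= noise_bound f A B C y}.

Local Notation sigma2 := (noise_bound f A B C).

Lemma measurable_oracle dT (T : measurableType dT) (u : T -> borelRV R d)
    (s : T -> Z) : measurable_fun [set: T] u -> measurable_fun [set: T] s ->
  measurable_fun [set: T] (fun t => G (u t) (s t) : borelRV R d).
Proof.
move=> mu ms; have [mG _] := oracle.
exact: (measurableT_comp mG (measurable_fun_pair mu ms)).
Qed.

Lemma measurable_oracle_coord y i : measurable_fun [set: Z] (fun s => G y s 0 i).
Proof.
apply: (measurableT_comp (@measurable_coord R d i)).
by apply: measurable_oracle.
Qed.

Lemma integral_cst_probability (c : R) : (\int[D]_s c%:E = c%:E)%E.
Proof.
rewrite integral_cst// -[RHS]mule1; congr (_ * _)%E; exact: probability_setT.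
Qed.

Hypothesis noise_bound_ge0 : forall y, 0 <= sigma2 y.

Lemma ae_normr_dot_noise y v : {ae D, forall s,
  `|dot v (G y s - grad f y)| <= enorm v * Num.sqrt (sigma2 y)}.
Proof.
apply: filterS (bounded y) => s h.
apply: le_trans (normr_dot _ _) _; rewrite ler_wpM2l ?enorm_ge0//.
by rewrite -[leLHS]ger0_norm ?enorm_ge0// -sqrtr_sqr ler_wsqrtr.
Qed.

Lemma measurable_dot_noise y v :
  measurable_fun [set: Z] (fun s => dot v (G y s - grad f y)).
Proof.
apply: measurable_sum => i.
apply: measurable_funM => //.
under eq_fun do rewrite !mxE.
apply: measurable_funB => //; exact: measurable_oracle_coord.
Qed.

Lemma integrable_of_ae_bounded (X : Z -> R) (M : R) : measurable_fun [set: Z] X ->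
  {ae D, forall s, `|X s| <= M} -> D.-integrable [set: Z] (EFin \o X).
Proof.
move=> mX bX; apply/integrableP; split; first exact/measurable_EFinP.
apply: (@le_lt_trans _ _ (\int[D]_s (`|M|%:E))%E); last first.
  by rewrite integral_cst_probability ltry.
apply: ae_ge0_le_integral => //.
- by apply: measurableT_comp => //; exact/measurable_EFinP.
- apply: filterS bX => s h _ /=; rewrite lee_fin.
  exact: le_trans h (ler_norm _).
Qed.

Lemma integrable_oracle_coord y i :
  D.-integrable [set: Z] (fun s => (G y s 0 i - grad f y 0 i)%:E).
Proof.
apply: (@integrable_of_ae_bounded _ (Num.sqrt (sigma2 y))).
  apply: measurable_funB => //; exact: measurable_oracle_coord.
apply: filterS (bounded y) => s h.
have := coord_le_enorm (G y s - grad f y) i; rewrite !mxE => /le_trans; apply.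
by rewrite -[leLHS]ger0_norm ?enorm_ge0// -sqrtr_sqr ler_wsqrtr.
Qed.

Lemma integral_dot_noise y v : (\int[D]_s (dot v (G y s - grad f y))%:E = 0)%E.
Proof.
have coordB s i : (G y s - grad f y) 0 i = G y s 0 i - grad f y 0 i by rewrite !mxE.
have I0 i : (\int[D]_s (G y s 0 i - grad f y 0 i)%:E = 0)%E.
  have I1 : D.-integrable [set: Z] (fun s => (grad f y 0 i)%:E).
    by apply: finite_measure_integrable_cst.
  have I2 : D.-integrable [set: Z] (fun s => (G y s 0 i)%:E).
    rewrite (_ : (fun s => _) = (fun s => (G y s 0 i - grad f y 0 i)%:E) \+
      (fun s => (grad f y 0 i)%:E))%E; last first.
      by apply/funext => s /=; rewrite -EFinD subrK.
    by apply: integrableD => //; exact: integrable_oracle_coord.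
  under eq_integral do rewrite EFinB.
  rewrite integralB_EFin// integral_cst_probability.
  by have := unbiased y i; rewrite unlock => ->; rewrite subee.
under eq_integral do rewrite /dot -sumEFin.
rewrite integral_sum//.
  apply: big1 => i _.
  under eq_integral do rewrite coordB EFinM.
  by rewrite integralZl ?I0 ?mule0//; exact: integrable_oracle_coord.
move=> i; apply: (eq_integrable _ (fun s => (v 0 i)%:E * (G y s 0 i - grad f y 0 i)%:E)%E) => //.
  by move=> s _; rewrite coordB EFinM.
by apply: integrableZl => //; exact: integrable_oracle_coord.
Qed.

(** The noise is centered, so the linear part of the majorant integrates to 0 and only the constant
    1 remains. *)
Lemma integral_le1_of_affine y v (phi : Z -> R) (k : R) :
  measurable_fun [set: Z] phi -> (forall s, 0 <= phi s) ->
  {ae D, forall s, phi s <= 1 + k * dot v (G y s - grad f y)} ->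
  (\int[D]_s (phi s)%:E <= 1)%E.
Proof.
move=> mphi phi0 H.
have mX := measurable_dot_noise y v.
have IX : D.-integrable [set: Z] (fun s => (dot v (G y s - grad f y))%:E).
  exact: integrable_of_ae_bounded mX (ae_normr_dot_noise y v).
have mh : measurable_fun [set: Z] (fun s => 1 + k * dot v (G y s - grad f y)).
  by apply: measurable_funD => //; exact: measurable_funM.
(* The affine majorant is nonnegative only almost everywhere; the comparison of integrals goes
   through its absolute value, which agrees with it almost everywhere because [phi] is
   nonnegative. *)
apply: (@le_trans _ _ (\int[D]_s (`|1 + k * dot v (G y s - grad f y)|)%:E)%E).
  apply: ae_ge0_le_integral => //.
  - by move=> s _; rewrite lee_fin.
  - exact/measurable_EFinP.
  - by apply/measurable_EFinP; exact: measurableT_comp.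
  - by apply: filterS H => s h _; rewrite lee_fin (le_trans h)// ler_norm.
rewrite (ae_eq_integral (fun s => (1 + k * dot v (G y s - grad f y))%:E))//; last 3 first.
- by apply/measurable_EFinP; exact: measurableT_comp.
- exact/measurable_EFinP.
- by apply: filterS H => s h _; rewrite ger0_norm// (le_trans (phi0 s)).
under eq_integral do rewrite EFinD EFinM.
rewrite integralD//; last 2 first.
- by apply: finite_measure_integrable_cst.
- exact: integrableZl.
rewrite integralZl// integral_dot_noise mule0 adde0.
by rewrite integral_cst_probability.
Qed.

(** The argument consists of the query point [p.1.1], the test direction [p.1.2] and the fresh
    sample [p.2]. The compensator is evaluated at the query point, which is why its exponential has
    integral at most 1 for every frozen pair. *)
Definition subgaussian_exponent (p : borelRV R d * borelRV R d * Z) : R :=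
  dot p.1.2 (G p.1.1 p.2 - grad f p.1.1)
  - enorm p.1.2 ^+ 2 * sigma2 p.1.1 / 2.

Lemma integral_subgaussian_exponent q :
  (\int[D]_s (expR (subgaussian_exponent (q, s)))%:E <= 1)%E.
Proof.
case: q => y v.
have s0 : 0 <= enorm v * Num.sqrt (sigma2 y) by rewrite mulr_ge0 ?enorm_ge0 ?sqrtr_ge0.
have [k Hk] := hoeffding_affine s0.
apply: (@integral_le1_of_affine y v _ k) => //.
- apply: measurableT_comp => //; apply: measurable_funB => //.
    exact: measurable_dot_noise.
  exact: (measurable_cst (enorm v ^+ 2 * sigma2 y / 2)).
- apply: filterS (ae_normr_dot_noise y v) => s /Hk.
  by rewrite /subgaussian_exponent exprMn (sqr_sqrtr (noise_bound_ge0 y)).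
Qed.

(* [expR (X - X ^+ 2) <= 1 + X] holds only for bounded [X], hence the
   truncation. *)
Definition self_normalized_exponent (p : borelRV R d * borelRV R d * Z) : R :=
  if enorm p.1.2 ^+ 2 * sigma2 p.1.1 <= 1 / 16 then
    dot p.1.2 (G p.1.1 p.2 - grad f p.1.1)
    - dot p.1.2 (G p.1.1 p.2 - grad f p.1.1) ^+ 2
  else 0.

Lemma integral_self_normalized_exponent q :
  (\int[D]_s (expR (self_normalized_exponent (q, s)))%:E <= 1)%E.
Proof.
case: q => y v; rewrite /self_normalized_exponent /=.
case: (leP (enorm v ^+ 2 * sigma2 y) (1 / 16)) => [le|_]; last first.
  by rewrite expR0 integral_cst_probability.
have s0 : 0 <= enorm v * Num.sqrt (sigma2 y) by rewrite mulr_ge0 ?enorm_ge0 ?sqrtr_ge0.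
(* The cutoff 1/16 bounds the square of the tested noise almost surely, by Cauchy-Schwarz, so the
   noise itself stays within the range 1/4 of [expR_sub_sqr_le]. *)
have s4 : enorm v * Num.sqrt (sigma2 y) <= 1 / 4.
  rewrite -(@ler_pXn2r _ 2)// ?nnegrE; last by lra.
  by rewrite exprMn (sqr_sqrtr (noise_bound_ge0 y)); lra.
apply: (@integral_le1_of_affine y v _ 1) => //.
- apply: measurableT_comp => //; apply: measurable_funB => //.
    exact: measurable_dot_noise.
  apply: measurable_funX; exact: measurable_dot_noise.
- apply: filterS (ae_normr_dot_noise y v) => s h.
  by rewrite mul1r expR_sub_sqr_le// (le_trans h).
Qed.

Lemma measurable_dot dT (T : measurableType dT) (u v : T -> borelRV R d) :
  measurable_fun [set: T] u -> measurable_fun [set: T] v ->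
  measurable_fun [set: T] (fun t => dot (u t) (v t)).
Proof.
move=> mu mv; apply: measurable_sum => i; apply: measurable_funM.
  exact: measurableT_comp (@measurable_coord R d i) mu.
exact: measurableT_comp (@measurable_coord R d i) mv.
Qed.

Lemma measurable_sqr_enorm dT (T : measurableType dT) (u : T -> borelRV R d) :
  measurable_fun [set: T] u -> measurable_fun [set: T] (fun t => enorm (u t) ^+ 2).
Proof. by move=> mu; under eq_fun do rewrite sqr_enorm; exact: measurable_dot. Qed.

Lemma measurable_rVB dT (T : measurableType dT) (u v : T -> borelRV R d) :
  measurable_fun [set: T] u -> measurable_fun [set: T] v ->
  measurable_fun [set: T] (fun t => u t - v t : borelRV R d).
Proof.
move=> mu mv; apply: measurable_rV => i; under eq_fun do rewrite !mxE.
apply: measurable_funB.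
  exact: measurableT_comp (@measurable_coord R d i) mu.
exact: measurableT_comp (@measurable_coord R d i) mv.
Qed.

Lemma measurable_rVD dT (T : measurableType dT) (u v : T -> borelRV R d) :
  measurable_fun [set: T] u -> measurable_fun [set: T] v ->
  measurable_fun [set: T] (fun t => u t + v t : borelRV R d).
Proof.
move=> mu mv; apply: measurable_rV => i; under eq_fun do rewrite !mxE.
apply: measurable_funD.
  exact: measurableT_comp (@measurable_coord R d i) mu.
exact: measurableT_comp (@measurable_coord R d i) mv.
Qed.

Lemma measurable_rVZ dT (T : measurableType dT) (a : T -> R) (u : T -> borelRV R d) :
  measurable_fun [set: T] a -> measurable_fun [set: T] u ->
  measurable_fun [set: T] (fun t => a t *: u t : borelRV R d).
Proof.
move=> ma mu; apply: measurable_rV => i; under eq_fun do rewrite !mxE.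
apply: measurable_funM => //.
exact: measurableT_comp (@measurable_coord R d i) mu.
Qed.

Hypothesis cont_f : continuous f.
Hypothesis cont_grad : forall i, continuous (fun y => grad f y 0 i).

Lemma measurable_grad : measurable_fun [set: borelRV R d] (grad f : _ -> borelRV R d).
Proof. by apply: measurable_rV => i; exact: continuous_measurable_rV. Qed.

Lemma measurable_noise_bound : measurable_fun [set: borelRV R d] sigma2.
Proof.
apply: measurable_funD => //; apply: measurable_funD.
  apply: measurable_funM => //; apply: measurable_funB => //.
  exact: continuous_measurable_rV.
apply: measurable_funM => //; apply: measurable_sqr_enorm; exact: measurable_grad.
Qed.

Let m11 : measurable_fun [set: borelRV R d * borelRV R d * Z] (fun p => p.1.1).
Proof. exact: (measurableT_comp measurable_fst measurable_fst). Qed.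

Let m12 : measurable_fun [set: borelRV R d * borelRV R d * Z] (fun p => p.1.2).
Proof. exact: (measurableT_comp measurable_snd measurable_fst). Qed.

Let mX : measurable_fun [set: borelRV R d * borelRV R d * Z]
  (fun p => dot p.1.2 (G p.1.1 p.2 - grad f p.1.1)).
Proof.
apply: measurable_dot => //; apply: measurable_rVB.
  by apply: measurable_oracle => //; exact: measurable_snd.
exact: (measurableT_comp measurable_grad).
Qed.

Let mV : measurable_fun [set: borelRV R d * borelRV R d * Z]
  (fun p => enorm p.1.2 ^+ 2 * sigma2 p.1.1).
Proof.
apply: measurable_funM; first exact: measurable_sqr_enorm.
exact: (measurableT_comp measurable_noise_bound).
Qed.

Lemma measurable_subgaussian_exponent :
  measurable_fun [set: _] subgaussian_exponent.
Proof. by apply: measurable_funB => //; exact: measurable_funM. Qed.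

Lemma measurable_self_normalized_exponent :
  measurable_fun [set: _] self_normalized_exponent.
Proof.
apply: measurable_fun_ifT => //; first exact: measurable_fun_ler.
by apply: measurable_funB => //; exact: measurable_funX.
Qed.

End noise.

(** * Pathwise bounds *)

Section scalar_sums.
Variable R : realType.
Implicit Types (a b c y : R).

Lemma div_le_ln_div a y : 0 < a -> 0 <= y -> y / (a + y) <= ln ((a + y) / a).
Proof.
move=> a0 y0; have ay : 0 < a + y by lra.
have h : -1 < a / (a + y) - 1 by have := divr_gt0 a0 ay; lra.
have := le_ln1Dx h; rewrite subrKC.
have -> : (a + y) / a = (a / (a + y))^-1 by rewrite invf_div.
rewrite lnV ?posrE ?divr_gt0//.
have -> : a / (a + y) - 1 = - (y / (a + y)) by field; rewrite gt_eqF.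
lra.
Qed.

(** Each term is at most the increment of the logarithm, so the sum telescopes. Applied to the
    squared gradients, this bounds the accumulated squared lengths of the steps. *)
Lemma sum_div_le_ln (y : nat -> R) a n : 0 < a -> (forall k, 0 <= y k) ->
  \sum_(1 <= k < n.+1) y k / (a + \sum_(1 <= j < k.+1) y j)
  <= ln (1 + (\sum_(1 <= k < n.+1) y k) / a).
Proof.
move=> a0 y0; elim: n => [|n IH].
  by rewrite !big_geq// mul0r addr0 ln1.
rewrite (@big_nat_recr _ _ _ n.+1) //=.
set s := \sum_(1 <= j < n.+1) y j in IH *.
have s0 : 0 <= s by apply: sumr_ge0.
have as0 : 0 < a + s by lra.
rewrite (big_nat_recr n.+1) //= -/s.
have L := div_le_ln_div as0 (y0 n.+1).
have -> : 1 + (s + y n.+1) / a = (1 + s / a) * ((a + s + y n.+1) / (a + s)).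
  by field; rewrite !gt_eqF.
have e1 : 0 < 1 + s / a by have := divr_ge0 s0 (ltW a0); lra.
rewrite lnM ?posrE ?divr_gt0// ?ltr_wpDr//.
by rewrite addrA; lra.
Qed.

Lemma sum_div_sqrt_le (y : nat -> R) a n : 0 < a -> (forall k, 0 <= y k) ->
  \sum_(1 <= k < n.+1) y k / Num.sqrt (a + \sum_(1 <= j < k.+1) y j)
  <= 2 * (Num.sqrt (a + \sum_(1 <= k < n.+1) y k) - Num.sqrt a).
Proof.
move=> a0 y0; elim: n => [|n IH].
  by rewrite !big_geq// addr0 subrr mulr0.
rewrite (@big_nat_recr _ _ _ n.+1) //=.
set s := \sum_(1 <= j < n.+1) y j in IH *.
have s0 : 0 <= s by apply: sumr_ge0.
rewrite (big_nat_recr n.+1) //= -/s.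
have as0 : 0 < a + s by lra.
set p := Num.sqrt (a + s) in IH *.
set q := Num.sqrt _.
have p2 : p ^+ 2 = a + s by rewrite sqr_sqrtr// ltW.
have yn := y0 n.+1.
have q2 : q ^+ 2 = a + (s + y n.+1) by rewrite sqr_sqrtr//; lra.
have q0 : 0 < q by rewrite sqrtr_gt0; lra.
have : y n.+1 / q <= 2 * (q - p).
  by rewrite ler_pdivrMr//; have := sqr_ge0 (q - p); nra.
lra.
Qed.

Lemma sqrtrD_le a b : 0 <= a -> 0 <= b ->
  Num.sqrt (a + b) <= Num.sqrt a + Num.sqrt b.
Proof.
move=> a0 b0.
rewrite -(@ler_pXn2r _ 2)// ?nnegrE ?addr_ge0 ?sqrtr_ge0//.
rewrite sqr_sqrtr ?addr_ge0// sqrrD !sqr_sqrtr//.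
by have := mulr_ge0 (sqrtr_ge0 a) (sqrtr_ge0 b); lra.
Qed.

(* Terms with [V_s <= th] cost at most [y / a]; beyond the threshold the
   denominator dominates [a + V_s / 2] and the sum telescopes into a logarithm. *)
Lemma sum_div_delayed_le_ln (y den : nat -> R) a (th : R) n :
  0 < a -> 0 <= th -> (forall k, 0 <= y k) ->
  (forall k, (1 <= k <= n)%N -> a <= den k) ->
  (forall k, (1 <= k <= n)%N -> th < \sum_(1 <= j < k.+1) y j ->
     a + (\sum_(1 <= j < k.+1) y j) / 2 <= den k) ->
  \sum_(1 <= k < n.+1) y k / den k <=
    th / a + 2 * ln (1 + (\sum_(1 <= k < n.+1) y k) / (2 * a)).
Proof.
move=> a0 th0 y0 d1 d2.
have V0 k : 0 <= \sum_(1 <= j < k.+1) y j by apply: sumr_ge0.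
(* The induction needs [Num.min V th] in place of [th]: below the threshold its growth pays for the
   new term [y / a], and beyond it the logarithm takes over. *)
have H m : (m <= n)%N -> \sum_(1 <= k < m.+1) y k / den k <=
    Num.min (\sum_(1 <= k < m.+1) y k) th / a
    + 2 * ln (1 + (\sum_(1 <= k < m.+1) y k) / (2 * a)).
  elim: m => [|m IH mn].
    by rewrite !big_geq// mul0r addr0 ln1 mulr0 addr0 divr_ge0 ?(ltW a0)// le_min lexx.
  have {}IH := IH (ltnW mn).
  have kn : (1 <= m.+1 <= n)%N by [].
  have D1 := d1 _ kn; have := d2 _ kn.
  rewrite !(@big_nat_recr _ _ _ m.+1) //=.
  have := V0 m; move: IH.
  set s := \sum_(1 <= j < m.+1) y j => IH s0 D2.
  have ym := y0 m.+1.
  set Y := y m.+1 in ym D2 *; set E := den m.+1 in D1 D2 *.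
  have E0 : 0 < E by lra.
  have l1 : 0 < 1 + s / (2 * a) by have := divr_ge0 s0 (ltW (mulr_gt0 (@ltr0Sn _ 1) a0)); lra.
  have as0 : 0 < a + s / 2 by lra.
  have e : 1 + (s + Y) / (2 * a) = (1 + s / (2 * a)) * ((a + s / 2 + Y / 2) / (a + s / 2)).
    by field; apply/andP; split; rewrite gt_eqF//; lra.
  have r1 : 0 < (a + s / 2 + Y / 2) / (a + s / 2) by rewrite divr_gt0//; lra.
  have Y2 : 0 <= Y / 2 by lra.
  have L := div_le_ln_div as0 Y2.
  rewrite e lnM ?posrE//.
  have L0 : 0 <= ln ((a + s / 2 + Y / 2) / (a + s / 2)).
    by apply: le_trans L; rewrite divr_ge0//; lra.
  have mm : Num.min s th / a <= Num.min (s + Y) th / a.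
    by rewrite ler_pM2r ?invr_gt0// le_min2//; lra.
  have [sth|sth] := leP (s + Y) th.
    have : Y / E <= Y / a by rewrite ler_wpM2l// lef_pV2// ?posrE.
    move: IH; have -> : Num.min s th = s by apply/min_idPl; lra.
    by rewrite mulrDl; lra.
  have {}D2 := D2 sth.
  have : Y / E <= 2 * (Y / 2 / (a + s / 2 + Y / 2)).
    rewrite mulrA mulrCA divff ?mulr1 ?gt_eqF//.
    by rewrite ler_wpM2l// lef_pV2 ?posrE//; lra.
  have : Num.min s th / a <= th / a by rewrite ler_pM2r ?invr_gt0// ge_min lexx orbT.
  by lra.
have := H n (leqnn n).
have : Num.min (\sum_(1 <= k < n.+1) y k) th / a <= th / a.
  by rewrite ler_pM2r ?invr_gt0// ge_min lexx orbT.
lra.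
Qed.

End scalar_sums.

(** * Both algorithms as perturbed gradient paths *)

Section paths.
Variables (R : realType) (d : nat) (eta G0 : R) (T : nat).
Hypotheses (eta0 : 0 < eta) (G00 : 0 < G0).

Definition stepsize (g : nat -> 'rV[R]_d) (t : nat) : R :=
  eta / Num.sqrt (G0 ^+ 2 + \sum_(1 <= k < t.+1) enorm (g k) ^+ 2).

(* The common abstraction of AdaGrad-Norm and RSAG: [x] is a plain normalized
   gradient iteration and [xbar] stays close to it. *)
Definition perturbed_path (x xbar g : nat -> 'rV[R]_d) : Prop :=
  [/\ forall t, (1 <= t <= T)%N -> x t.+1 = x t - stepsize g t *: g t,
      forall t, (1 <= t <= T)%N -> enorm (xbar t - x t) <= eta
    & forall n, (n <= T)%N -> \sum_(1 <= t < n.+1) enorm (xbar t - x t) ^+ 2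
        <= 2 * \sum_(1 <= t < n.+1) stepsize g t ^+ 2 * enorm (g t) ^+ 2].

Variable g : nat -> 'rV[R]_d.

Lemma sum_sqr_ge0 m n : 0 <= \sum_(m <= k < n) enorm (g k) ^+ 2.
Proof. by apply: sumr_ge0 => k _; rewrite sqr_ge0. Qed.

Lemma denom_gt0 t : 0 < G0 ^+ 2 + \sum_(1 <= k < t.+1) enorm (g k) ^+ 2.
Proof. by rewrite ltr_wpDr ?sum_sqr_ge0// exprn_gt0. Qed.

Lemma stepsize_gt0 t : 0 < stepsize g t.
Proof. by rewrite divr_gt0// sqrtr_gt0 denom_gt0. Qed.

Lemma sqr_stepsize t : stepsize g t ^+ 2 =
  eta ^+ 2 / (G0 ^+ 2 + \sum_(1 <= k < t.+1) enorm (g k) ^+ 2).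
Proof. by rewrite expr_div_n sqr_sqrtr// ltW// denom_gt0. Qed.

Lemma stepsize_mul_le t : (1 <= t)%N -> stepsize g t * enorm (g t) <= eta.
Proof.
move=> t1; rewrite mulrAC ler_pdivrMr ?sqrtr_gt0 ?denom_gt0// ler_pM2l//.
rewrite -[leLHS]ger0_norm ?enorm_ge0// -sqrtr_sqr ler_wsqrtr//.
rewrite big_nat_recr//= addrA lerDr addr_ge0 ?sqr_ge0//.
by apply: sumr_ge0 => k _; rewrite sqr_ge0.
Qed.

Lemma sum_stepsize_sqr_le n (M : R) :
  (forall t, (1 <= t <= n)%N -> enorm (g t) ^+ 2 <= M) ->
  \sum_(1 <= t < n.+1) stepsize g t ^+ 2 * enorm (g t) ^+ 2
    <= eta ^+ 2 * ln (1 + n%:R * M / G0 ^+ 2).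
Proof.
move=> gM.
have -> : \sum_(1 <= t < n.+1) stepsize g t ^+ 2 * enorm (g t) ^+ 2 =
  eta ^+ 2 * \sum_(1 <= k < n.+1) enorm (g k) ^+ 2 /
      (G0 ^+ 2 + \sum_(1 <= j < k.+1) enorm (g j) ^+ 2).
  rewrite mulr_sumr; apply: eq_bigr => k _.
  by rewrite sqr_stepsize mulrAC mulrA.
rewrite ler_pM2l ?exprn_gt0//.
have G2 : 0 < G0 ^+ 2 by rewrite exprn_gt0.
apply: le_trans (sum_div_le_ln _ _ _) _ => // [k|]; first exact: sqr_ge0.
have SM : \sum_(1 <= k < n.+1) enorm (g k) ^+ 2 <= n%:R * M.
  apply: le_trans (_ : \sum_(1 <= k < n.+1) M <= _).
    by apply: ler_sum_nat => k; rewrite ltnS => /gM.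
  by rewrite sumr_const_nat subSS subn0 mulr_natl.
have S0 := sum_sqr_ge0 1 n.+1.
rewrite ler_ln ?posrE; last 2 first.
- by rewrite ltr_wpDr// divr_ge0 ?(ltW G2).
- by rewrite ltr_wpDr// divr_ge0 ?(ltW G2)//; apply: le_trans SM.
by rewrite lerD2l ler_pM2r ?invr_gt0.
Qed.

Variables (x xtilde xbar : nat -> 'rV[R]_d).
Hypothesis init : xtilde 1%N = x 1%N.

Lemma adagrad_norm_path (alpha : nat -> R) :
  (forall t, (1 <= t <= T)%N ->
    [/\ xbar t = alpha t *: x t + (1 - alpha t) *: xtilde t,
        x t.+1 = x t - stepsize g t *: g t
      & xtilde t.+1 = xbar t - stepsize g t *: g t]) ->
  perturbed_path x xbar g.
Proof.
move=> step.
have E t : (t < T)%N -> xtilde t.+1 = x t.+1.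
  elim: t => [//|t IH tT]; have [e1 -> ->] := step t.+1 (ltnW tT).
  by rewrite e1 IH ?(ltnW tT)// -scalerDl subrKC scale1r.
have E' t : (1 <= t <= T)%N -> xbar t = x t.
  case: t => // t tT; have [-> _ _] := step _ tT.
  by rewrite E// -scalerDl subrKC scale1r.
have z t : (1 <= t <= T)%N -> enorm (xbar t - x t) = 0.
  by move=> /E' ->; rewrite subrr enorm0.
split.
- by move=> t /step[].
- by move=> t tT; rewrite z// ltW.
- move=> n nT; rewrite big_nat big1 => [|t tn]; last first.
    by rewrite z ?expr0n//; lia.
  by rewrite mulr_ge0// sumr_ge0// => t _; rewrite mulr_ge0 ?sqr_ge0.
Qed.

Lemma sqr_enorm_conv_le (a : R) (u v : 'rV[R]_d) : 0 <= a <= 1 ->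
  enorm ((1 - a) *: u - a *: v) ^+ 2 <= (1 - a) * enorm u ^+ 2 + a * enorm v ^+ 2.
Proof.
move=> /andP[a0 a1]; have := dotvv_ge0 (u + v).
rewrite !sqr_enorm !dotE (dotC v u) => h.
have : 0 <= a * (1 - a) by rewrite mulr_ge0// subr_ge0.
nra.
Qed.

(** The gap [e t = xtilde t - x t] obeys [e t.+1 = (1 - al t) *: e t - al t *: (stepsize g t *: g
    t)], a convex combination up to sign: its norm stays below [eta] because each step has length at
    most [eta], and its square is controlled by convexity. *)
Lemma rsag_path :
  (forall t, (1 <= t <= T)%N ->
    [/\ xbar t = (2 / t.+1%:R) *: x t + (1 - 2 / t.+1%:R) *: xtilde t,
        x t.+1 = x t - stepsize g t *: g t
      & xtilde t.+1 = xbar t - ((1 + 2 / t.+1%:R) * stepsize g t) *: g t]) ->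
  perturbed_path x xbar g.
Proof.
move=> step.
pose e t := xtilde t - x t.
pose al t : R := 2 / t.+1%:R.
have al0 t : 0 <= al t by rewrite divr_ge0.
have al1 t : (1 <= t)%N -> al t <= 1.
  by move=> t1; rewrite ler_pdivrMr// mul1r ler_nat.
have xe t : (1 <= t <= T)%N -> xbar t - x t = (1 - al t) *: e t.
  move=> /step[-> _ _]; apply/rowP => i; rewrite !mxE -/(al t); ring.
have eS t : (1 <= t <= T)%N ->
    e t.+1 = (1 - al t) *: e t - al t *: (stepsize g t *: g t).
  move=> tT; have [e1 e2 e3] := step _ tT.
  rewrite /e e2 e3 e1; apply/rowP => i; rewrite !mxE -/(al t); ring.
have e1 : e 1%N = 0 by rewrite /e init subrr.
have s0 t := ltW (stepsize_gt0 t).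
have en t : (t <= T)%N -> enorm (e t.+1) <= eta.
  elim: t => [_|t IH tT]; first by rewrite e1 enorm0 ltW.
  have a0 := al0 t.+1; have a1 := al1 t.+1 isT.
  rewrite eS//; apply: le_trans (enormD _ _) _.
  rewrite enormN !enormZ (ger0_norm a0) (ger0_norm (s0 _)) ger0_norm ?subr_ge0//.
  have := IH (ltnW tT); have := @stepsize_mul_le t.+1 isT; nra.
have xb t : (1 <= t <= T)%N -> enorm (xbar t - x t) <= enorm (e t).
  move=> tT; rewrite xe// enormZ ger0_norm ?subr_ge0 ?al1//; last by case/andP: tT.
  by rewrite ler_piMl ?enorm_ge0// gerBl.
pose N t := stepsize g t ^+ 2 * enorm (g t) ^+ 2.
(* The potential [n.+1%:R * enorm (e n.+1) ^+ 2] fits the weights [2 / t.+1]: multiplying the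
   convexity bound at index [n.+1] by [n + 2] leaves [n] times the old square plus twice the new
   step, so one old square is released at each round. *)
have pot n : (n <= T)%N ->
    \sum_(1 <= t < n.+1) enorm (e t) ^+ 2 + n.+1%:R * enorm (e n.+1) ^+ 2
    <= 2 * \sum_(1 <= t < n.+1) N t.
  elim: n => [_|n IH nT].
    by rewrite !big_geq// e1 enorm0 expr0n/= !mulr0 addr0.
  rewrite !(@big_nat_recr _ _ _ n.+1)//=.
  have {}IH := IH (ltnW nT).
  have a01 : 0 <= al n.+1 <= 1 by rewrite al0 al1.
  have := sqr_enorm_conv_le (e n.+1) (stepsize g n.+1 *: g n.+1) a01.
  rewrite -eS// enormZ exprMn real_normK ?num_real// -/(N n.+1).
  have n2 : 0 < n.+2%:R :> R by [].
  move=> h.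
  have : n.+2%:R * enorm (e n.+2) ^+ 2 <=
      (n.+1%:R - 1) * enorm (e n.+1) ^+ 2 + 2 * N n.+1.
    apply: le_trans (ler_wpM2l (ltW n2) h) _.
    rewrite le_eqVlt; apply/orP; left; apply/eqP; rewrite /al.
    have -> : n.+1%:R = n.+2%:R - 1 :> R by rewrite -[n.+2]addn1 natrD addrK.
    by field; rewrite gt_eqF.
  lra.
split.
- by move=> t /step[].
- move=> t tT; apply: le_trans (xb _ tT) _; case: t tT => // t tT.
  by apply: en; exact: ltnW.
- move=> n nT; apply: le_trans (pot n nT).
  rewrite ler_wpDr ?mulr_ge0 ?sqr_ge0 ?enorm_ge0//.
  apply: ler_sum_nat => t tn.
  rewrite ler_pXn2r ?nnegrE ?enorm_ge0//; apply: xb; lia.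
Qed.
End paths.

(** * One descent step with an adaptive step size *)

Section descent.
Variables (R : realType) (d : nat) (f : 'rV[R]_d -> R) (L0 L1 : R).
Hypotheses (L00 : 0 < L0) (L10 : 0 < L1) (sf : L0L1_smooth L0 L1 f).

(** The two roots are the denominators of the predictable proxy and of the true step, with [p] the
    gradient norm, [q] the norm of the stochastic gradient and [s] the noise bound. *)
Lemma sqrtr_denom_close (c p q s : R) : 0 <= c -> 0 <= p -> 0 <= q -> 0 <= s ->
  `|p - q| <= s ->
  `|Num.sqrt (c + p ^+ 2 + s ^+ 2) - Num.sqrt (c + q ^+ 2)| <= 2 * s.
Proof.
move=> c0 p0 q0 s0; rewrite ler_norml => /andP[pq1 pq2].
set u := Num.sqrt _; set v := Num.sqrt _.
have u0 : 0 <= u := sqrtr_ge0 _; have v0 : 0 <= v := sqrtr_ge0 _.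
have p2 := sqr_ge0 p; have q2 := sqr_ge0 q; have s2 := sqr_ge0 s.
have u2 : u ^+ 2 = c + p ^+ 2 + s ^+ 2 by rewrite sqr_sqrtr//; lra.
have v2 : v ^+ 2 = c + q ^+ 2 by rewrite sqr_sqrtr//; lra.
have pu : p <= u by rewrite -(@ler_pXn2r _ 2)// ?nnegrE// u2; lra.
have qv : q <= v by rewrite -(@ler_pXn2r _ 2)// ?nnegrE// v2; lra.
have H1 : v <= u + s.
  rewrite -(@ler_pXn2r _ 2)// ?nnegrE ?addr_ge0// v2.
  have : q ^+ 2 <= (p + s) ^+ 2 by rewrite ler_pXn2r ?nnegrE ?addr_ge0//; lra.
  have := ler_wpM2r s0 pu; lra.
have H2 : u <= v + 2 * s.
  rewrite -(@ler_pXn2r _ 2)// ?nnegrE ?addr_ge0 ?mulr_ge0// u2.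
  have : p ^+ 2 <= (q + s) ^+ 2 by rewrite ler_pXn2r ?nnegrE ?addr_ge0//; lra.
  have := ler_wpM2r s0 qv; have := mulr_ge0 v0 s0; lra.
rewrite ler_norml; apply/andP; split; lra.
Qed.

(** In the descent inequality at [x], the gradient is moved to the query point [xb] at a cost
    bounded by smoothness, and the step [et] is exchanged for the proxy [eh]. What remains is
    [- eh * p ^+ 2] plus a noise term with predictable weight. Here [c] stands for [G0 ^+ 2] plus
    the past squared gradients. *)
Lemma adaptive_descent_step (x xb g : 'rV[R]_d) (c eta s L : R) :
  let p := enorm (grad f xb) in
  let et := eta / Num.sqrt (c + enorm g ^+ 2) in
  let eh := eta / Num.sqrt (c + p ^+ 2 + s ^+ 2) in
  0 < c -> 0 < eta -> 0 < s -> eta <= L1^-1 ->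
  enorm (g - grad f xb) <= s -> enorm (xb - x) <= eta ->
  L0 + L1 * p <= L -> L0 + L1 * enorm (grad f x) <= L ->
  f (x - et *: g) <= f x - eh * p ^+ 2 / 2
    + dot (- eh *: grad f xb) (g - grad f xb)
    + (2 * s / eta + L) * (et ^+ 2 * enorm g ^+ 2)
    + L / 2 * enorm (xb - x) ^+ 2.
Proof.
move=> p et eh c0 eta0 s0 etaL gs xbx Lb Lx.
set q := enorm g.
have p0 : 0 <= p := enorm_ge0 _. have q0 : 0 <= q := enorm_ge0 _.
have p2 := sqr_ge0 p; have q2 := sqr_ge0 q; have s2 : 0 < s ^+ 2 by rewrite exprn_gt0.
set u := Num.sqrt (c + p ^+ 2 + s ^+ 2) in eh *.
set v := Num.sqrt (c + enorm g ^+ 2) in et *.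
have u0 : 0 < u by rewrite sqrtr_gt0; lra.
have v0 : 0 < v by rewrite sqrtr_gt0 -/q; lra.
have et0 : 0 < et by rewrite divr_gt0.
have eh0 : 0 < eh by rewrite divr_gt0.
have u2 : u ^+ 2 = c + p ^+ 2 + s ^+ 2 by rewrite sqr_sqrtr//; lra.
have v2 : v ^+ 2 = c + q ^+ 2 by rewrite sqr_sqrtr// -/q; lra.
have su : s <= u by rewrite -(@ler_pXn2r _ 2)// ?nnegrE ?(ltW u0) ?(ltW s0)// u2; lra.
have qv : q <= v by rewrite -(@ler_pXn2r _ 2)// ?nnegrE ?(ltW v0)// v2; lra.
have pq : `|p - q| <= s.
  have h1 : p <= s + q.
    have := enormD (grad f xb - g) g; rewrite subrK -/p -/q enormB; lra.
  have h2 : q <= s + p.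
    have := enormD (g - grad f xb) (grad f xb); rewrite subrK -/p -/q; lra.
  by rewrite ler_norml; apply/andP; split; lra.
have uv := sqrtr_denom_close (ltW c0) p0 q0 (ltW s0) pq; rewrite -/u -/v in uv.
have ehet : `|eh - et| <= 2 * s * (eh * et) / eta.
  have -> : eh - et = (v - u) * (eh * et) / eta.
    by rewrite /eh /et; field; rewrite !gt_eqF.
  have h0 : 0 < eh * et / eta by apply: divr_gt0 => //; exact: mulr_gt0.
  rewrite -[(v - u) * _ / _]mulrA normrM (gtr0_norm h0) -[leRHS]mulrA.
  by rewrite ler_pM2r// distrC.
have etq : et * q <= eta by rewrite /et mulrAC ler_pdivrMr// ler_pM2l.
have D1 := descent sf (x := x) (y := x - et *: g).
rewrite [x - et *: g - x]addrAC subrr add0r enormN enormZ (gtr0_norm et0) -/q in D1.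
have {}D1 := D1 (le_trans etq etaL).
have sm := sf.2 xb x (le_trans xbx etaL).
have r0 := enorm_ge0 (xb - x); set r := enorm (xb - x) in r0 sm xbx *.
have cs1 : dot (grad f xb - grad f x) (et *: g) <= L * r * (et * q).
  apply: le_trans (cauchy_schwarz _ _) _; rewrite enormZ (gtr0_norm et0) -/q.
  apply: ler_wpM2r; first by apply: mulr_ge0 => //; exact: ltW.
  by apply: le_trans sm _; exact: ler_wpM2r.
have cs2 : (eh - et) * dot (grad f xb) g <= 2 * s * (eh * et) / eta * (p * q).
  apply: le_trans (ler_norm _) _; rewrite normrM.
  by apply: ler_pM => //; exact: normr_dot.
(* The exchange error is split by Young's inequality; since [eh * s <= eta], its gradient part uses
   up only half of the decrease [eh * p ^+ 2]. *)
have am1 : 2 * s * (eh * et) / eta * (p * q)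
    <= eh * p ^+ 2 / 2 + 2 * s / eta * (et ^+ 2 * q ^+ 2).
  have ehs : eh * s <= eta by rewrite /eh mulrAC ler_pdivrMr// ler_pM2l.
  have h := sqr_ge0 (eh * p / 2 - et * q).
  have h1 : 2 * (eh * p / 2) * (et * q) <= eh ^+ 2 * p ^+ 2 / 4 + et ^+ 2 * q ^+ 2.
    by move: h; clear; lra.
  have -> : 2 * s * (eh * et) / eta * (p * q) = 2 * s / eta * (2 * (eh * p / 2) * (et * q)).
    by field; rewrite gt_eqF.
  have se : 0 <= 2 * s / eta by rewrite divr_ge0 ?mulr_ge0 ?(ltW s0) ?(ltW eta0).
  apply: le_trans (ler_wpM2l se h1) _.
  rewrite mulrDr lerD2r.
  have -> : 2 * s / eta * (eh ^+ 2 * p ^+ 2 / 4) = (eh * s / eta) * (eh * p ^+ 2 / 2).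
    by field; rewrite gt_eqF.
  apply: ler_piMl; last by rewrite ler_pdivrMr// mul1r.
  by apply: divr_ge0 => //; apply: mulr_ge0 => //; exact: ltW.
have L0' : 0 <= L by apply: le_trans Lx; rewrite addr_ge0 ?mulr_ge0 ?enorm_ge0 ?ltW.
have am2 : L * r * (et * q) <= L / 2 * (et ^+ 2 * q ^+ 2) + L / 2 * r ^+ 2.
  by have := mulr_ge0 L0' (sqr_ge0 (r - et * q)); clear; lra.
have cu : (L0 + L1 * enorm (grad f x)) / 2 * (et * q) ^+ 2 <= L / 2 * (et ^+ 2 * q ^+ 2).
  rewrite exprMn; apply: ler_wpM2r; first by apply: mulr_ge0; exact: sqr_ge0.
  by rewrite ler_pM2r.
have pp : p ^+ 2 = dot (grad f xb) (grad f xb) by rewrite sqr_enorm.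
apply: (le_trans D1).
rewrite !dotE in cs1 *; rewrite pp in am1 *.
move: cs1 cs2 am1 am2 cu; clear; lra.
Qed.

End descent.

(** * Stage 1: bound on the function values *)

Lemma range_trans n T t : (n <= T)%N -> (1 <= t <= n)%N -> (1 <= t <= T)%N.
Proof. by move=> nT /andP[-> /leq_trans]; apply. Qed.

(* In the pathwise sections [Da] is the paper's [\overline\Delta_a], whereas its
   [D_a] is [Dd]. *)
Section values.
Variables (R : realType) (d : nat) (f : 'rV[R]_d -> R).
Variables (L0 L1 A B C eta G0 Da Pa : R) (T : nat) (x xbar g : nat -> 'rV[R]_d).
Hypotheses (L00 : 0 < L0) (L10 : 0 < L1) (sf : L0L1_smooth L0 L1 f).
Hypotheses (A0 : 0 < A) (B0 : 0 < B) (C0 : 0 < C).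
Hypotheses (eta0 : 0 < eta) (G00 : 0 < G0) (Da0 : 0 <= Da) (Pa0 : 0 < Pa).

Local Notation fs := (inf (range f)).
Local Notation Q2 := (L0 * Da + L1 ^+ 2 * Da ^+ 2).
Local Notation H := (ln (1 + 2 * T%:R * (A * Da + 4 * (B + 1) * Q2 + C) / G0 ^+ 2)).
Local Notation sigma2 := (noise_bound f A B C).

Hypothesis fsP : forall y, fs <= f y.
Hypothesis Pa2 : Pa ^+ 2 = A * Da + 4 * B * Q2 + C.
Hypothesis path : perturbed_path eta G0 T x xbar g.
Hypothesis noise : forall t, (1 <= t <= T)%N ->
  enorm (g t - grad f (xbar t)) ^+ 2 <= sigma2 (xbar t).

Lemma sqr_grad_le_level y : f y - fs <= Da -> enorm (grad f y) ^+ 2 <= 4 * Q2.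
Proof.
move=> yD; apply: le_trans (sqr_grad_le L00 L10 sf y fsP) _.
have y0 : 0 <= f y - fs by rewrite subr_ge0.
rewrite ler_pM2l//; apply: lerD; first by rewrite ler_pM2l.
by rewrite ler_pM2l ?exprn_gt0// ler_pXn2r ?nnegrE.
Qed.

Lemma noise_bound_le_level y : f y - fs <= Da -> sigma2 y <= Pa ^+ 2.
Proof.
move=> yD; rewrite Pa2 /noise_bound lerD2r; apply: lerD; first by rewrite ler_pM2l.
by have := ler_wpM2l (ltW B0) (sqr_grad_le_level yD); lra.
Qed.

Lemma noise_le_level t : (1 <= t <= T)%N -> f (xbar t) - fs <= Da ->
  enorm (g t - grad f (xbar t)) <= Pa.
Proof.
move=> tT yD; rewrite -(@ler_pXn2r _ 2)// ?nnegrE ?enorm_ge0 ?(ltW Pa0)//.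
exact: le_trans (noise tT) (noise_bound_le_level yD).
Qed.

Lemma sqr_g_le_level t : (1 <= t <= T)%N -> f (xbar t) - fs <= Da ->
  enorm (g t) ^+ 2 <= 2 * (A * Da + 4 * (B + 1) * Q2 + C).
Proof.
move=> tT yD; rewrite -[g t](subrK (grad f (xbar t))).
apply: le_trans (sqr_enormD_le _ _) _.
have := le_trans (noise tT) (noise_bound_le_level yD); rewrite Pa2.
have := sqr_grad_le_level yD; lra.
Qed.

Lemma sum_steps_le_level n : (n <= T)%N ->
  (forall t, (1 <= t <= n)%N -> f (xbar t) - fs <= Da) ->
  \sum_(1 <= t < n.+1) stepsize eta G0 g t ^+ 2 * enorm (g t) ^+ 2 <= eta ^+ 2 * H.
Proof.
move=> nT gd.
have gM t : (1 <= t <= n)%N ->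
    enorm (g t) ^+ 2 <= 2 * (A * Da + 4 * (B + 1) * Q2 + C).
  by move=> tn; apply: sqr_g_le_level; [exact: range_trans tn|exact: gd].
apply: le_trans (sum_stepsize_sqr_le eta0 G00 gM) _.
rewrite ler_pM2l ?exprn_gt0//.
have G2 : 0 < G0 ^+ 2 by rewrite exprn_gt0.
have Q0 : 0 <= Q2 by rewrite addr_ge0 ?mulr_ge0 ?sqr_ge0// ltW.
set M := _ + C.
have M0 : 0 <= M.
  have h1 := mulr_ge0 (ltW A0) Da0; have h2 := mulr_ge0 (ltW B0) Q0.
  have h3 := C0; rewrite /M; lra.
have e0 k : 0 < 1 + k%:R * (2 * M) / G0 ^+ 2.
  apply: ltr_wpDr => //; apply: divr_ge0; last exact: ltW.
  by apply: mulr_ge0 => //; exact: mulr_ge0.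
have -> : 1 + 2 * T%:R * M / G0 ^+ 2 = 1 + T%:R * (2 * M) / G0 ^+ 2 by ring.
rewrite ler_ln ?posrE// lerD2l ler_pM2r ?invr_gt0//.
by apply: ler_wpM2r; [exact: mulr_ge0|rewrite ler_nat].
Qed.

(** With [k = L1^-1], the displacement is at most [k / 8] and
    [n * k <= 2 * (f y - fs) + L0 * k ^+ 2]. The linear and quadratic terms of the descent
    inequality add up to [17 / 128 * (n * k) + L0 * k ^+ 2 / 128], whence 34 and 18. *)
Lemma perturbed_value_le (y yb : 'rV[R]_d) (Y : R) : f y - fs <= Y ->
  enorm (yb - y) <= 1 / (8 * L1) ->
  f yb - fs <= (1 + 34 / 128) * Y + 18 / 128 * (L0 / L1 ^+ 2).
Proof.
move=> yY yb1; have y0 : 0 <= f y - fs by rewrite subr_ge0.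
set n := enorm (grad f y); set r := enorm (yb - y) in yb1 *.
have n0 : 0 <= n := enorm_ge0 _. have r0 : 0 <= r := enorm_ge0 _.
pose k := L1^-1; have k0 : 0 < k by rewrite invr_gt0.
have kL : L1 * k = 1 by rewrite mulfV ?gt_eqF.
have rk : r <= k / 8 by rewrite (le_trans yb1)// div1r invfM mulrC.
have rk' : r <= L1^-1 by rewrite (le_trans rk)// -/k; lra.
have D := descent sf rk'.
have cs := cauchy_schwarz (grad f y) (yb - y); rewrite -/n -/r in cs.
have nb : n * k <= 2 * (f y - fs) + L0 * k ^+ 2.
  have n2 : n <= 2 * L1 * (f y - fs) + L0 * k.
    have h0 : 0 <= 2 * L1 * (f y - fs) + L0 * k.
      by rewrite addr_ge0 ?mulr_ge0 ?(ltW L10) ?(ltW L00) ?(ltW k0).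
    rewrite -(@ler_pXn2r _ 2)// ?nnegrE//.
    apply: le_trans (sqr_grad_le L00 L10 sf y fsP) _.
    have -> : (2 * L1 * (f y - fs) + L0 * k) ^+ 2 =
      4 * (L0 * (L1 * k) * (f y - fs) + L1 ^+ 2 * (f y - fs) ^+ 2) + (L0 * k) ^+ 2 by ring.
    by rewrite kL mulr1 lerDl sqr_ge0.
  apply: le_trans (ler_wpM2r (ltW k0) n2) _.
  have -> : (2 * L1 * (f y - fs) + L0 * k) * k = 2 * (L1 * k) * (f y - fs) + L0 * k ^+ 2 by ring.
  by rewrite kL mulr1.
have t1 : n * r <= n * k / 8 by rewrite -mulrA ler_wpM2l.
have r2 : r ^+ 2 <= k ^+ 2 / 64.
  have -> : k ^+ 2 / 64 = (k / 8) ^+ 2 by field.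
  by rewrite ler_pXn2r ?nnegrE//; lra.
have t2 : (L0 + L1 * n) / 2 * r ^+ 2 <= L0 * k ^+ 2 / 128 + n * k / 128.
  have -> : L0 * k ^+ 2 / 128 + n * k / 128 = L0 * k ^+ 2 / 128 + (L1 * k) * n * k / 128.
    by rewrite kL mul1r.
  have -> : L0 * k ^+ 2 / 128 + (L1 * k) * n * k / 128 = (L0 + L1 * n) / 2 * (k ^+ 2 / 64).
    by field.
  by apply: ler_wpM2l => //; rewrite divr_ge0 ?addr_ge0 ?mulr_ge0 ?(ltW L10) ?(ltW L00).
have -> : L0 / L1 ^+ 2 = L0 * k ^+ 2 by rewrite /k exprVn.
rewrite -/n -/r in D; lra.
Qed.

Variables (Ma l : R).
Hypotheses (Ma2 : 4 * Q2 <= Ma ^+ 2) (Ma0 : 0 <= Ma).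
Hypotheses (etaL1 : eta <= 1 / (8 * L1)) (etaPH : eta * Pa * H <= 1 / 8).
Hypotheses (etaP : eta * Pa <= 1 / 3) (etaLH : (L0 + L1 * Ma) * (eta ^+ 2 * H) <= 1 / 4).

(* A proxy of the step size that does not depend on the sample [t]: [|g_t|^2] is
   replaced by [|grad f (xbar t)|^2 + Pa^2]. *)
Definition predictable_step t : R := eta /
  Num.sqrt (G0 ^+ 2 + \sum_(1 <= k < t) enorm (g k) ^+ 2
            + enorm (grad f (xbar t)) ^+ 2 + Pa ^+ 2).

Lemma predictable_step_gt0 t : 0 < predictable_step t.
Proof.
rewrite divr_gt0// sqrtr_gt0 ltr_wpDl ?exprn_gt0//.
by rewrite !addr_ge0 ?sqr_ge0// sum_sqr_ge0.
Qed.

Lemma predictable_step_mul_le t : predictable_step t * Pa <= eta.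
Proof.
rewrite mulrAC ler_pdivrMr; last first.
  rewrite sqrtr_gt0 ltr_wpDl ?exprn_gt0// !addr_ge0 ?sqr_ge0//.
  exact: sum_sqr_ge0.
rewrite ler_pM2l// -[leLHS]ger0_norm ?(ltW Pa0)// -sqrtr_sqr ler_wsqrtr//.
by rewrite lerDr !addr_ge0 ?sqr_ge0// sum_sqr_ge0.
Qed.

Local Notation v t := (- predictable_step t *: grad f (xbar t)).
Local Notation xi t := (g t - grad f (xbar t)).

Hypothesis event : forall n, (n <= T)%N ->
  \sum_(1 <= t < n.+1) (dot (v t) (xi t) - enorm (v t) ^+ 2 * sigma2 (xbar t) / 2) <= l.

Local Notation Y := (f (x 1%N) - fs + l + 3 / 4).
Hypothesis YDa : (1 + 34 / 128) * Y + 18 / 128 * (L0 / L1 ^+ 2) <= Da.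

(** Strong induction: values below [Y] at the earlier iterates put the query points below [Da],
    where [Pa] and [Ma] are valid, and the telescoped descent inequality then bounds the next
    iterate. The constant 3/4 collects three second order terms of at most 1/4 each: step mismatch,
    curvature and displacement of the query points. *)
Lemma values_bound_x n : (n <= T)%N -> f (x n.+1) - fs <= Y.
Proof.
have [pstep pclose psum] := path.
(* At time 0 the event concerns an empty sum and reads [0 <= l]. *)
have l0 : 0 <= l by have := event (leq0n T); rewrite big_geq.
elim/ltn_ind: n => -[_ _|n IH nT]; first by lra.
have Y0 : 0 <= Y by have := fsP (x 1%N); lra.
have YD : Y <= Da.
  have := divr_ge0 (ltW L00) (sqr_ge0 L1).
  by move: YDa Y0; move: (L0 / L1 ^+ 2) (Y) Da => q y D; lra.
have xY t : (1 <= t <= n.+1)%N -> f (x t) - fs <= Y.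
  case: t => // t tn; apply: IH => //; exact: leq_trans (ltnW tn) nT.
have gd t : (1 <= t <= n.+1)%N -> f (xbar t) - fs <= Da.
  move=> tn; apply: le_trans YDa; apply: perturbed_value_le (xY t tn) _.
  by apply: le_trans (pclose t _) etaL1; exact: range_trans tn.
have gradM y : f y - fs <= Da -> enorm (grad f y) <= Ma.
  move=> yD; rewrite -(@ler_pXn2r _ 2)// ?nnegrE ?enorm_ge0//.
  exact: le_trans (sqr_grad_le_level yD) Ma2.
have etaL1' : eta <= L1^-1.
  have : 0 < L1^-1 by rewrite invr_gt0.
  by move: etaL1; rewrite div1r invfM; lra.
pose L := L0 + L1 * Ma.
pose N t := stepsize eta G0 g t ^+ 2 * enorm (g t) ^+ 2.
have tel m : (m <= n.+1)%N -> f (x m.+1) <= f (x 1%N)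
    - (\sum_(1 <= t < m.+1) predictable_step t * enorm (grad f (xbar t)) ^+ 2) / 2
    + \sum_(1 <= t < m.+1) dot (v t) (xi t)
    + (2 * Pa / eta + L) * \sum_(1 <= t < m.+1) N t
    + L / 2 * \sum_(1 <= t < m.+1) enorm (xbar t - x t) ^+ 2.
  elim: m => [_|m IHm mn]; first by rewrite !big_geq//; lra.
  have {}IHm := IHm (ltnW mn).
  have mT : (1 <= m.+1 <= T)%N by exact: leq_trans mn nT.
  have mn' : (1 <= m.+1 <= n.+1)%N by [].
  have c0 : 0 < G0 ^+ 2 + \sum_(1 <= k < m.+1) enorm (g k) ^+ 2.
    by rewrite ltr_wpDr ?exprn_gt0// sum_sqr_ge0.
  have S := @adaptive_descent_step _ _ f L0 L1 L00 L10 sf (x m.+1) (xbar m.+1) (g m.+1)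
    _ eta Pa L c0 eta0 Pa0 etaL1' (noise_le_level mT (gd _ mn')) (pclose _ mT).
  have Lb : L0 + L1 * enorm (grad f (xbar m.+1)) <= L.
    by rewrite lerD2l ler_pM2l// gradM// gd.
  have Lx : L0 + L1 * enorm (grad f (x m.+1)) <= L.
    by rewrite lerD2l ler_pM2l// gradM// (le_trans (xY _ mn')).
  have {}S := S Lb Lx.
  rewrite !(@big_nat_recr _ _ _ m.+1)//= (pstep _ mT).
  have e1 : stepsize eta G0 g m.+1 =
      eta / Num.sqrt (G0 ^+ 2 + \sum_(1 <= k < m.+1) enorm (g k) ^+ 2 + enorm (g m.+1) ^+ 2).
    by rewrite /stepsize big_nat_recr//= addrA.
  rewrite -e1 -/(predictable_step m.+1) -/(N m.+1) in S.
  lra.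
have Nle : \sum_(1 <= t < n.+2) N t <= eta ^+ 2 * H.
  exact: sum_steps_le_level.
have rle : \sum_(1 <= t < n.+2) enorm (xbar t - x t) ^+ 2
    <= 2 * \sum_(1 <= t < n.+2) N t := psum _ nT.
have ev := event nT; rewrite sumrB in ev.
(* The compensator of the event: [predictable_step t * Pa <= eta] and [eta * Pa <= 1 / 3] make it at
   most a sixth of the weighted squared gradients, of which the descent provides a half. *)
have wle : \sum_(1 <= t < n.+2) (enorm (v t) ^+ 2 * sigma2 (xbar t) / 2) <=
    (\sum_(1 <= t < n.+2) predictable_step t * enorm (grad f (xbar t)) ^+ 2) / 6.
  rewrite mulr_suml; apply: ler_sum_nat => t tn.
  have s1 := noise_bound_le_level (gd _ tn).
  have h0 := predictable_step_gt0 t; have h1 := predictable_step_mul_le t.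
  rewrite enormZ exprMn real_normK ?num_real// sqrrN.
  set h := predictable_step t in h0 h1 *; set p := enorm _.
  have s2 : h ^+ 2 * sigma2 (xbar t) <= h / 3.
    apply: le_trans (ler_wpM2l (sqr_ge0 h) s1) _.
    have -> : h ^+ 2 * Pa ^+ 2 = h * (h * Pa * Pa) by ring.
    rewrite ler_pM2l//.
    by apply: le_trans (ler_wpM2r (ltW Pa0) h1) _; move: etaP; lra.
  have -> : h ^+ 2 * p ^+ 2 * sigma2 (xbar t) / 2 = h ^+ 2 * sigma2 (xbar t) * p ^+ 2 / 2 by ring.
  by have := ler_wpM2r (sqr_ge0 p) s2; lra.
have W0 : 0 <= \sum_(1 <= t < n.+2) predictable_step t * enorm (grad f (xbar t)) ^+ 2.
  by apply: sumr_ge0 => t _; rewrite mulr_ge0 ?sqr_ge0// ltW ?predictable_step_gt0.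
have LL : 0 <= L by rewrite addr_ge0 ?mulr_ge0 ?(ltW L00) ?(ltW L10).
have PL : 0 <= 2 * Pa / eta by rewrite divr_ge0 ?mulr_ge0 ?(ltW Pa0) ?(ltW eta0).
have u1 := ler_wpM2l PL Nle.
have e2 : 2 * Pa / eta * (eta ^+ 2 * H) = 2 * (eta * Pa * H) by field; rewrite gt_eqF.
rewrite e2 in u1.
have u2 := ler_wpM2l LL Nle.
have u3 := ler_wpM2l LL rle.
have := tel n.+1 (leqnn _).
have h1 : L * (eta ^+ 2 * H) <= 1 / 4 := etaLH.
have h2 := etaPH; move: u1 u2 u3 h1 h2 ev wle W0.
move: (\sum_(1 <= t < n.+2) N t) (\sum_(1 <= t < n.+2) predictable_step t * _)
  (\sum_(1 <= t < n.+2) enorm (xbar t - x t) ^+ 2)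
  (\sum_(1 <= t < n.+2) dot _ _) (\sum_(1 <= t < n.+2) (_ * _ / 2))
  (2 * Pa / eta) (L * (eta ^+ 2 * H)) (eta * Pa * H) => a1 a2 a3 a4 a5 a6 a7 a8.
lra.
Qed.

Lemma values_bound t : (1 <= t <= T)%N -> f (xbar t) - fs <= Da.
Proof.
case: t => // t tT; have [_ pclose _] := path.
have tT' : (t <= T)%N by exact: ltnW.
apply: le_trans YDa; apply: (perturbed_value_le (values_bound_x tT')).
exact: le_trans (pclose t.+1 tT) etaL1.
Qed.

End values.

(** * Stages 2 and 3: accumulated noise and distances to the minimizer *)

Lemma le_of_sqr (R : realType) (a b : R) : 0 <= b -> a ^+ 2 <= b ^+ 2 -> a <= b.
Proof.
move=> b0 ab; have [a0|a0] := leP 0 a; last exact: le_trans (ltW a0) b0.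
by rewrite -(@ler_pXn2r _ 2)// ?nnegrE.
Qed.

Section distances.
Variables (R : realType) (d : nat) (f : 'rV[R]_d -> R).
Variables (L0 L1 A B C eta G0 Da Pa : R) (T : nat) (x xbar g : nat -> 'rV[R]_d).
Hypotheses (L00 : 0 < L0) (L10 : 0 < L1) (sf : L0L1_smooth L0 L1 f).
Hypotheses (A0 : 0 < A) (B0 : 0 < B) (C0 : 0 < C).
Hypotheses (eta0 : 0 < eta) (G00 : 0 < G0) (Da0 : 0 <= Da) (Pa0 : 0 < Pa).

Local Notation fs := (inf (range f)).
Local Notation Q2 := (L0 * Da + L1 ^+ 2 * Da ^+ 2).
Local Notation H := (ln (1 + 2 * T%:R * (A * Da + 4 * (B + 1) * Q2 + C) / G0 ^+ 2)).
Local Notation sigma2 := (noise_bound f A B C).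
Local Notation xi t := (g t - grad f (xbar t)).

Hypothesis fsP : forall y, fs <= f y.
Hypothesis Pa2 : Pa ^+ 2 = A * Da + 4 * B * Q2 + C.
Hypothesis path : perturbed_path eta G0 T x xbar g.
Hypothesis noise : forall t, (1 <= t <= T)%N -> enorm (xi t) ^+ 2 <= sigma2 (xbar t).
Hypothesis level : forall t, (1 <= t <= T)%N -> f (xbar t) - fs <= Da.

(** The step size of time [t - 1], hence known before sample [t]; at [t = 1] it equals
    [eta / G0]. *)
Definition delayed_step t : R :=
  eta / Num.sqrt (G0 ^+ 2 + \sum_(1 <= k < t) enorm (g k) ^+ 2).

Lemma delayed_stepS t : delayed_step t.+1 = stepsize eta G0 g t.
Proof. by []. Qed.

Lemma delayed_denom_gt0 t : 0 < G0 ^+ 2 + \sum_(1 <= k < t) enorm (g k) ^+ 2.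
Proof. by rewrite ltr_wpDr ?exprn_gt0// sum_sqr_ge0. Qed.

Lemma delayed_step_gt0 t : 0 < delayed_step t.
Proof. by rewrite divr_gt0// sqrtr_gt0 delayed_denom_gt0. Qed.

Lemma delayed_step_le t : delayed_step t <= eta / G0.
Proof.
rewrite ler_pM2l// lef_pV2 ?posrE ?sqrtr_gt0 ?delayed_denom_gt0//.
by rewrite -[leLHS]ger0_norm ?(ltW G00)// -sqrtr_sqr ler_wsqrtr// lerDl sum_sqr_ge0.
Qed.

Lemma delayed_step_nincr t : (1 <= t)%N -> delayed_step t.+1 <= delayed_step t.
Proof.
move=> t1; rewrite ler_pM2l// lef_pV2 ?posrE ?sqrtr_gt0 ?delayed_denom_gt0//.
by rewrite ler_wsqrtr// big_nat_recr//= addrA lerDl sqr_ge0.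
Qed.

Lemma noise_le t : (1 <= t <= T)%N -> enorm (xi t) <= Pa.
Proof.
by move=> tT; apply: (noise_le_level L00 L10 sf A0 B0 Da0 Pa0 fsP Pa2 noise tT (level tT)).
Qed.

Lemma sqr_noise_le t : (1 <= t <= T)%N -> enorm (xi t) ^+ 2 <= Pa ^+ 2.
Proof. by move=> tT; rewrite ler_pXn2r ?nnegrE ?enorm_ge0 ?(ltW Pa0)// noise_le. Qed.

Lemma noise_bound_le t : (1 <= t <= T)%N -> sigma2 (xbar t) <= Pa ^+ 2.
Proof.
by move=> tT; apply: (noise_bound_le_level L00 L10 sf A0 B0 Da0 fsP Pa2 (level tT)).
Qed.

Lemma sum_steps_le n : (n <= T)%N ->
  \sum_(1 <= t < n.+1) stepsize eta G0 g t ^+ 2 * enorm (g t) ^+ 2 <= eta ^+ 2 * H.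
Proof.
move=> nT; apply: (sum_steps_le_level L00 L10 sf A0 B0 C0 eta0 G00 Da0 fsP Pa2 noise nT).
by move=> t tn; apply: level; exact: range_trans tn.
Qed.

Lemma sum_perturbations_le n : (n <= T)%N ->
  \sum_(1 <= t < n.+1) enorm (xbar t - x t) ^+ 2 <= 2 * (eta ^+ 2 * H).
Proof.
move=> nT; have [_ _ psum] := path.
by apply: le_trans (psum n nT) _; rewrite ler_pM2l// sum_steps_le.
Qed.

Variable l : R.
Hypothesis l1 : 1 <= l.

Local Notation v2 t := (- (Pa ^+ 2)^-1 *: grad f (xbar t)).
Hypothesis event2 : forall n, (n <= T)%N ->
  \sum_(1 <= t < n.+1) (dot (v2 t) (xi t) - enorm (v2 t) ^+ 2 * sigma2 (xbar t) / 2) <= l.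

(** Expanding the square, [|xi|^2 - |g|^2 = - 2 <grad f, xi> - |grad f|^2]. The scaling of [v2] by
    [(Pa ^+ 2)^-1] is the one for which the compensator, after multiplication by [2 * Pa ^+ 2], is
    at most the available [|grad f|^2]. *)
Lemma sum_noise_le n : (n <= T)%N ->
  \sum_(1 <= t < n.+1) enorm (xi t) ^+ 2 <=
  \sum_(1 <= t < n.+1) enorm (g t) ^+ 2 + 2 * Pa ^+ 2 * l.
Proof.
move=> nT; have P2 : 0 < Pa ^+ 2 by rewrite exprn_gt0.
have : \sum_(1 <= t < n.+1) (enorm (xi t) ^+ 2 - enorm (g t) ^+ 2) <=
    2 * Pa ^+ 2 * \sum_(1 <= t < n.+1)
      (dot (v2 t) (xi t) - enorm (v2 t) ^+ 2 * sigma2 (xbar t) / 2).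
  rewrite mulr_sumr; apply: ler_sum_nat => t tn.
  have tT : (1 <= t <= T)%N by exact: range_trans tn.
  have s1 := noise_bound_le tT.
  set G := grad f (xbar t).
  have -> : enorm (xi t) ^+ 2 - enorm (g t) ^+ 2 = - 2 * dot G (xi t) - enorm G ^+ 2.
    by rewrite !sqr_enorm !dotE (dotC _ G); ring.
  rewrite enormZ exprMn real_normK ?num_real// sqrrN !dotE.
  have -> : 2 * Pa ^+ 2 * (- (Pa ^+ 2)^-1 * dot G (g t) - - (Pa ^+ 2)^-1 * dot G G
       - (Pa ^+ 2)^-1 ^+ 2 * enorm G ^+ 2 * sigma2 (xbar t) / 2)
    = - 2 * (dot G (g t) - dot G G) - enorm G ^+ 2 * (sigma2 (xbar t) / Pa ^+ 2).
    by field; rewrite gt_eqF.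
  rewrite lerD2l lerN2 ler_piMr ?sqr_ge0//.
  by rewrite ler_pdivrMr// mul1r.
rewrite sumrB => h.
have := ler_wpM2l (ltW (mulr_gt0 (@ltr0Sn R 1) P2)) (event2 nT).
lra.
Qed.

(** The bound of [sum_div_delayed_le_ln] with threshold [(4 * l + 2) * Pa ^+ 2]. The noise
    accumulated through time [t] is at most the past squared gradients plus [(2 * l + 1) * Pa ^+ 2],
    the last [Pa ^+ 2] being the noise of time [t]; beyond the threshold at least half of it is thus
    matched by past gradients. *)
Definition variance_budget : R :=
  eta ^+ 2 * ((4 * l + 2) * Pa ^+ 2 / G0 ^+ 2
              + 2 * ln (1 + T%:R * Pa ^+ 2 / (2 * G0 ^+ 2))).

Lemma sum_weighted_noise_le n : (n <= T)%N ->
  \sum_(1 <= t < n.+1) delayed_step t ^+ 2 * enorm (xi t) ^+ 2 <= variance_budget.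
Proof.
move=> nT; have P2 : 0 < Pa ^+ 2 by rewrite exprn_gt0.
have G2 : 0 < G0 ^+ 2 by rewrite exprn_gt0.
have -> : \sum_(1 <= t < n.+1) delayed_step t ^+ 2 * enorm (xi t) ^+ 2 =
   eta ^+ 2 * \sum_(1 <= t < n.+1) enorm (xi t) ^+ 2 /
     (G0 ^+ 2 + \sum_(1 <= k < t) enorm (g k) ^+ 2).
  rewrite mulr_sumr; apply: eq_bigr => t _.
  by rewrite expr_div_n sqr_sqrtr ?(ltW (delayed_denom_gt0 t))// mulrAC mulrA.
rewrite ler_pM2l ?exprn_gt0//.
have th0 : 0 <= (4 * l + 2) * Pa ^+ 2.
  by apply: mulr_ge0; [have := l1; lra|exact: ltW].
have V0 : 0 <= \sum_(1 <= t < n.+1) enorm (xi t) ^+ 2.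
  by apply: sumr_ge0 => t _; exact: sqr_ge0.
apply: le_trans (@sum_div_delayed_le_ln R (fun t => enorm (xi t) ^+ 2) _ (G0 ^+ 2)
    ((4 * l + 2) * Pa ^+ 2) n G2 th0 _ _ _) _.
- by move=> k; exact: sqr_ge0.
- by move=> k _; rewrite lerDl sum_sqr_ge0.
- case=> // k kn; rewrite !(@big_nat_recr _ _ _ k.+1)//=.
  have kT : (1 <= k.+1 <= T)%N by exact: range_trans kn.
  have := sum_noise_le (ltnW kT); have := sqr_noise_le kT.
  by lra.
rewrite lerD2l ler_pM2l// ler_ln ?posrE; last 2 first.
- by apply: ltr_wpDr => //; apply: divr_ge0 => //; apply: mulr_ge0 => //; exact: ltW.
- apply: ltr_wpDr => //; apply: divr_ge0; first by apply: mulr_ge0 => //; exact: ltW.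
  by apply: mulr_ge0 => //; exact: ltW.
rewrite lerD2l ler_pM2r ?invr_gt0 ?mulr_gt0//.
apply: le_trans (_ : \sum_(1 <= k < n.+1) Pa ^+ 2 <= _).
  by apply: ler_sum_nat => k kn; apply: sqr_noise_le; exact: range_trans kn.
by rewrite sumr_const_nat subSS subn0 -[leLHS]mulr_natl; apply: ler_wpM2r; rewrite ?ler_nat// ltW.
Qed.

Variables (xstar : 'rV[R]_d) (Dd Ra : R).
Hypotheses (fstar : f xstar = fs) (cf : convex_function [set: 'rV[R]_d] f).
Hypotheses (RaP : variance_budget <= Ra) (D0 : 0 <= Dd).
Hypothesis Ra7 : 7 * (eta * Pa / G0) ^+ 2 * l <= Ra.
Hypothesis D2 : 2 * enorm (x 1%N - xstar) ^+ 2 + 8 * (eta ^+ 2 * H) + eta ^+ 2 / 2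
   + 108 * (Ra * l) <= Dd ^+ 2.

Local Notation U := (Dd + eta).
Local Notation lam := (Num.sqrt (l / Ra) / (2 * U)).
Local Notation u t := (xbar t - xstar).
Local Notation v3 t := (- (lam * delayed_step t) *: u t).
Hypothesis event3 : forall n, (n <= T)%N ->
  \sum_(1 <= t < n.+1)
    (if enorm (v3 t) ^+ 2 * sigma2 (xbar t) <= 1 / 16 then
       dot (v3 t) (xi t) - dot (v3 t) (xi t) ^+ 2 else 0) <= l.

Lemma gap_le t : f (xbar t) - fs <= dot (grad f (xbar t)) (u t).
Proof.
have := convex_grad_le (xbar t) xstar sf.1 cf; rewrite fstar -opprB dotNr; lra.
Qed.

Lemma gap_ge0 t : 0 <= f (xbar t) - fs.
Proof. by rewrite subr_ge0. Qed.

Lemma Ra_gt0 : 0 < Ra.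
Proof.
apply: lt_le_trans Ra7; apply: mulr_gt0; last exact: lt_le_trans l1.
by apply: mulr_gt0 => //; apply: exprn_gt0; apply: divr_gt0 => //; exact: mulr_gt0.
Qed.

(** Strong induction: distances at most [Dd] at the earlier iterates give [enorm (u t) <= U], which
    bounds the quadratic part of the self-normalized exponent by the noise budget [Ra]. *)
Lemma distances_bound n : (n <= T)%N -> enorm (x n.+1 - xstar) <= Dd.
Proof.
have [pstep pclose psum] := path.
have R0 := Ra_gt0.
have U0 : 0 < U by rewrite ltr_wpDl.
have l0 : 0 < l by exact: lt_le_trans l1.
have lR : 0 < l / Ra by rewrite divr_gt0.
have sl : 0 < Num.sqrt (l / Ra) by rewrite sqrtr_gt0.
have lam0 : 0 < lam by rewrite divr_gt0// mulr_gt0.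
pose s := Num.sqrt (Ra * l).
have s2 : s ^+ 2 = Ra * l by rewrite sqr_sqrtr// ltW// mulr_gt0.
have s0 : 0 < s by rewrite sqrtr_gt0 mulr_gt0.
have lamE : l / lam = 2 * U * s.
  have e : Num.sqrt (l / Ra) = l / s.
    apply/eqP; rewrite -(@eqrXn2 _ 2)// ?(ltW sl) ?divr_ge0 ?(ltW l0) ?(ltW s0)//.
    rewrite sqr_sqrtr ?(ltW lR)// expr_div_n s2; apply/eqP; field.
    by rewrite !gt_eqF.
  by rewrite e; field; rewrite !gt_eqF.
(* The scale [lam] makes the quadratic part cost at most [l / 4], so that the tested noise sums to
   at most [5 / 4 * l]; division by [lam] turns [l] into [2 * U * s]. *)
have lam2 : lam ^+ 2 * U ^+ 2 * Ra = l / 4.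
  rewrite expr_div_n sqr_sqrtr ?(ltW lR)//; field.
  by rewrite !gt_eqF.
pose b := eta * Pa / G0.
have b0 : 0 < b by rewrite divr_gt0// mulr_gt0.
have bs : 2 * b <= s.
  apply: le_of_sqr; rewrite ?(ltW s0)// s2.
  have h1 := ler_wpM2r (ltW l0) Ra7; rewrite -/b in h1.
  have h2 : 1 <= l ^+ 2 by rewrite exprn_ege1.
  have h3 := ler_wpM2l (sqr_ge0 b) h2.
  by have := sqr_ge0 b; lra.
elim/ltn_ind: n => n IH nT.
have d1 : enorm (x 1%N - xstar) ^+ 2 <= Dd ^+ 2.
  have HH : 0 <= eta ^+ 2 * H.
    by apply: le_trans (sum_steps_le (leq0n T)); rewrite big_geq.
  have := sqr_ge0 (enorm (x 1%N - xstar)); have := sqr_ge0 eta.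
  by have := mulr_ge0 (ltW R0) (ltW l0); have := D2; lra.
have dD t : (1 <= t <= n)%N -> enorm (x t - xstar) <= Dd.
  by case: t => // t tn; apply: IH => //; exact: leq_trans (ltnW tn) nT.
have uU t : (1 <= t <= n)%N -> enorm (u t) <= U.
  move=> tn; have -> : u t = (x t - xstar) + (xbar t - x t).
    by rewrite [RHS]addrC addrA subrK.
  apply: le_trans (enormD _ _) (lerD (dD _ tn) (pclose _ _)).
  exact: range_trans tn.
(* Convexity discards the gradient part of the inner product. The noise part gets the delayed step
   as its weight; the correction is at most [2 * Pa * U] times the decrease of the delayed step, and
   telescopes. *)
have tel m : (m <= n)%N -> enorm (x m.+1 - xstar) ^+ 2 <= enorm (x 1%N - xstar) ^+ 2
    + 2 * \sum_(1 <= t < m.+1) stepsize eta G0 g t ^+ 2 * enorm (g t) ^+ 2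
    + \sum_(1 <= t < m.+1) enorm (xbar t - x t) ^+ 2
    + 2 * (\sum_(1 <= t < m.+1) dot (v3 t) (xi t)) / lam
    + 2 * Pa * U * (delayed_step 1 - delayed_step m.+1).
  elim: m => [_|m IHm mn].
    by rewrite !big_geq//; lra.
  have {}IHm := IHm (ltnW mn).
  have mT : (1 <= m.+1 <= T)%N by exact: leq_trans mn nT.
  rewrite !(@big_nat_recr _ _ _ m.+1)//= (pstep _ mT) -delayed_stepS.
  have h0 := delayed_step_gt0 m.+2; have k0 := delayed_step_gt0 m.+1.
  have kh := @delayed_step_nincr m.+1 isT.
  set h := delayed_step m.+2 in h0 kh *; set k := delayed_step m.+1 in k0 kh IHm *.
  set y := x m.+1 in IHm *; set yb := xbar m.+1; set gg := g m.+1.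
  have e1 : enorm (y - h *: gg - xstar) ^+ 2 =
     enorm (y - xstar) ^+ 2 - 2 * (h * dot gg (yb - xstar)) + 2 * (h * dot gg (yb - y))
     + h ^+ 2 * enorm gg ^+ 2.
    have -> : y - h *: gg - xstar = (y - xstar) - h *: gg by rewrite addrAC.
    rewrite [LHS]sqr_enormB enormZ exprMn real_normK ?num_real// dotZr (dotC _ gg).
    have {2}-> : y - xstar = (yb - xstar) - (yb - y) by rewrite opprB [RHS]addrC addrA subrK.
    by rewrite [dot gg _]dotDr dotNr; ring.
  have e2 : 2 * (h * dot gg (yb - y)) <= h ^+ 2 * enorm gg ^+ 2 + enorm (yb - y) ^+ 2.
    have := dotvv_ge0 (h *: gg - (yb - y)).
    by rewrite -sqr_enorm (sqr_enormB (h *: gg)) enormZ exprMn real_normK ?num_real// dotZl; lra.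
  have e3 : dot gg (yb - xstar) = dot (grad f yb) (yb - xstar) + dot (xi m.+1) (yb - xstar).
    by rewrite -dotDl [_ + xi _]addrC subrK.
  have e4 : 0 <= dot (grad f yb) (yb - xstar) := le_trans (gap_ge0 _) (gap_le _).
  have e5 : 2 * (k - h) * dot (xi m.+1) (yb - xstar) <= 2 * (k - h) * (Pa * U).
    apply: ler_wpM2l; first by rewrite mulr_ge0// subr_ge0.
    apply: le_trans (cauchy_schwarz _ _) _.
    by apply: ler_pM; rewrite ?enorm_ge0//; [exact: noise_le|exact: uU].
  have e6 : 2 * (\sum_(1 <= t < m.+1) dot (v3 t) (xi t) + dot (v3 m.+1) (xi m.+1)) / lam
    = 2 * (\sum_(1 <= t < m.+1) dot (v3 t) (xi t)) / lam - 2 * k * dot (xi m.+1) (yb - xstar).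
    rewrite [dot (v3 m.+1) _]dotZl (dotC (yb - xstar)) -/k.
    by move: (\sum_(1 <= t < m.+1) _) => q; field; rewrite !gt_eqF.
  rewrite e1 e6; have e7 := mulr_ge0 (ltW h0) e4.
  rewrite e3 mulrDr; move: IHm e2 e5 e7.
  move: (2 * (\sum_(1 <= t < m.+1) dot (v3 t) (xi t)) / lam) => q; lra.
(* Since 1/28 is below 1/16, the truncation of the self-normalized exponent never triggers along the
   induction. *)
have lamU : lam ^+ 2 * U ^+ 2 * b ^+ 2 <= 1 / 28.
  have h1 := ler_wpM2l (mulr_ge0 (sqr_ge0 lam) (sqr_ge0 U)) Ra7.
  rewrite lam2 -/b in h1.
  rewrite -(@ler_pM2r _ l)//.
  by move: h1; move: (lam ^+ 2 * U ^+ 2) (b ^+ 2) => p q; lra.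
have v3E t : enorm (v3 t) ^+ 2 = lam ^+ 2 * delayed_step t ^+ 2 * enorm (u t) ^+ 2.
  by rewrite enormZ exprMn real_normK ?num_real// sqrrN exprMn.
have cond t : (1 <= t <= n)%N -> enorm (v3 t) ^+ 2 * sigma2 (xbar t) <= 1 / 16.
  move=> tn; have tT : (1 <= t <= T)%N by exact: range_trans tn.
  have k0 := delayed_step_gt0 t; have k1 := delayed_step_le t.
  have kP : delayed_step t ^+ 2 * sigma2 (xbar t) <= b ^+ 2.
    apply: le_trans (ler_wpM2l (sqr_ge0 _) (noise_bound_le tT)) _.
    have kP0 : 0 <= delayed_step t * Pa by apply: mulr_ge0; exact: ltW.
    rewrite -exprMn ler_pXn2r ?nnegrE ?(ltW b0)//.
    by apply: le_trans (ler_wpM2r (ltW Pa0) k1) _; rewrite /b mulrAC.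
  have u2 : enorm (u t) ^+ 2 <= U ^+ 2.
    by rewrite ler_pXn2r ?nnegrE ?enorm_ge0 ?(ltW U0)// uU.
  rewrite v3E.
  have -> : lam ^+ 2 * delayed_step t ^+ 2 * enorm (u t) ^+ 2 * sigma2 (xbar t) =
    lam ^+ 2 * (enorm (u t) ^+ 2 * (delayed_step t ^+ 2 * sigma2 (xbar t))) by ring.
  have : enorm (u t) ^+ 2 * (delayed_step t ^+ 2 * sigma2 (xbar t)) <= U ^+ 2 * b ^+ 2.
    apply: ler_pM => //; first exact: sqr_ge0.
    apply: mulr_ge0; first exact: sqr_ge0.
    exact: le_trans (sqr_ge0 _) (noise tT).
  by move=> /(ler_wpM2l (sqr_ge0 lam)); lra.
have SX : \sum_(1 <= t < n.+1) dot (v3 t) (xi t) <= 5 / 4 * l.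
  have S1 : \sum_(1 <= t < n.+1) dot (v3 t) (xi t) <=
      \sum_(1 <= t < n.+1)
        (if enorm (v3 t) ^+ 2 * sigma2 (xbar t) <= 1 / 16 then
         dot (v3 t) (xi t) - dot (v3 t) (xi t) ^+ 2 else 0) +
      lam ^+ 2 * U ^+ 2 * \sum_(1 <= t < n.+1) delayed_step t ^+ 2 * enorm (xi t) ^+ 2.
    rewrite mulr_sumr -big_split /=; apply: ler_sum_nat => t tn.
    rewrite cond// -lerBlDl opprB addrC subrK.
    have k0 := delayed_step_gt0 t.
    have -> : lam ^+ 2 * U ^+ 2 * (delayed_step t ^+ 2 * enorm (xi t) ^+ 2) =
      (lam * delayed_step t * U * enorm (xi t)) ^+ 2 by ring.
    rewrite -[leLHS]real_normK ?num_real//.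
    have lk0 : 0 <= lam * delayed_step t by apply: mulr_ge0; exact: ltW.
    have w0 : 0 <= lam * delayed_step t * U * enorm (xi t).
      by apply: mulr_ge0; [apply: mulr_ge0 => //; exact: ltW|exact: enorm_ge0].
    rewrite ler_pXn2r ?nnegrE//.
    apply: le_trans (normr_dot _ _) _; apply: ler_wpM2r; first exact: enorm_ge0.
    rewrite enormZ normrN (ger0_norm lk0).
    by apply: ler_wpM2l => //; exact: uU.
  have S2 := event3 nT.
  have S3 := le_trans (sum_weighted_noise_le nT) RaP.
  have S4 := ler_wpM2l (mulr_ge0 (sqr_ge0 lam) (sqr_ge0 U)) S3.
  by rewrite lam2 in S4; lra.
have t1 : 2 * (\sum_(1 <= t < n.+1) dot (v3 t) (xi t)) / lam <= 5 * (U * s).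
  rewrite ler_pdivrMr//.
  have lamE' : l = 2 * U * s * lam by rewrite -lamE divfK ?gt_eqF.
  have -> : 5 * (U * s) * lam = 5 / 2 * (2 * U * s * lam) by move: lam => q; field.
  by rewrite -lamE'; lra.
have t2 : 2 * Pa * U * (delayed_step 1 - delayed_step n.+1) <= U * s.
  have h1 := delayed_step_le 1; have h2 := delayed_step_gt0 n.+1.
  have h3 : delayed_step 1 - delayed_step n.+1 <= eta / G0 by lra.
  apply: le_trans (ler_wpM2l _ h3) _.
    by apply: mulr_ge0; [apply: mulr_ge0 => //; exact: ltW|exact: ltW].
  have -> : 2 * Pa * U * (eta / G0) = U * (2 * b) by rewrite /b; ring.
  by apply: ler_wpM2l => //; exact: ltW.
have S := tel n (leqnn n).
have N1 := sum_steps_le nT; have N2 := sum_perturbations_le nT.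
apply: le_of_sqr => //.
(* The noise contributes [6 * U * s] in total. Young's inequality gives
   [6 * Dd * s <= Dd ^+ 2 / 2 + 18 * s ^+ 2] and [6 * eta * s <= eta ^+ 2 / 4 + 36 * s ^+ 2];
   solving for [Dd ^+ 2] doubles 18 + 36 to 108. *)
have q1 := sqr_ge0 (Dd - 6 * s); have q2 := sqr_ge0 (eta / 2 - 6 * s).
have DD := D2; rewrite -s2 in DD.
move: S N1 N2 t1 t2 q1 q2 DD.
move: (\sum_(1 <= t < n.+1) enorm _ ^+ 2) (\sum_(1 <= t < n.+1) _ ^+ 2 * enorm _ ^+ 2)
  (2 * _ / lam) (2 * Pa * U * _) (eta ^+ 2 * H) (enorm (x n.+1 - xstar) ^+ 2)
  (enorm (x 1%N - xstar) ^+ 2) => a1 a2 a3 a4 a5 a6 a7.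
lra.
Qed.

End distances.

(** * Stage 4: regret and the averaged query point *)

Section averages.
Variables (R : realType) (d : nat) (f : 'rV[R]_d -> R).
Variables (L0 L1 A B C eta G0 Da hh : R) (T : nat) (x xbar g : nat -> 'rV[R]_d).
Hypotheses (L00 : 0 < L0) (L10 : 0 < L1) (sf : L0L1_smooth L0 L1 f).
Hypotheses (A0 : 0 < A) (B0 : 0 < B) (C0 : 0 < C).
Hypotheses (eta0 : 0 < eta) (G00 : 0 < G0) (Da0 : 0 <= Da) (T1 : (1 <= T)%N).

Local Notation fs := (inf (range f)).
Local Notation sigma2 := (noise_bound f A B C).
Local Notation xi t := (g t - grad f (xbar t)).

Hypothesis fsP : forall y, fs <= f y.
Hypothesis path : perturbed_path eta G0 T x xbar g.
Hypothesis noise : forall t, (1 <= t <= T)%N -> enorm (xi t) ^+ 2 <= sigma2 (xbar t).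
Hypothesis level : forall t, (1 <= t <= T)%N -> f (xbar t) - fs <= Da.
Hypothesis perturb :
  \sum_(1 <= t < T.+1) enorm (xbar t - x t) ^+ 2 <= 2 * (eta ^+ 2 * hh).

Variables (xstar : 'rV[R]_d) (Dd l : R).
Hypotheses (fstar : f xstar = fs) (cf : convex_function [set: 'rV[R]_d] f).
Hypotheses (l0 : 0 < l) (D0 : 0 <= Dd) (hh0 : 0 <= hh).
Hypothesis dist : forall t, (1 <= t <= T.+1)%N -> enorm (x t - xstar) <= Dd.

Local Notation U := (Dd + eta).
Local Notation u t := (xbar t - xstar).
Local Notation a := (A + 4 * B * (L0 + L1 ^+ 2 * Da)).
Local Notation cg := (A + 4 * (B + 1) * (L0 + L1 ^+ 2 * Da)).
Local Notation K := (2 * eta + Dd ^+ 2 / eta + eta * hh).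
Local Notation Del t := (f (xbar t) - fs).
Local Notation S := (\sum_(1 <= t < T.+1) enorm (g t) ^+ 2).

(** Below the level [Da] one factor of the squared gap is bounded by [Da], so squared gradients are
    linear in the gap. This self-bounding lets the multiplicative noise be absorbed by the sum of
    gaps and leaves only [C] in the slow rate. *)
Lemma sqr_grad_le_gap t : (1 <= t <= T)%N ->
  enorm (grad f (xbar t)) ^+ 2 <= 4 * (L0 + L1 ^+ 2 * Da) * Del t.
Proof.
move=> tT; apply: le_trans (sqr_grad_le L00 L10 sf _ fsP) _.
have g0 : 0 <= Del t by rewrite subr_ge0.
have := ler_wpM2l (mulr_ge0 (sqr_ge0 L1) g0) (level tT); lra.
Qed.

Lemma noise_bound_le_gap t : (1 <= t <= T)%N -> sigma2 (xbar t) <= a * Del t + C.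
Proof.
by move=> tT; rewrite /noise_bound; have := ler_wpM2l (ltW B0) (sqr_grad_le_gap tT); lra.
Qed.

Lemma sqr_g_le_gap t : (1 <= t <= T)%N -> enorm (g t) ^+ 2 <= 2 * cg * Del t + 2 * C.
Proof.
move=> tT; rewrite -[g t](subrK (grad f (xbar t))).
apply: le_trans (sqr_enormD_le _ _) _.
have := le_trans (noise tT) (noise_bound_le_gap tT).
have := sqr_grad_le_gap tT; lra.
Qed.

Lemma sum_sqr_g_le : S <= 2 * cg * \sum_(1 <= t < T.+1) Del t + 2 * C * T%:R.
Proof.
apply: le_trans (_ : \sum_(1 <= t < T.+1) (2 * cg * Del t + 2 * C) <= _).
  by apply: ler_sum_nat => t tT; exact: sqr_g_le_gap.
by rewrite big_split /= -mulr_sumr sumr_const_nat subSS subn0 -[(2 * C) *+ T]mulr_natr.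
Qed.

Lemma u_le t : (1 <= t <= T)%N -> enorm (u t) <= U.
Proof.
have [_ pclose _] := path; move=> tT.
have -> : u t = (x t - xstar) + (xbar t - x t) by rewrite [RHS]addrC addrA subrK.
apply: le_trans (enormD _ _) (lerD (dist _) (pclose _ tT)).
by case/andP: tT => -> /leqW ->.
Qed.

(* Summation by parts in the weights [1 / stepsize], which are nondecreasing. *)
Lemma weighted_regret_le :
  2 * \sum_(1 <= t < T.+1) dot (g t) (u t) <=
    G0 * enorm (x 1%N - xstar) ^+ 2 / eta + 2 * K * Num.sqrt S + 2 * eta * hh * G0.
Proof.
have [pstep pclose psum] := path.
have eta_neq0 : eta != 0 by rewrite gt_eqF.
pose w t := Num.sqrt (G0 ^+ 2 + \sum_(1 <= k < t.+1) enorm (g k) ^+ 2) / eta.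
have w0 t : 0 < w t by rewrite divr_gt0// sqrtr_gt0 denom_gt0.
have wh t : w t * stepsize eta G0 g t = 1.
  rewrite /w /stepsize mulrA divfK// mulfV// gt_eqF// sqrtr_gt0.
  exact: denom_gt0.
have wS t : w t <= w t.+1.
  rewrite ler_pM2r ?invr_gt0// ler_wsqrtr// [X in _ <= _ + X]big_nat_recr//= addrA.
  by rewrite lerDl sqr_ge0.
have wm m n : (m <= n)%N -> w m <= w n.
  elim: n => [|n IH]; first by rewrite leqn0 => /eqP ->.
  by rewrite leq_eqVlt => /predU1P[->//|/IH /le_trans]; apply.
have w00 : w 0%N = G0 / eta.
  by rewrite /w big_geq// addr0 sqrtr_sqr gtr0_norm.
have tel m : (m <= T)%N -> 2 * \sum_(1 <= t < m.+1) dot (g t) (u t) <=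
    w 0%N * enorm (x 1%N - xstar) ^+ 2 + Dd ^+ 2 * (w m - w 0%N)
    - w m * enorm (x m.+1 - xstar) ^+ 2
    + 2 * \sum_(1 <= t < m.+1) stepsize eta G0 g t * enorm (g t) ^+ 2
    + w T * \sum_(1 <= t < m.+1) enorm (xbar t - x t) ^+ 2.
  elim: m => [_|m IHm mT].
    by rewrite !big_geq// subrr !mulr0 !addr0 subrr.
  have {}IHm := IHm (ltnW mT).
  rewrite !(@big_nat_recr _ _ _ m.+1)//= (pstep m.+1 mT).
  have kT := wm _ _ mT; have km := wS m.
  have k0 := w0 m.+1; have kh := wh m.+1.
  have d1 : enorm (x m.+1 - xstar) ^+ 2 <= Dd ^+ 2.
    by rewrite ler_pXn2r ?nnegrE ?enorm_ge0//; apply: dist; exact: leqW.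
  set h := stepsize _ _ _ _ in kh *; set k := w m.+1 in kT km k0 kh *.
  set y := x m.+1 in IHm d1 *; set yb := xbar m.+1; set gg := g m.+1.
  have e1 : k * enorm (y - h *: gg - xstar) ^+ 2 =
     k * enorm (y - xstar) ^+ 2 - 2 * dot gg (yb - xstar) + 2 * dot gg (yb - y)
     + h * enorm gg ^+ 2.
    have -> : y - h *: gg - xstar = (y - xstar) - h *: gg by rewrite addrAC.
    rewrite [X in k * X]sqr_enormB enormZ exprMn real_normK ?num_real// dotZr (dotC _ gg).
    have {2}-> : y - xstar = (yb - xstar) - (yb - y).
      by rewrite opprB [RHS]addrC addrA subrK.
    rewrite [dot gg _]dotDr dotNr.
    have -> : k * (enorm (y - xstar) ^+ 2 - 2 * (h * (dot gg (yb - xstar) - dot gg (yb - y)))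
        + h ^+ 2 * enorm gg ^+ 2) = k * enorm (y - xstar) ^+ 2
      - 2 * (k * h) * (dot gg (yb - xstar) - dot gg (yb - y))
      + (k * h) * h * enorm gg ^+ 2 by ring.
    by rewrite kh; ring.
  (* Young's inequality with the reciprocal weights [h] and [k], as [k * h = 1]. *)
  have e2 : 2 * dot gg (yb - y) <= h * enorm gg ^+ 2 + k * enorm (yb - y) ^+ 2.
    have := mulr_ge0 (ltW k0) (dotvv_ge0 (h *: gg - (yb - y))).
    rewrite -sqr_enorm (sqr_enormB (h *: gg)) enormZ exprMn real_normK ?num_real// dotZl.
    have -> : k * (h ^+ 2 * enorm gg ^+ 2 - 2 * (h * dot gg (yb - y)) + enorm (yb - y) ^+ 2)
      = (k * h) * h * enorm gg ^+ 2 - 2 * (k * h) * dot gg (yb - y)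
        + k * enorm (yb - y) ^+ 2 by ring.
    by rewrite kh; lra.
  have e3 : k * enorm (yb - y) ^+ 2 <= w T * enorm (yb - y) ^+ 2.
    by apply: ler_wpM2r => //; exact: sqr_ge0.
  have e4 : (k - w m) * enorm (y - xstar) ^+ 2 <= (k - w m) * Dd ^+ 2.
    by apply: ler_wpM2l => //; rewrite subr_ge0.
  move: IHm e2 e3 e4; rewrite e1.
  move: (\sum_(1 <= t < m.+1) dot _ _) (\sum_(1 <= t < m.+1) _ * _)
    (\sum_(1 <= t < m.+1) enorm _ ^+ 2) => q1 q2 q3.
  lra.
have sS : w T <= (G0 + Num.sqrt S) / eta.
  rewrite ler_pM2r ?invr_gt0//; apply: le_trans (sqrtrD_le _ _) _; rewrite ?sqr_ge0//.
    exact: sum_sqr_ge0.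
  by rewrite sqrtr_sqr gtr0_norm.
have hS : \sum_(1 <= t < T.+1) stepsize eta G0 g t * enorm (g t) ^+ 2 <= 2 * eta * Num.sqrt S.
  have -> : \sum_(1 <= t < T.+1) stepsize eta G0 g t * enorm (g t) ^+ 2 =
    eta * \sum_(1 <= t < T.+1) enorm (g t) ^+ 2 /
       Num.sqrt (G0 ^+ 2 + \sum_(1 <= k < t.+1) enorm (g k) ^+ 2).
    by rewrite mulr_sumr; apply: eq_bigr => t _; rewrite mulrAC mulrA.
  have -> : 2 * eta * Num.sqrt S = eta * (2 * Num.sqrt S) by ring.
  rewrite ler_pM2l//.
  have G2 : 0 < G0 ^+ 2 by rewrite exprn_gt0.
  apply: le_trans (sum_div_sqrt_le T G2 (fun k => sqr_ge0 (enorm (g k)))) _.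
  rewrite ler_pM2l// lerBlDl.
  by apply: sqrtrD_le; [exact: ltW|exact: sum_sqr_ge0].
have := tel T (leqnn T); rewrite w00.
have wd := mulr_ge0 (ltW (w0 T)) (sqr_ge0 (enorm (x T.+1 - xstar))).
have r1 := ler_wpM2l (ltW (w0 T)) perturb.
have E0 : 0 <= 2 * (eta ^+ 2 * hh) by rewrite !mulr_ge0 ?(ltW eta0).
have r2 := ler_wpM2r E0 sS.
have r3 : (G0 + Num.sqrt S) / eta * (2 * (eta ^+ 2 * hh)) = 2 * eta * hh * (G0 + Num.sqrt S).
  by field.
rewrite r3 in r2.
have r4 := ler_wpM2l (sqr_ge0 Dd) sS.
have r5 : Dd ^+ 2 * ((G0 + Num.sqrt S) / eta) = Dd ^+ 2 / eta * G0 + Dd ^+ 2 / eta * Num.sqrt S.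
  by field.
rewrite r5 in r4.
have -> : G0 / eta * enorm (x 1%N - xstar) ^+ 2 = G0 * enorm (x 1%N - xstar) ^+ 2 / eta by ring.
have -> : Dd ^+ 2 * (w T - G0 / eta) = Dd ^+ 2 * w T - Dd ^+ 2 / eta * G0 by ring.
have q0 : 0 <= Num.sqrt S := sqrtr_ge0 _.
have q1 : 0 <= Dd ^+ 2 / eta * Num.sqrt S by rewrite mulr_ge0 ?divr_ge0 ?sqr_ge0 ?(ltW eta0).
have q2 : 0 <= eta * hh * Num.sqrt S by rewrite !mulr_ge0 ?(ltW eta0).
move: hS wd r1 r2 r4 q1 q2.
move: (\sum_(1 <= t < T.+1) dot _ _) (\sum_(1 <= t < T.+1) _ * enorm _ ^+ 2)
  (\sum_(1 <= t < T.+1) enorm (xbar _ - _) ^+ 2) (Num.sqrt S) (Dd ^+ 2 / eta)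
  (G0 * enorm (x 1%N - xstar) ^+ 2 / eta) (w T) => p1 p2 p3 p4 p5 p6 p7.
lra.
Qed.

Local Notation lam := (Num.min (1 / (2 * a * U ^+ 2)) (Num.sqrt (l / (C * T%:R)) / U)).
Local Notation v4 t := (- lam *: u t).
Hypothesis event4 :
  \sum_(1 <= t < T.+1) (dot (v4 t) (xi t) - enorm (v4 t) ^+ 2 * sigma2 (xbar t) / 2) <= l.

(** The two bounds on [lam] treat the two parts of the compensator: the first keeps the part
    proportional to the gaps below a quarter of their sum, the second balances the constant part
    [C * T%:R] against [l / lam]. Since [l / lam] is at most the sum of its two candidate values,
    both appear in the bound. *)
Lemma noise_regret_le : - \sum_(1 <= t < T.+1) dot (xi t) (u t) <=
  (\sum_(1 <= t < T.+1) Del t) / 4 + 2 * a * U ^+ 2 * l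
  + 3 / 2 * U * Num.sqrt (C * l) * Num.sqrt T%:R.
Proof.
have U0 : 0 < U by rewrite ltr_wpDl.
have a0 : 0 < a.
  rewrite ltr_wpDr// !mulr_ge0 ?(ltW B0)//.
  by rewrite addr_ge0 ?(ltW L00)// mulr_ge0// sqr_ge0.
have T0 : 0 < T%:R :> R by rewrite ltr0n.
have CT0 : 0 < C * T%:R by rewrite mulr_gt0.
pose s := Num.sqrt (l / (C * T%:R)).
have s0 : 0 < s by rewrite sqrtr_gt0 divr_gt0.
have s2 : s ^+ 2 = l / (C * T%:R) by rewrite sqr_sqrtr// ltW// divr_gt0.
pose r := Num.sqrt (C * l) * Num.sqrt T%:R.
have r0 : 0 < r by rewrite mulr_gt0// sqrtr_gt0// mulr_gt0.
have r2 : r ^+ 2 = C * l * T%:R.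
  by rewrite exprMn !sqr_sqrtr// ?(ltW T0)// ltW// mulr_gt0.
have sCT : s * (C * T%:R) = r.
  apply/eqP; rewrite -(@eqrXn2 _ 2)// ?(ltW r0) ?mulr_ge0 ?(ltW s0) ?(ltW C0)//.
  rewrite exprMn s2 r2; apply/eqP; field.
  by rewrite !gt_eqF.
have rs : r * s = l by rewrite -sCT mulrAC -expr2 s2 divfK ?gt_eqF.
have ls : l / s = r by rewrite -rs mulfK ?gt_eqF.
have aU0 : 0 < 2 * a * U ^+ 2 by rewrite !mulr_gt0// exprn_gt0.
have E := event4; rewrite sumrB in E.
set la := lam in E *.
have la0 : 0 < la by rewrite lt_min divr_gt0//= divr_gt0.
have la1 : la * (2 * a * U ^+ 2) <= 1.
  by rewrite -ler_pdivlMr// ge_min lexx.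
have la2 : la * U <= s by rewrite -ler_pdivlMr// ge_min lexx orbT.
have lla : l / la <= 2 * a * U ^+ 2 * l + U * r.
  have [h|h] := leP (1 / (2 * a * U ^+ 2)) (s / U).
    have -> : l / la = 2 * a * U ^+ 2 * l.
      have -> : la = 1 / (2 * a * U ^+ 2) by apply/min_idPl.
      by rewrite div1r invrK mulrC.
    by rewrite lerDl mulr_ge0 ?(ltW U0) ?(ltW r0).
  have -> : l / la = U * r.
    have -> : la = s / U by apply/min_idPr; exact: ltW.
    by rewrite -ls invf_div mulrCA.
  by rewrite lerDr mulr_ge0 ?(ltW aU0) ?(ltW l0).
have X0 : 0 <= \sum_(1 <= t < T.+1) Del t.
  by apply: sumr_ge0 => t _; rewrite subr_ge0.
have Q : \sum_(1 <= t < T.+1) (enorm (- la *: u t) ^+ 2 * sigma2 (xbar t) / 2) <=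
    la ^+ 2 * U ^+ 2 / 2 * (a * \sum_(1 <= t < T.+1) Del t + C * T%:R).
  have -> : a * \sum_(1 <= t < T.+1) Del t + C * T%:R = \sum_(1 <= t < T.+1) (a * Del t + C).
    rewrite [RHS]big_split /= sumr_const_nat subSS subn0 -[C *+ T]mulr_natr.
    by rewrite mulr_sumr.
  rewrite mulr_sumr; apply: ler_sum_nat => t tT.
  rewrite enormZ exprMn real_normK ?num_real// sqrrN.
  have h1 := noise_bound_le_gap tT.
  have h2 : enorm (u t) ^+ 2 <= U ^+ 2.
    by rewrite ler_pXn2r ?nnegrE ?enorm_ge0 ?(ltW U0)// u_le.
  have h3 : enorm (u t) ^+ 2 * sigma2 (xbar t) <= U ^+ 2 * (a * Del t + C).
    apply: ler_pM => //; first exact: sqr_ge0.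
    exact: le_trans (sqr_ge0 _) (noise tT).
  by have := ler_wpM2l (sqr_ge0 la) h3; lra.
have e1 : \sum_(1 <= t < T.+1) dot (- la *: u t) (xi t) =
    la * - \sum_(1 <= t < T.+1) dot (xi t) (u t).
  by rewrite mulrN -mulNr mulr_sumr; apply: eq_bigr => t _; rewrite dotZl dotC.
rewrite e1 in E.
move: (- \sum_(1 <= t < T.+1) dot (xi t) (u t)) (\sum_(1 <= t < T.+1) Del t) X0 Q E
  => M X X0 Q E.
have E2 : la * M <= l + la ^+ 2 * U ^+ 2 / 2 * (a * X + C * T%:R) by lra.
have E3 : M <= l / la + la * U ^+ 2 / 2 * (a * X + C * T%:R).
  rewrite -(ler_pM2l la0); apply: (le_trans E2).
  rewrite le_eqVlt; apply/orP; left; apply/eqP.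
  by move: la la0 {la1 la2 lla E2 e1 Q E} => q q0; field; rewrite gt_eqF.
have E4 : la * U ^+ 2 / 2 * (a * X) <= X / 4.
  have := ler_wpM2r X0 la1; lra.
have E5 : la * U ^+ 2 / 2 * (C * T%:R) <= U * r / 2.
  have := ler_wpM2r (mulr_ge0 (ltW U0) (ltW CT0)) la2.
  have -> : s * (U * (C * T%:R)) = U * (s * (C * T%:R)) by ring.
  rewrite sCT; lra.
have -> : 3 / 2 * U * Num.sqrt (C * l) * Num.sqrt T%:R = 3 / 2 * (U * r).
  by rewrite /r; ring.
move: E3 E4 E5 lla; rewrite mulrDr; lra.
Qed.

(** The sum of gaps occurs on both sides: a quarter of it comes from the noise, and another quarter
    from [K * Num.sqrt S], because [S] is itself linear in the gaps. Half of the sum remains on the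
    left. *)
Lemma sum_gap_le : \sum_(1 <= t < T.+1) Del t <=
  2 * G0 * enorm (x 1%N - xstar) ^+ 2 / eta + 4 * eta * hh * G0 + 4 * K ^+ 2 * cg
  + 12 * a * U ^+ 2 * l
  + (7 * U * Num.sqrt (C * l) + 4 * K * Num.sqrt (2 * C)) * Num.sqrt T%:R.
Proof.
have h1 : \sum_(1 <= t < T.+1) Del t <=
    \sum_(1 <= t < T.+1) dot (g t) (u t) - \sum_(1 <= t < T.+1) dot (xi t) (u t).
  rewrite -sumrB; apply: ler_sum_nat => t tT.
  rewrite -dotNl -dotDl opprB addrCA subrr addr0.
  exact: (gap_le xbar sf fstar cf t).
have h2 := weighted_regret_le; have h3 := noise_regret_le.
have h4 := sum_sqr_g_le.
have LD0 : 0 <= L0 + L1 ^+ 2 * Da.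
  by rewrite addr_ge0 ?(ltW L00)// mulr_ge0// sqr_ge0.
have cg0 : 0 <= cg.
  rewrite addr_ge0 ?(ltW A0)//; apply: mulr_ge0 => //; apply: mulr_ge0 => //.
  by rewrite addr_ge0 ?(ltW B0).
have a0 : 0 <= a.
  rewrite addr_ge0 ?(ltW A0)//; apply: mulr_ge0 => //; apply: mulr_ge0 => //; exact: ltW.
have X0 : 0 <= \sum_(1 <= t < T.+1) Del t.
  by apply: sumr_ge0 => t _; rewrite subr_ge0.
have S0 : 0 <= S by exact: sum_sqr_ge0.
have K0 : 0 <= K.
  by rewrite !addr_ge0 ?divr_ge0 ?mulr_ge0 ?sqr_ge0 ?(ltW eta0).
have U0 : 0 <= U by rewrite addr_ge0 ?(ltW eta0).
set X := \sum_(1 <= t < T.+1) Del t in h1 h3 h4 X0 *.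
have h5 : Num.sqrt S <= Num.sqrt (2 * cg * X) + Num.sqrt (2 * C) * Num.sqrt T%:R.
  rewrite -sqrtrM ?mulr_ge0 ?(ltW C0)//.
  apply: le_trans (ler_wsqrtr h4) (sqrtrD_le _ _).
    by rewrite !mulr_ge0.
  by rewrite !mulr_ge0 ?(ltW C0).
have h6 : K * Num.sqrt (2 * cg * X) <= X / 4 + 2 * K ^+ 2 * cg.
  apply: le_of_sqr; first by rewrite addr_ge0 ?divr_ge0 ?mulr_ge0 ?sqr_ge0.
  rewrite exprMn sqr_sqrtr ?mulr_ge0//.
  have aux (p q r : R) : p ^+ 2 * (2 * q * r) <= (r / 4 + 2 * p ^+ 2 * q) ^+ 2.
    by have := sqr_ge0 (r / 4 - 2 * p ^+ 2 * q); lra.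
  exact: aux.
have h7 := ler_wpM2l K0 h5.
have q0 : 0 <= U * Num.sqrt (C * l) * Num.sqrt T%:R by rewrite !mulr_ge0 ?sqrtr_ge0.
have q1 : 0 <= K * (Num.sqrt (2 * C) * Num.sqrt T%:R) by rewrite !mulr_ge0 ?sqrtr_ge0.
have q2 : 0 <= a * U ^+ 2 * l by rewrite !mulr_ge0 ?sqr_ge0 ?(ltW l0).
have q3 : 0 <= eta * hh * G0 by rewrite !mulr_ge0 ?(ltW eta0) ?(ltW G00).
have q4 : 0 <= G0 * enorm (x 1%N - xstar) ^+ 2 / eta.
  by apply: divr_ge0; [apply: mulr_ge0; [exact: ltW|exact: sqr_ge0]|exact: ltW].
rewrite mulrDr in h7.
have -> : 2 * G0 * enorm (x 1%N - xstar) ^+ 2 / eta =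
  2 * (G0 * enorm (x 1%N - xstar) ^+ 2 / eta) by ring.
have -> : (7 * U * Num.sqrt (C * l) + 4 * K * Num.sqrt (2 * C)) * Num.sqrt T%:R =
  7 * (U * Num.sqrt (C * l) * Num.sqrt T%:R)
  + 4 * (K * (Num.sqrt (2 * C) * Num.sqrt T%:R)) by ring.
have h3' : - (\sum_(1 <= t < T.+1) dot (xi t) (u t)) <=
  X / 4 + 2 * (a * U ^+ 2 * l) + 3 / 2 * (U * Num.sqrt (C * l) * Num.sqrt T%:R).
  by move: h3; rewrite !mulrA.
have -> : 12 * a * U ^+ 2 * l = 12 * (a * U ^+ 2 * l) by ring.
have -> : 4 * K ^+ 2 * cg = 2 * (2 * K ^+ 2 * cg) by ring.
have -> : 4 * eta * hh * G0 = 4 * (eta * hh * G0) by ring.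
have h2' : 2 * \sum_(1 <= t < T.+1) dot (g t) (u t) <=
  G0 * enorm (x 1%N - xstar) ^+ 2 / eta + 2 * (K * Num.sqrt S) + 2 * (eta * hh * G0).
  by move: h2; rewrite !mulrA.
move: h1 h2' h3' h6 h7 q0 q1 q2 q3 q4.
move: (\sum_(1 <= t < T.+1) dot (g t) (u t)) (\sum_(1 <= t < T.+1) dot (xi t) (u t))
  (U * _ * _) (K * (_ * _)) (K * Num.sqrt S) (a * _ * _) (eta * hh * G0)
  (G0 * _ / eta) (2 * K ^+ 2 * cg) (K * Num.sqrt (2 * cg * X)).
move=> p1 p2 p3 p4 p5 p6 p7 p8 p9 p10; lra.
Qed.

(** Jensen's inequality through the tangent at the mean: the linear terms sum to zero. *)
Lemma average_gap_le :
  f (T%:R^-1 *: \sum_(1 <= t < T.+1) xbar t) - fs <=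
  T%:R^-1 * \sum_(1 <= t < T.+1) Del t.
Proof.
have T0 : 0 < T%:R :> R by rewrite ltr0n.
set m := T%:R^-1 *: _.
have h : \sum_(1 <= t < T.+1) (f m + dot (grad f m) (xbar t - m)) <=
    \sum_(1 <= t < T.+1) f (xbar t).
  by apply: ler_sum_nat => t _; exact: (convex_grad_le _ _ sf.1 cf).
have z : \sum_(1 <= t < T.+1) dot (grad f m) (xbar t - m) = 0.
  have dot_sum (I : seq nat) (F : nat -> 'rV[R]_d) v :
      \sum_(t <- I) dot v (F t) = dot v (\sum_(t <- I) F t).
    elim: I => [|i I IH]; last by rewrite !big_cons IH dotDr.
    by rewrite !big_nil -(scale0r v) dotZr mul0r.
  rewrite dot_sum sumrB sumr_const_nat subSS subn0 -scaler_nat /m scalerA mulfV ?gt_eqF//.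
  by rewrite scale1r subrr -(scale0r (grad f m)) dotZr mul0r.
rewrite big_split /= z addr0 sumr_const_nat subSS subn0 -mulr_natl in h.
rewrite sumrB sumr_const_nat subSS subn0 -[fs *+ T]mulr_natl mulrBr mulrA mulVf ?gt_eqF//.
by rewrite mul1r lerD2r mulrC ler_pdivlMr// mulrC.
Qed.

End averages.

(** * Assembly *)

Lemma measurable_div_sqrt (R : realType) dT (T : measurableType dT) (c : R)
    (s : T -> R) : (forall t, 0 <= s t) -> measurable_fun [set: T] s ->
  measurable_fun [set: T] (fun t => c / Num.sqrt (s t)).
Proof.
move=> s0 ms; apply: measurable_funM => //.
rewrite (_ : (fun t => _) = (fun t => s t `^ (- 2^-1))).
  exact: (measurableT_comp (measurable_powR (- 2^-1))).
by apply/funext => t; rewrite powRN powR12_sqrt.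
Qed.

Lemma probability_ge_of_bad (R : realType) dO (Omega : measurableType dO)
    (P : probability Omega R) (Good : set Omega) (Bad : nat -> set Omega)
    (n : nat) (delta : R) :
  measurable Good -> (forall k, (k < n)%N -> measurable (Bad k)) ->
  (forall k, (k < n)%N -> (P (Bad k) <= delta%:E)%E) ->
  {ae P, forall w, (forall k, (k < n)%N -> ~ Bad k w) -> Good w} ->
  ((1 - n%:R * delta)%:E <= P Good)%E.
Proof.
move=> mG mB PB [N [mN PN HN]].
(* The null set exempted by the almost sure hypothesis enters the union bound as event number
   [n]. *)
pose F k := if (k < n)%N then Bad k else N.
have mF k : measurable (F k) by rewrite /F; case: ifP => // /mB.
have /(_ n.+1) := @content_subadditive _ _ _ P (~` Good) F.
have -> : (\sum_(k < n.+1) P (F k) = \sum_(k < n) P (Bad k))%E.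
  rewrite big_ord_recr /= {2}/F ltnn PN adde0.
  by apply: eq_bigr => k _; rewrite /F ltn_ord.
move=> H.
have {H} : (P (~` Good) <= \sum_(k < n) P (Bad k))%E.
  apply: H => //; first exact: measurableC.
  move=> w nG; rewrite -bigcup_mkord.
  have [[k kn Bk]|B] := pselect (exists2 k, (k < n)%N & Bad k w).
    by exists k => /=; [exact: ltnW|rewrite /F kn].
  exists n => //=; rewrite /F ltnn; apply: HN => /= /(_ _)/nG; apply.
  by move=> k kn Bk; apply: B; exists k.
have : (\sum_(k < n) P (Bad k) <= (n%:R * delta)%:E)%E.
  apply: le_trans (_ : \sum_(k < n) delta%:E <= _)%E.
    by apply: lee_sum => k _; exact: PB.
  by rewrite sumEFin sumr_const card_ord mulr_natl.
move=> h1 h2; have {h1 h2} := le_trans h2 h1.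
rewrite probability_setC// leeBlDr ?fin_num_measure//.
by rewrite EFinB leeBlDl// => h; rewrite leeBlDr.
Qed.

(** * Adaptedness of the iterates and the noise bound along the run *)

Section adapted.
Variables (R : realType) (d : nat) (dO dZ : measure_display).
Variables (Omega : measurableType dO) (Z : measurableType dZ).
Variables (P : probability Omega R) (D : probability Z R).
Variables (fz : 'rV[R]_d -> Z -> R) (G : 'rV[R]_d -> Z -> 'rV[R]_d).
Variables (T : nat) (z : nat -> {RV P >-> Z}) (x1 : 'rV[R]_d) (eta G0 : R).
Variables (alpha c : nat -> R).
Variables (x xtilde xbar g : nat -> Omega -> 'rV[R]_d).
Hypothesis oracle : gradient_oracle D fz G.
Hypothesis iid : iid_samples D T z.
Hypothesis algo : agd G z T x1 alpha (adaptive_step eta G0 g)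
  (fun t w => c t * adaptive_step eta G0 g t w) x xtilde xbar g.

Local Notation adapted n X := (measurable_fun [set: past z n] (X : _ -> borelRV R d)).

Lemma measurable_sum_sqr n m : (forall k, (1 <= k < m)%N -> adapted n (g k)) ->
  measurable_fun [set: past z n] (fun w => \sum_(1 <= k < m) enorm (g k w) ^+ 2).
Proof.
(* Terms outside the summation range, on which no measurability is assumed, are replaced by 0 so
   that every term is measurable. *)
move=> mg; rewrite (_ : (fun w => _) = (fun w => \sum_(1 <= k < m)
    if (1 <= k < m)%N then enorm (g k w) ^+ 2 else 0)); last first.
  by apply/funext => w; apply: eq_big_nat => k ->.
apply: measurable_sum => k; have [km|_] := boolP (1 <= k < m)%N => //.
by apply: measurable_sqr_enorm; exact: mg.
Qed.

(** Note the shift: the iterates of index [n.+1] are known after [n] samples, the gradients only up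
    to index [n]. The three claims are proved together because each update uses all of them. *)
Lemma agd_adapted n : (n <= T)%N ->
  [/\ adapted n (x n.+1), adapted n (xtilde n.+1)
    & forall k, (1 <= k <= n)%N -> adapted n (g k)].
Proof.
have [_ init step] := algo.
have mcomb m : (m < T)%N -> adapted m (x m.+1) -> adapted m (xtilde m.+1) ->
    adapted m (xbar m.+1).
  move=> mT mx mxt.
  rewrite (_ : xbar m.+1 = fun w => alpha m.+1 *: x m.+1 w + (1 - alpha m.+1) *: xtilde m.+1 w).
    by apply: measurable_rVD; exact: measurable_rVZ.
  by apply/funext => w; have [] := step m.+1 w mT.
elim: n => [_|n IH nT].
  split=> [||k]; last by case: k.
  - rewrite (_ : x 1%N = cst x1); first exact: measurable_cst.
    by apply/funext => w; have [] := init w.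
  - rewrite (_ : xtilde 1%N = cst x1); first exact: measurable_cst.
    by apply/funext => w; have [] := init w.
have [mx mxt mg] := IH (ltnW nT).
have mxb := mcomb n nT mx mxt.
have mg' : adapted n.+1 (g n.+1).
  rewrite (_ : g n.+1 = fun w => G (xbar n.+1 w) (z n.+1 w)).
    apply: (measurable_oracle oracle); first exact: measurable_fun_pastS.
    exact: measurable_sample_past.
  by apply/funext => w; have [] := step n.+1 w nT.
have mgs k : (1 <= k <= n.+1)%N -> adapted n.+1 (g k).
  rewrite andbC leq_eqVlt => /andP[/predU1P[->//|kn k1]].
  by apply: measurable_fun_pastS; apply: mg; rewrite k1.
have mst : measurable_fun [set: past z n.+1] (adaptive_step eta G0 g n.+1).
  apply: measurable_div_sqrt => [w|].
    by rewrite addr_ge0 ?sqr_ge0// sumr_ge0// => k _; rewrite sqr_ge0.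
  by apply: measurable_funD => //; exact: measurable_sum_sqr.
split=> //.
- rewrite (_ : x n.+2 = fun w => x n.+1 w - adaptive_step eta G0 g n.+1 w *: g n.+1 w).
    apply: measurable_rVB; first exact: measurable_fun_pastS.
    exact: measurable_rVZ.
  by apply/funext => w; have [] := step n.+1 w nT.
- rewrite (_ : xtilde n.+2 = fun w =>
      xbar n.+1 w - (c n.+1 * adaptive_step eta G0 g n.+1 w) *: g n.+1 w).
    apply: measurable_rVB; first exact: measurable_fun_pastS.
    by apply: measurable_rVZ => //; exact: measurable_funM.
  by apply/funext => w; have [] := step n.+1 w nT.
Qed.

Lemma xbar_adapted n : (n < T)%N -> adapted n (xbar n.+1).
Proof.
move=> nT; have [mx mxt _] := agd_adapted (ltnW nT); have [_ _ step] := algo.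
rewrite (_ : xbar n.+1 = fun w => alpha n.+1 *: x n.+1 w + (1 - alpha n.+1) *: xtilde n.+1 w).
  by apply: measurable_rVD; exact: measurable_rVZ.
by apply/funext => w; have [] := step n.+1 w nT.
Qed.

Lemma measurable_past_sum_sqr n : (n < T)%N ->
  measurable_fun [set: past z n] (fun w => \sum_(1 <= k < n.+1) enorm (g k w) ^+ 2).
Proof.
move=> nT; have [_ _ mg] := agd_adapted (ltnW nT).
by apply: measurable_sum_sqr => k; rewrite ltnS; exact: mg.
Qed.

Variables (f : 'rV[R]_d -> R) (A B C : R).
Hypothesis bounded : forall y, {ae D, forall s,
  enorm (G y s - grad f y) ^+ 2 <= noise_bound f A B C y}.
Hypothesis cont_f : continuous f.
Hypothesis cont_grad : forall i, continuous (fun y => grad f y 0 i).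

Lemma measurable_delayed_step n : (n < T)%N ->
  measurable_fun [set: past z n] (fun w => delayed_step eta G0 (g^~ w) n.+1).
Proof.
move=> nT; apply: measurable_div_sqrt => [w|].
  by rewrite addr_ge0 ?sqr_ge0// sum_sqr_ge0.
by apply: measurable_funD => //; exact: measurable_past_sum_sqr.
Qed.

Lemma measurable_predictable_step Pa n : (n < T)%N ->
  measurable_fun [set: past z n]
    (fun w => predictable_step f eta G0 Pa (xbar^~ w) (g^~ w) n.+1).
Proof.
move=> nT; apply: measurable_div_sqrt => [w|].
  by rewrite !addr_ge0 ?sqr_ge0// sum_sqr_ge0.
apply: measurable_funD => //; apply: measurable_funD.
  by apply: measurable_funD => //; exact: measurable_past_sum_sqr.
apply: measurable_sqr_enorm.
exact: (measurableT_comp (measurable_grad cont_grad) (xbar_adapted nT)).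
Qed.

(** The hypothesis holds almost surely at each fixed point, with an exceptional set depending on the
    point. Freezing the query point shows that the violation set still has probability zero at the
    random [xbar t], and finitely many relevant times are combined. *)
Lemma ae_noise_le : {ae P, forall w, forall t, (1 <= t <= T)%N ->
  enorm (g t w - grad f (xbar t w)) ^+ 2 <= noise_bound f A B C (xbar t w)}.
Proof.
have [_ _ step] := algo.
apply: ae_foralln => -[|n]; first by apply: aeW => w.
have [nT|nT] := ltnP n T; last by apply: aeW => w; lia.
pose E := [set p : borelRV R d * Z |
  noise_bound f A B C p.1 < enorm (G p.1 p.2 - grad f p.1) ^+ 2].
have mE : measurable E.
  rewrite -[X in measurable X]setTI.
  have -> : E = (fun p : borelRV R d * Z =>
      noise_bound f A B C p.1 < enorm (G p.1 p.2 - grad f p.1) ^+ 2) @^-1` [set true].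
    by apply/seteqP; split.
  apply: measurable_fun_ltr => //.
    apply: (measurableT_comp (measurable_noise_bound A B C cont_f cont_grad)).
    exact: measurable_fst.
  apply: measurable_sqr_enorm; apply: measurable_rVB.
    by apply: (measurable_oracle oracle); [exact: measurable_fst|exact: measurable_snd].
  exact: (measurableT_comp (measurable_grad cont_grad) measurable_fst).
pose h (p : borelRV R d * Z) : \bar R := (\1_E p)%:E.
have mh : measurable_fun [set: borelRV R d * Z] h.
  by apply/measurable_EFinP; exact: measurable_indic.
have h0 p : (0 <= h p)%E by rewrite lee_fin.
have mpair : measurable_fun [set: Omega] (fun w => (xbar n.+1 w : borelRV R d, z n.+1 w)).
  apply: measurable_fun_pair => //; apply: measurable_fun_past; exact: (xbar_adapted nT).
have := integral_past_sample iid nT (xbar_adapted nT) mh h0.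
have inner y : (\int[D]_s h (y, s) = 0)%E.
  transitivity (\int[D]_(s in [set: Z]) (cst 0 s))%E; last exact: integral0.
  apply: ge0_ae_eq_integral.
  - exact: measurableT.
  - by apply: (measurableT_comp mh); exact: measurable_fun_pair.
  - exact: measurable_cst.
  - by move=> s _; exact: h0.
  - by move=> s _; exact: lexx.
  - apply: filterS (bounded y) => s Hs _; rewrite /h /= indicE memNset//.
    by rewrite /E /= ltNge Hs.
under [RHS]eq_integral do rewrite inner.
rewrite integral0.
pose E' := (fun w => (xbar n.+1 w : borelRV R d, z n.+1 w)) @^-1` E.
have mE' : measurable E' by rewrite -[X in measurable X]setTI; exact: mpair.
have -> : (\int[P]_w h (xbar n.+1 w, z n.+1 w) = \int[P]_w (\1_E' w)%:E)%E by [].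
rewrite integral_indic// setIT => PE.
exists E'; split => // w /= nle; apply: contrapT => nE; apply: nle => _.
have [_ -> _ _] := step n.+1 w nT.
by rewrite leNgt; apply/negP.
Qed.

End adapted.

Section logarithms.
Variables (R : realType) (T : nat) (delta : R).
Hypotheses (T1 : (1 <= T)%N) (delta0 : 0 < delta).

Lemma ln2_ge : 1 / 2 <= ln 2 :> R.
Proof.
have := @le_ln1Dx R (- (1 / 2)).
have -> : 1 + - (1 / 2) = 2^-1 :> R by field.
by rewrite lnV ?posrE//; lra.
Qed.

Lemma ln_inv_ge1 : delta < 1 / 4 -> 1 <= ln (1 / delta).
Proof.
move=> d4; have h := ln2_ge.
apply: (@le_trans _ _ (ln (2 * 2))); first by rewrite lnM ?posrE//; lra.
rewrite ler_ln ?posrE ?divr_gt0//.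
by rewrite ler_pdivlMr//; lra.
Qed.

Lemma ln_inv_le_ln_div (a : R) : 1 <= a -> ln (1 / delta) <= ln (a / delta).
Proof.
move=> a1; rewrite ler_ln ?posrE ?divr_gt0// ?(lt_le_trans ltr01)//.
by rewrite ler_pM2r ?invr_gt0.
Qed.

(** This makes the logarithm in the definition of the distance radius at least [ln (1 / delta)], the
    level of the events. *)
Lemma log_factor_ge1 : 1 <= 60 * (ln (4 * T%:R) / ln 2) * ln (6 * T%:R) :> R.
Proof.
have h := ln2_ge; have T1' : 1 <= T%:R :> R by rewrite ler1n.
have l20 : 0 < ln 2 :> R by lra.
have h4 : ln 2 <= ln (4 * T%:R) :> R by rewrite ler_ln ?posrE//; lra.
have h6 : ln 2 <= ln (6 * T%:R) :> R by rewrite ler_ln ?posrE//; lra.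
have h5 : 1 <= ln (4 * T%:R) / ln 2 :> R by rewrite ler_pdivlMr// mul1r.
move: (ln (4 * T%:R) / ln 2) h5 => p p1; nra.
Qed.

End logarithms.

(** * The deterministic argument outside the bad events *)

Section pathwise.
Variables (R : realType) (d : nat) (f : 'rV[R]_d -> R).
Variables (L0 L1 A B C eta G0 Da Pa Ma Ra Dd l : R) (T : nat).
Variables (x xbar g : nat -> 'rV[R]_d) (xstar : 'rV[R]_d).
Hypotheses (L00 : 0 < L0) (L10 : 0 < L1) (sf : L0L1_smooth L0 L1 f).
Hypotheses (A0 : 0 < A) (B0 : 0 < B) (C0 : 0 < C).
Hypotheses (eta0 : 0 < eta) (G00 : 0 < G0) (Da0 : 0 <= Da) (Pa0 : 0 < Pa).
Hypotheses (T1 : (1 <= T)%N) (l1 : 1 <= l) (D0 : 0 <= Dd).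

Local Notation fs := (inf (range f)).
Local Notation Q2 := (L0 * Da + L1 ^+ 2 * Da ^+ 2).
Local Notation H := (ln (1 + 2 * T%:R * (A * Da + 4 * (B + 1) * Q2 + C) / G0 ^+ 2)).
Local Notation xi t := (g t - grad f (xbar t)).

Hypothesis fsP : forall y, fs <= f y.
Hypotheses (fstar : f xstar = fs) (cf : convex_function [set: 'rV[R]_d] f).
Hypothesis Pa2 : Pa ^+ 2 = A * Da + 4 * B * Q2 + C.
Hypotheses (Ma2 : 4 * Q2 <= Ma ^+ 2) (Ma0 : 0 <= Ma).
Hypotheses (etaL1 : eta <= 1 / (8 * L1)) (etaPH : eta * Pa * H <= 1 / 8).
Hypotheses (etaP : eta * Pa <= 1 / 3) (etaLH : (L0 + L1 * Ma) * (eta ^+ 2 * H) <= 1 / 4).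
Hypothesis YDa : (1 + 34 / 128) * (f (x 1%N) - fs + l + 3 / 4)
  + 18 / 128 * (L0 / L1 ^+ 2) <= Da.
Hypotheses (RaP : variance_budget eta G0 Pa T l <= Ra).
Hypothesis Ra7 : 7 * (eta * Pa / G0) ^+ 2 * l <= Ra.
Hypothesis D2 : 2 * enorm (x 1%N - xstar) ^+ 2 + 8 * (eta ^+ 2 * H) + eta ^+ 2 / 2
   + 108 * (Ra * l) <= Dd ^+ 2.

Hypothesis path : perturbed_path eta G0 T x xbar g.
Hypothesis noise : forall t, (1 <= t <= T)%N -> enorm (xi t) ^+ 2 <= noise_bound f A B C (xbar t).

Local Notation U := (Dd + eta).
Local Notation a := (A + 4 * B * (L0 + L1 ^+ 2 * Da)).
Local Notation K := (2 * eta + Dd ^+ 2 / eta + eta * H).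

(* The noise is tested against four predictable directions: 0 controls the
   function values, 1 the accumulated noise, 2 the distances to [xstar] and 3
   the final regret. *)
Definition test_direction (k t : nat) : 'rV[R]_d :=
  match k with
  | 0 => - predictable_step f eta G0 Pa xbar g t *: grad f (xbar t)
  | 1 => - (Pa ^+ 2)^-1 *: grad f (xbar t)
  | 2 => - (Num.sqrt (l / Ra) / (2 * U) * delayed_step eta G0 g t) *: (xbar t - xstar)
  | _ => - Num.min (1 / (2 * a * U ^+ 2)) (Num.sqrt (l / (C * T%:R)) / U) *: (xbar t - xstar)
  end.

Hypothesis event_subgaussian : forall k n, (k < 4)%N -> k != 2%N -> (n <= T)%N ->
  \sum_(1 <= t < n.+1) (dot (test_direction k t) (xi t)
    - enorm (test_direction k t) ^+ 2 * noise_bound f A B C (xbar t) / 2) <= l.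
Hypothesis event_self_normalized : forall n, (n <= T)%N ->
  \sum_(1 <= t < n.+1)
    (if enorm (test_direction 2 t) ^+ 2 * noise_bound f A B C (xbar t) <= 1 / 16 then
       dot (test_direction 2 t) (xi t) - dot (test_direction 2 t) (xi t) ^+ 2 else 0) <= l.

Lemma regret_bound :
  f (T%:R^-1 *: \sum_(1 <= t < T.+1) xbar t) - fs <= T%:R^-1 *
  (2 * G0 * enorm (x 1%N - xstar) ^+ 2 / eta + 4 * eta * H * G0
   + 4 * K ^+ 2 * (A + 4 * (B + 1) * (L0 + L1 ^+ 2 * Da)) + 12 * a * U ^+ 2 * l
   + (7 * U * Num.sqrt (C * l) + 4 * K * Num.sqrt (2 * C)) * Num.sqrt T%:R).
Proof.
have level t : (1 <= t <= T)%N -> f (xbar t) - fs <= Da.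
  apply: (values_bound L00 L10 sf A0 B0 C0 eta0 G00 Da0 Pa0 fsP Pa2
    path noise Ma2 Ma0 etaL1 etaPH etaP etaLH _ YDa).
  by move=> n nT; exact: (event_subgaussian (k := 0)).
have dist n : (n <= T)%N -> enorm (x n.+1 - xstar) <= Dd.
  apply: (distances_bound L00 L10 sf A0 B0 C0 eta0 G00 Da0 Pa0 fsP Pa2
    path noise level l1 _ fstar cf RaP D0 Ra7 D2).
    by move=> m mT; exact: (event_subgaussian (k := 1)).
  exact: event_self_normalized.
have perturb := sum_perturbations_le L00 L10 sf A0 B0 C0 eta0 G00 Da0 fsP Pa2
  path noise level (leqnn T).
apply: le_trans (average_gap_le xbar sf T1 cf) _.
rewrite ler_pM2l ?invr_gt0 ?ltr0n//.
apply: (sum_gap_le L00 L10 sf A0 B0 C0 eta0 G00 Da0 T1 fsP path noise level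
  perturb fstar cf (lt_le_trans ltr01 l1) D0).
- apply: ln_ge0; rewrite lerDl.
  have Q0 : 0 <= Q2.
    by apply: addr_ge0; apply: mulr_ge0; rewrite ?sqr_ge0// ltW.
  have B1 : 0 <= 4 * (B + 1) by rewrite mulr_ge0// addr_ge0// ltW.
  apply: divr_ge0; last exact: sqr_ge0.
  apply: mulr_ge0; first exact: mulr_ge0.
  apply: addr_ge0; last exact: ltW.
  by apply: addr_ge0; apply: mulr_ge0 => //; exact: ltW.
- by case=> // t; rewrite ltnS; exact: dist.
- exact: (event_subgaussian (k := 3)).
Qed.

End pathwise.

(** * Matching the explicit constants *)

Lemma step_conditions (R : realType) (eta M H Pa L1 : R) :
  0 < M -> 0 < H -> 0 < Pa -> 0 < eta ->
  eta <= Num.min (1 / (2 * Num.sqrt (M * H)))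
    (Num.min (1 / (8 * Pa * H)) (Num.min (1 / (3 * Pa)) (1 / (8 * L1)))) ->
  [/\ M * (eta ^+ 2 * H) <= 1 / 4, eta * Pa * H <= 1 / 8, eta * Pa <= 1 / 3
    & eta <= 1 / (8 * L1)].
Proof.
move=> M0 H0 Pa0 eta0; rewrite !le_min => /and4P[eta1 eta2 eta3 ->]; split => //.
- have MH0 : 0 < M * H by rewrite mulr_gt0.
  have s0 : 0 < Num.sqrt (M * H) by rewrite sqrtr_gt0.
  have h1 : eta * (2 * Num.sqrt (M * H)) <= 1 by rewrite -ler_pdivlMr// mulr_gt0.
  have h0 : 0 <= eta * (2 * Num.sqrt (M * H)) by rewrite !mulr_ge0// ltW.
  have := exprn_ile1 2 h0 h1.
  by rewrite !exprMn sqr_sqrtr ?(ltW MH0)//; lra.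
- by move: eta2; rewrite ler_pdivlMr ?mulr_gt0//; lra.
- by move: eta3; rewrite ler_pdivlMr ?mulr_gt0//; lra.
Qed.

(** The factor 7 covers both uses of the budget: [4 * l + 2 <= 6 * l] because [1 <= l], and the
    condition that keeps the truncation inactive. *)
Lemma budget_conditions (R : realType) (eta G0 Pa l lT : R) (T : nat) :
  let Ra := 2 * eta ^+ 2 * ln (1 + T%:R * Pa ^+ 2 / (2 * G0 ^+ 2))
            + 7 * eta ^+ 2 / G0 ^+ 2 * Pa ^+ 2 * lT in
  0 < eta -> 0 < G0 -> 0 < Pa -> 1 <= l -> l <= lT ->
  [/\ variance_budget eta G0 Pa T l <= Ra, 7 * (eta * Pa / G0) ^+ 2 * l <= Ra
    & 0 < Ra].
Proof.
move=> Ra eta0 G00 Pa0 l1 lle.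
have e2 : 0 < eta ^+ 2 by rewrite exprn_gt0.
have G2 : 0 < G0 ^+ 2 by rewrite exprn_gt0.
have P2 : 0 < Pa ^+ 2 by rewrite exprn_gt0.
pose q := eta ^+ 2 * (Pa ^+ 2 / G0 ^+ 2).
have q0 : 0 < q by rewrite mulr_gt0// divr_gt0.
pose lg := ln (1 + T%:R * Pa ^+ 2 / (2 * G0 ^+ 2)).
have lg0 : 0 <= eta ^+ 2 * lg.
  rewrite mulr_ge0 ?(ltW e2)// ln_ge0// lerDl.
  by apply: divr_ge0; apply: mulr_ge0 => //; exact: ltW.
have -> : Ra = 2 * (eta ^+ 2 * lg) + 7 * (q * lT) by rewrite /Ra /q /lg; ring.
have -> : variance_budget eta G0 Pa T l = (4 * l + 2) * q + 2 * (eta ^+ 2 * lg).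
  by rewrite /variance_budget -/lg /q; ring.
have -> : 7 * (eta * Pa / G0) ^+ 2 * l = 7 * (q * l).
  by rewrite /q; field; rewrite gt_eqF.
have := ler_wpM2l (ltW q0) lle; have := ler_wpM2l (ltW q0) l1.
by move: (eta ^+ 2 * lg) lg0 => ? ?; split; lra.
Qed.

(** The coefficient 108 from the distance induction is covered by [32 * 16], as [l <= la]. *)
Lemma radius_condition (R : realType) (X Ra eH eta l la W b c : R) :
  0 <= X -> 0 < Ra -> 0 <= eH -> 0 <= b -> 0 <= c -> 1 <= l -> l <= la ->
  2 * X + 8 * eH + eta ^+ 2 / 2 + 108 * (Ra * l) <=
  Num.sqrt (2 * X + 4 * Ra + 10 * eH + eta ^+ 2 / 2 + 32 * (16 * la * Ra + W ^+ 2 * b) + c) ^+ 2.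
Proof.
move=> X0 Ra0 eH0 b0 c0 l1 lla.
have h1 : Ra * l <= la * Ra by rewrite mulrC ler_wpM2r// ltW.
have h2 : 0 <= W ^+ 2 * b by rewrite mulr_ge0 ?sqr_ge0.
have h3 : Ra <= Ra * l by rewrite ler_peMr// ltW.
have h4 := sqr_ge0 eta.
have h5 : 2 * X + 8 * eH + eta ^+ 2 / 2 + 108 * (Ra * l) <=
  2 * X + 4 * Ra + 10 * eH + eta ^+ 2 / 2 + 32 * (16 * la * Ra + W ^+ 2 * b) + c by lra.
by rewrite sqr_sqrtr//; apply: le_trans h5; lra.
Qed.

(** The pathwise bound has the radius [Dd + eta]; the final form has the larger [Dd + 1 / (8 * L1)],
    and the factor [Num.sqrt T%:R / T%:R] becomes [1 / Num.sqrt T%:R]. *)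
Lemma radius_widen (R : realType) (eta V U a l s p q r k : R) (T : nat) :
  (1 <= T)%N -> 0 <= U -> U <= V -> 0 <= a -> 0 <= l -> 0 <= s ->
  T%:R^-1 * (p + q + r + 12 * a * U ^+ 2 * l + (7 * U * s + k) * Num.sqrt T%:R)
  <= (12 * a * V ^+ 2 * l + p) * (1 / T%:R) + (r + q) * (1 / T%:R)
     + (7 * V * s + k) / Num.sqrt T%:R.
Proof.
move=> T1 U0 UV a0 l0 s0.
have T0 : 0 < T%:R :> R by rewrite ltr0n.
have t0 : 0 < Num.sqrt T%:R :> R by rewrite sqrtr_gt0.
have tE : T%:R = Num.sqrt T%:R ^+ 2 :> R by rewrite sqr_sqrtr ?ltW.
have -> : (7 * V * s + k) / Num.sqrt T%:R =
    T%:R^-1 * ((7 * V * s + k) * Num.sqrt T%:R) :> R.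
  have -> : T%:R^-1 = (Num.sqrt T%:R ^+ 2)^-1 :> R by rewrite -tE.
  by field; rewrite gt_eqF.
rewrite div1r -![_ * T%:R^-1]mulrC -!mulrDr ler_pM2l ?invr_gt0//.
have h1 : a * U ^+ 2 * l <= a * V ^+ 2 * l.
  by rewrite ler_wpM2r// ler_wpM2l// ler_pXn2r ?nnegrE// (le_trans U0).
have h2 : U * s * Num.sqrt T%:R <= V * s * Num.sqrt T%:R.
  by rewrite ler_wpM2r ?(ltW t0)// ler_wpM2r.
move: (Num.sqrt T%:R) h1 h2 => t; lra.
Qed.

(** * The algorithms on the sample space and their bad events *)

Section high_probability.
Variables (R : realType) (d : nat) (dO dZ : measure_display).
Variables (Omega : measurableType dO) (Z : measurableType dZ).
Variables (P : probability Omega R) (D : probability Z R).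
Variables (fz : 'rV[R]_d -> Z -> R) (G : 'rV[R]_d -> Z -> 'rV[R]_d).
Variables (f : 'rV[R]_d -> R).
Variables (L0 L1 A B C eta G0 Da Pa Ra Dd l : R) (T : nat) (z : nat -> {RV P >-> Z}).
Variables (delta : R) (x1 xstar : 'rV[R]_d).
Variables (x xtilde xbar g : nat -> Omega -> 'rV[R]_d).
Hypotheses (eta0 : 0 < eta) (G00 : 0 < G0) (delta0 : 0 < delta).
Hypotheses (L00 : 0 < L0) (L10 : 0 < L1) (sf : L0L1_smooth L0 L1 f).
Hypothesis oracle : gradient_oracle D fz G.
Hypothesis iid : iid_samples D T z.
Hypothesis unbiased : forall y (i : 'I_d),
  'E_D[(fun s => G y s 0 i)%R]%E = (grad f y 0 i)%:E.
Hypothesis bounded : forall y, {ae D, forall s,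
  enorm (G y s - grad f y) ^+ 2 <= noise_bound f A B C y}.
Hypothesis noise_bound_ge0 : forall y, 0 <= noise_bound f A B C y.
Hypothesis algo : adagrad_norm G z T x1 eta G0 x xtilde xbar g \/
  rsag G z T x1 eta G0 x xtilde xbar g.

Local Notation v k t w := (test_direction f L0 L1 A B C eta G0 Da Pa Ra Dd l T
  (xbar^~ w) (g^~ w) xstar k t).
Local Notation xi t w := (g t w - grad f (xbar t w)).
Local Notation sigma2 := (noise_bound f A B C).

Lemma algorithm_path w : perturbed_path eta G0 T (x^~ w) (xbar^~ w) (g^~ w).
Proof.
case: algo => [[alpha]|] [_ init step].
- apply: (adagrad_norm_path eta0 G00 (xtilde := xtilde^~ w) _ (alpha := alpha)).
    by have [-> ->] := init w.
  by move=> t tT; have [] := step t w tT.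
- apply: (rsag_path eta0 G00 (xtilde := xtilde^~ w)).
    by have [-> ->] := init w.
  by move=> t tT; have [] := step t w tT.
Qed.

(** Writing [gamma] as a deterministic multiple of [theta], with factor 1 or [1 + alpha], lets
    measurability be treated once for both algorithms. *)
Lemma algorithm_agd : exists alpha c,
  agd G z T x1 alpha (adaptive_step eta G0 g)
    (fun t w => c t * adaptive_step eta G0 g t w) x xtilde xbar g.
Proof.
case: algo => [[alpha algo1]|algo1].
  exists alpha, (fun=> 1); rewrite (_ : (fun t w => _) = adaptive_step eta G0 g)//.
  by apply/funext => t; apply/funext => w; rewrite mul1r.
by exists (fun t => 2 / t.+1%:R), (fun t => 1 + 2 / t.+1%:R).
Qed.

Let cont_f : continuous f.
Proof. by move=> y; apply: differentiable_continuous; exact: sf.1. Qed.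

Let cont_grad i : continuous (fun y => grad f y 0 i).
Proof. exact: (continuous_grad L00 L10 sf). Qed.

Lemma test_direction_adapted k n : (n < T)%N ->
  measurable_fun [set: past z n] (fun w => v k n.+1 w : borelRV R d).
Proof.
move=> nT; have [alpha [c ag]] := algorithm_agd.
have mxb := xbar_adapted oracle ag nT.
have mg := measurableT_comp (measurable_grad cont_grad) mxb.
have mu : measurable_fun [set: past z n] (fun w => xbar n.+1 w - xstar : borelRV R d).
  by apply: measurable_rVB => //; exact: measurable_cst.
case: k => [|[|[|k]]] /=; apply: measurable_rVZ => //.
- by apply: measurable_funN; exact: (measurable_predictable_step oracle ag).
- apply: measurable_funN; apply: measurable_funM => //.
  exact: (measurable_delayed_step oracle ag).
Qed.

Local Notation event k Bad := [/\ measurable Bad, (P Bad <= delta%:E)%E &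
  forall w, ~ Bad w -> forall n, (n <= T)%N ->
  if k == 2 then
    \sum_(1 <= t < n.+1)
      (if enorm (v k t w) ^+ 2 * sigma2 (xbar t w) <= 1 / 16 then
        dot (v k t w) (xi t w) - dot (v k t w) (xi t w) ^+ 2 else 0) <= ln (1 / delta)
  else
    \sum_(1 <= t < n.+1)
      (dot (v k t w) (xi t w) - enorm (v k t w) ^+ 2 * sigma2 (xbar t w) / 2)
      <= ln (1 / delta)].

Lemma algorithm_event k : exists Bad, event k Bad.
Proof.
have [alpha [c ag]] := algorithm_agd; have [_ _ step] := ag.
pose psi := if k == 2 then self_normalized_exponent G f A B C
  else subgaussian_exponent G f A B C.
pose W t w : borelRV R d * borelRV R d := (xbar t w, v k t w).
have mpsi : measurable_fun [set: borelRV R d * borelRV R d * Z] psi.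
  rewrite /psi; case: ifP => _.
    exact: (measurable_self_normalized_exponent A B C oracle cont_f cont_grad).
  exact: (measurable_subgaussian_exponent A B C oracle cont_f cont_grad).
have mW n : (n < T)%N -> measurable_fun [set: past z n] (W n.+1).
  move=> nT; apply: measurable_fun_pair; first exact: (xbar_adapted oracle ag nT).
  exact: test_direction_adapted.
have psi1 s : (\int[D]_y (expR (psi (s, y)))%:E <= 1)%E.
  rewrite /psi; case: ifP => _.
    exact: (integral_self_normalized_exponent oracle unbiased bounded noise_bound_ge0).
  exact: (integral_subgaussian_exponent oracle unbiased bounded noise_bound_ge0).
have [Bad [mB PB HB]] := maximal_inequality iid delta0 mpsi mW psi1.
exists Bad; split => // w nB n nT; move: (HB w nB n nT).
rewrite /psi; case: ifP => _; apply: le_trans; rewrite le_eqVlt; apply/orP; left; apply/eqP;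
  apply: eq_big_nat => t tn; have [_ -> _ _] := step t w (range_trans nT tn) => //.
Qed.

Lemma measurable_average_gap (c : R) :
  measurable [set w | f (T%:R^-1 *: \sum_(1 <= t < T.+1) xbar t w) - inf (range f) <= c].
Proof.
have [alpha [c' ag]] := algorithm_agd.
have mxb t : (1 <= t <= T)%N -> measurable_fun [set: Omega] (xbar t : _ -> borelRV R d).
  case: t => // t tT; apply: measurable_fun_past; exact: (xbar_adapted oracle ag tT).
have mavg : measurable_fun [set: Omega]
    (fun w => T%:R^-1 *: \sum_(1 <= t < T.+1) xbar t w : borelRV R d).
  apply: measurable_rVZ => //; apply: measurable_rV => i.
  rewrite (_ : (fun w => _) = (fun w => \sum_(1 <= t < T.+1)
      if (1 <= t < T.+1)%N then xbar t w 0 i else 0)); last first.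
    by apply/funext => w; rewrite summxE; apply: eq_big_nat => t ->.
  apply: measurable_sum => t; have [tT|_] := boolP (1 <= t < T.+1)%N => //.
  exact: (measurableT_comp (@measurable_coord R d i) (mxb t tT)).
have mf := measurableT_comp (continuous_measurable_rV cont_f) mavg.
rewrite -[X in measurable X]setTI.
have -> : [set w | f (T%:R^-1 *: \sum_(1 <= t < T.+1) xbar t w) - inf (range f) <= c] =
  (fun w => f (T%:R^-1 *: \sum_(1 <= t < T.+1) xbar t w)) @^-1` `]-oo, c + inf (range f)].
  by apply/seteqP; split => w /=; rewrite in_itv /= lerBlDr.
exact: mf.
Qed.

End high_probability.

Theorem theorem4 (R : realType) (d : nat)
  (dO dZ : measure_display)
  (Omega : measurableType dO) (Z : measurableType dZ)
  (P : probability Omega R) (D : probability Z R)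
  (fz : 'rV[R]_d -> {RV D >-> R}) (G : 'rV[R]_d -> Z -> 'rV[R]_d)
  (f : 'rV[R]_d -> R)
  (T : nat) (z : nat -> {RV P >-> Z})
  (delta L0 L1 A B C eta G0 : R) (x1 xstar : 'rV[R]_d)
  (x xtilde xbar g : nat -> Omega -> 'rV[R]_d) :
  let fstar : R := inf (range f) in
  let Delta1 : R := f x1 - fstar in
  let Deltaa : R := 8 / 5 * Delta1 + 8 / 5 * ln (T%:R / delta) + 8 / 5
                + 303 * L0 / (1120 * L1 ^+ 2) in
  let Ma : R := L0 / (8 * L1)
            + 9 / 4 * Num.sqrt (L0 * Deltaa + L1 ^+ 2 * Deltaa ^+ 2) in
  let Pa : R := Num.sqrt (A * Deltaa
                      + 4 * B * (L0 * Deltaa + L1 ^+ 2 * Deltaa ^+ 2) + C) in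
  let H : R := ln (1 + 2 * T%:R
                   * (A * Deltaa
                      + 4 * (B + 1) * (L0 * Deltaa + L1 ^+ 2 * Deltaa ^+ 2) + C)
                   / G0 ^+ 2) in
  let log2 := fun y : R => ln y / ln 2 in
  let ATd : R := 16 * ln (60 * log2 (4 * T%:R) * ln (6 * T%:R) / delta) in
  let BTd : R := 16 * ln (60 * log2 (4 * T%:R) * ln (6 * T%:R) / delta) ^+ 2 in
  let Wa : R := eta * Num.sqrt (A * Deltaa + C) / G0 + eta * Num.sqrt B in
  let Ra : R := 2 * eta ^+ 2 * ln (1 + T%:R * Pa ^+ 2 / (2 * G0 ^+ 2))
            + 7 * eta ^+ 2 / G0 ^+ 2 * Pa ^+ 2 * ln (T%:R / delta) in
  let Da : R := Num.sqrt (2 * enorm (x1 - xstar) ^+ 2 + 4 * Ra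
                      + 10 * eta ^+ 2 * H + eta ^+ 2 / 2
                      + 32 * (ATd * Ra + Wa ^+ 2 * BTd)
                      + 8 / eta ^+ 2 * Ra ^+ 2) in
  (1 <= T)%N ->
  0 < delta < 1 ->
  0 < L0 -> 0 < L1 ->
  0 < A -> 0 < B -> 0 < C ->
  (forall y, 'E_D[fz y]%E = (f y)%:E) ->
  gradient_oracle D fz G ->
  iid_samples D T z ->
  L0L1_smooth L0 L1 f ->
  convex_function [set: 'rV[R]_d] f ->
  (forall y, f xstar <= f y) ->
  has_lbound (range f) ->
  (forall y (i : 'I_d), 'E_D[(fun s => G y s 0 i)%R]%E = (grad f y 0 i)%:E) ->
  (forall y, {ae D, forall s,
    enorm (G y s - grad f y) ^+ 2
      <= A * (f y - fstar) + B * enorm (grad f y) ^+ 2 + C}) ->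
  0 < G0 ->
  0 < eta ->
  eta <= Num.min (1 / (2 * Num.sqrt ((L0 + L1 * Ma) * H)))
          (Num.min (1 / (8 * Pa * H)) (Num.min (1 / (3 * Pa)) (1 / (8 * L1)))) ->
  adagrad_norm G z T x1 eta G0 x xtilde xbar g \/
  rsag G z T x1 eta G0 x xtilde xbar g ->
  ((1 - 4 * delta)%:E <=
   P [set w |
      f (T%:R^-1 *: \sum_(1 <= t < T.+1) xbar t w) - fstar
      <= (12 * (A + 4 * B * (L0 + L1 ^+ 2 * Deltaa))
            * (Da + 1 / (8 * L1)) ^+ 2 * ln (1 / delta)
          + 2 * G0 * enorm (x1 - xstar) ^+ 2 / eta) * (1 / T%:R)
       + (4 * (2 * eta + Da ^+ 2 / eta + eta * H) ^+ 2
            * (A + 4 * (B + 1) * (L0 + L1 ^+ 2 * Deltaa))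
          + 4 * eta * H * G0) * (1 / T%:R)
       + (7 * (Da + 1 / (8 * L1)) * Num.sqrt (C * ln (1 / delta))
          + 4 * (2 * eta + Da ^+ 2 / eta + eta * H) * Num.sqrt (2 * C))
         / Num.sqrt T%:R]%R)%E.
Proof.
move=> fstar Delta1 Deltaa Ma Pa H log2 ATd BTd Wa Ra Da T1 /andP[delta0 delta1] L00 L10 A0 B0 C0.
move=> _ oracle iid sf cf fmin flb unbiased bounded G00 eta0 etale algo.
(* For [1 / 4 <= delta] the claimed probability is nonpositive; otherwise [1 <= ln (1 / delta)]. *)
have [d4|d4] := leP (1 / 4) delta.
  apply: le_trans (measure_ge0 P _); rewrite lee_fin; lra.
have l1 := ln_inv_ge1 delta0 d4.
have T1' : 1 <= T%:R :> R by rewrite ler1n.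
have lT := ln_inv_le_ln_div delta0 T1'.
have llog := ln_inv_le_ln_div delta0 (log_factor_ge1 R T1).
pose l := ln (1 / delta).
rewrite -/l in l1 lT llog *.
have fs : f xstar = fstar.
  apply/eqP; rewrite eq_le; apply/andP; split.
    by apply: lb_le_inf => [|_ [y _ <-]]; [exists (f xstar), xstar|].
  by apply: ge_inf => //; exists xstar.
have fsP y : fstar <= f y by rewrite -fs.
have nb0 y : 0 <= noise_bound f A B C y.
  rewrite /noise_bound; apply: addr_ge0; last exact: ltW.
  apply: addr_ge0; apply: mulr_ge0; [exact: ltW| |exact: ltW|exact: sqr_ge0].
  by rewrite subr_ge0; exact: fsP.
have Delta0 : 0 <= Delta1 by rewrite subr_ge0.
have LL0 : 0 < L0 / L1 ^+ 2 by rewrite divr_gt0// exprn_gt0.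
have DaE : Deltaa = 8 / 5 * Delta1 + 8 / 5 * ln (T%:R / delta) + 8 / 5
    + 303 / 1120 * (L0 / L1 ^+ 2).
  rewrite /Deltaa; congr (_ + _); field; rewrite gt_eqF//.
have Da1 : 1 <= Deltaa by rewrite DaE; lra.
have Da0 : 0 <= Deltaa by lra.
have Q0 : 0 < L0 * Deltaa + L1 ^+ 2 * Deltaa ^+ 2.
  by apply: ltr_pwDl; [rewrite mulr_gt0//; lra|rewrite mulr_ge0// sqr_ge0].
have AD0 : 0 < A * Deltaa by rewrite mulr_gt0//; lra.
have BQ0 := mulr_gt0 B0 Q0.
have Pa2 : Pa ^+ 2 = A * Deltaa + 4 * B * (L0 * Deltaa + L1 ^+ 2 * Deltaa ^+ 2) + C.
  by rewrite sqr_sqrtr//; lra.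
have Pa0 : 0 < Pa by rewrite sqrtr_gt0; lra.
have H0 : 0 < H.
  apply: ln_gt0; rewrite ltrDl; apply: divr_gt0; last exact: exprn_gt0.
  by apply: mulr_gt0; [rewrite mulr_gt0// (lt_le_trans ltr01)|lra].
have sQ0 : 0 <= Num.sqrt (L0 * Deltaa + L1 ^+ 2 * Deltaa ^+ 2) by exact: sqrtr_ge0.
have L01 : 0 < L0 / (8 * L1) by rewrite divr_gt0// mulr_gt0.
have Ma0 : 0 <= Ma by rewrite /Ma; lra.
(* The coefficient 9/4 of the root in [Ma] exceeds the 2 required for gradients at level
   [Deltaa]. *)
have Ma2 : 4 * (L0 * Deltaa + L1 ^+ 2 * Deltaa ^+ 2) <= Ma ^+ 2.
  rewrite -[X in 4 * X](sqr_sqrtr (ltW Q0)).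
  move: sQ0; rewrite /Ma; move: (Num.sqrt _) (L0 / (8 * L1)) L01 => p q q0 p0; nra.
have LM0 : 0 < L0 + L1 * Ma by rewrite ltr_pwDl// mulr_ge0// ltW.
have [etaLH etaPH etaP etaL1] := step_conditions LM0 H0 Pa0 eta0 etale.
(* Coefficients are compared one by one: [1 + 34 / 128 <= 8 / 5], also after multiplying the left
   side by 3/4, [18 / 128 <= 303 / 1120], and [l <= ln (T%:R / delta)]. *)
have YDa : (1 + 34 / 128) * (f x1 - inf (range f) + l + 3 / 4)
    + 18 / 128 * (L0 / L1 ^+ 2) <= Deltaa.
  have -> : f x1 - inf (range f) = Delta1 by [].
  by rewrite DaE; lra.
have [RaP Ra7 Ra0] := budget_conditions T eta0 G00 Pa0 l1 lT.
rewrite -/Ra in RaP Ra7 Ra0.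
have D2 : 2 * enorm (x1 - xstar) ^+ 2 + 8 * (eta ^+ 2 * H) + eta ^+ 2 / 2 + 108 * (Ra * l)
    <= Da ^+ 2.
  rewrite /Da -[10 * _ * H]mulrA; apply: radius_condition => //.
  - exact: sqr_ge0.
  - by rewrite mulr_ge0 ?sqr_ge0 ?(ltW H0).
  - by rewrite mulr_ge0 ?sqr_ge0.
  - by rewrite mulr_ge0 ?divr_ge0 ?sqr_ge0.
have D0 : 0 <= Da by exact: sqrtr_ge0.
have /choice[Bad HBad] := @algorithm_event _ _ _ _ _ _ P D fz G f L0 L1 A B C eta G0 Deltaa
  Pa Ra Da l T z delta x1 xstar x xtilde xbar g delta0 L00 L10 sf oracle iid unbiased bounded
  nb0 algo.
have [alpha [c ag]] := algorithm_agd algo.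
have cont_f : continuous f by move=> y; apply: differentiable_continuous; exact: sf.1.
have noise := ae_noise_le oracle iid ag bounded cont_f (continuous_grad L00 L10 sf).
apply: (probability_ge_of_bad (Bad := Bad)).
- exact: (measurable_average_gap sf oracle algo).
- by move=> k _; have [] := HBad k.
- by move=> k _; have [] := HBad k.
- apply: filterS noise => w noise_w nBad /=.
  have init : x 1%N w = x1 by have [_ /(_ w)[]] := ag.
  have path := algorithm_path eta0 G00 algo w.
  rewrite -init in YDa D2 *.
  have reg := regret_bound L00 L10 sf A0 B0 C0 eta0 G00 Da0 Pa0 T1 l1 D0 fsP fs cf Pa2 Ma2 Ma0
    etaL1 etaPH etaP etaLH YDa RaP Ra7 D2 path noise_w.
  apply: le_trans (reg _ _) _.
  - move=> k n k4 k2 nT.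
    by have [_ _ /(_ w (nBad k k4) n nT)] := HBad k; rewrite (negbTE k2).
  - by move=> n nT; have [_ _ /(_ w (nBad 2%N isT) n nT)] := HBad 2%N.
  apply: radius_widen => //.
  - by rewrite addr_ge0// ltW.
  - by rewrite lerD2l.
  - apply: addr_ge0 (ltW A0) (mulr_ge0 _ _); first by rewrite mulr_ge0 ?(ltW B0).
    exact: addr_ge0 (ltW L00) (mulr_ge0 (sqr_ge0 L1) Da0).
  - by rewrite (le_trans ler01).
Qed.
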